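(* For every constant $0<c\le1$ there is a polynomial-time algorithm for Maximum Coverage with cardinality bound $k=cn$ that achieves an approximation ratio of $\rho(c)$ when the instance is accessed only through a value oracle for the weighted coverage function $f(T)=\sum_{e\in\bigcup_{i\in T}S_i}w_e$, $T\subseteq[n]$ (i.e. it makes polynomially many oracle queries and outputs $X\subseteq[n]$, $|X|\le k$, with $f(X)\ge\rho(c)\max_{|Y|\le k}f(Y)$).
   Context: Maximum Coverage (MC): given a finite set of elements $E$ with weights $w\colon E\to\mathbb{R}_{\ge0}$, sets $S_1,\dots,S_n\subseteq E$ and an integer $k$, find $X\subseteq[n]$ with $|X|\le k$ maximizing $\sum_{e\in\bigcup_{i\in X}S_i}w_e$. Here $k=cn$ for a constant $c\in(0,1]$ ($cn$ an integer). A value oracle for $f$ returns $f(T)$ on query $T$. Definition of $\rho(c)$: for $\alpha\in[0,1]$ and integer $m\ge1$ let $\sigma(\alpha,m)=\bigl(1-\alpha c-(1-\alpha)/m\bigr)^m$. If $c=1/s$ for some integer $s\ge1$, then $\rho(c)=1-(1-c)^{1/c}$. Otherwise $1/(s+1)<c<1/s$ for a unique integer $s\ge1$, there is a unique $\alpha^*\in(0,1)$ with $\sigma(\alpha^*,s)=\sigma(\alpha^*,s+1)$, and $\rho(c)=1-\sigma(\alpha^*,s)$. *)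

(* Defs.v *)
From HB Require Import structures.
From mathcomp Require Import all_boot all_order all_algebra.
From mathcomp Require Import reals.
Set Implicit Arguments. Unset Strict Implicit. Unset Printing Implicit Defensive.
Import Order.TTheory GRing.Theory Num.Theory.
Local Open Scope ring_scope.

Definition cov (R : realType) (E : finType) (n : nat)
  (S : 'I_n -> {set E}) (w : E -> R) (T : {set 'I_n}) : R :=
  \sum_(e in \bigcup_(i in T) S i) w e.

Definition sigma (R : realType) (c alpha : R) (m : nat) : R :=
  (1 - alpha * c - (1 - alpha) / m%:R) ^+ m.

(* is_rho c r  <->  r = rho(c)  (per the definition in the paper; alpha* is
   unique, so quantifying over all witnesses alpha is harmless). *)
Definition is_rho (R : realType) (c r : R) : Prop :=
  (exists s : nat, (1 <= s)%N /\ c = 1 / s%:R /\ r = 1 - (1 - c) ^+ s)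
  \/
  (exists s : nat, (1 <= s)%N /\ 1 / s.+1%:R < c /\ c < 1 / s%:R /\
     exists alpha : R, 0 < alpha /\ alpha < 1 /\
       sigma c alpha s = sigma c alpha s.+1 /\ r = 1 - sigma c alpha s).

(* Machine model: a unit-cost RAM with natural-number registers         *)
(* (only +, truncated -, comparison, indirect addressing) and real      *)
(* registers (field operations, comparison, as in the real-RAM/BSS      *)
(* model), plus a value-oracle instruction.  A query set T is given by  *)
(* a bitmask in a nat register.                                         *)
Inductive instr : Type :=
| NSet (d m : nat)
| NAdd (d a b : nat)
| NSub (d a b : nat)
| NLoad (d a : nat)
| NStore (a s : nat)
| NJlt (a b t : nat)
| Jmp (t : nat)
| RZero (d : nat)
| ROne (d : nat)
| RAdd (d a b : nat)
| RSub (d a b : nat)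
| RMul (d a b : nat)
| RDiv (d a b : nat)
| ROfN (d a : nat)
| RLoad (d a : nat)
| RStore (a s : nat)
| RJlt (a b t : nat)
| Query (d a : nat)
| Halt.

Record config (R : realType) := Config {
  pc : nat; nreg : nat -> nat; rreg : nat -> R }.

Definition upd (T : Type) (f : nat -> T) (i : nat) (v : T) : nat -> T :=
  fun j => if j == i then v else f j.

Definition step (R : realType) (P : seq instr) (orc : nat -> R)
  (cf : config R) : option (config R) :=
  let: Config p N Rg := cf in
  if (size P <= p)%N then None else
  match nth Halt P p with
  | NSet d m => Some (Config p.+1 (upd N d m) Rg)
  | NAdd d a b => Some (Config p.+1 (upd N d (N a + N b)%N) Rg)
  | NSub d a b => Some (Config p.+1 (upd N d (N a - N b)%N) Rg)
  | NLoad d a => Some (Config p.+1 (upd N d (N (N a))) Rg)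
  | NStore a s => Some (Config p.+1 (upd N (N a) (N s)) Rg)
  | NJlt a b t => Some (Config (if (N a < N b)%N then t else p.+1) N Rg)
  | Jmp t => Some (Config t N Rg)
  | RZero d => Some (Config p.+1 N (upd Rg d 0))
  | ROne d => Some (Config p.+1 N (upd Rg d 1))
  | RAdd d a b => Some (Config p.+1 N (upd Rg d (Rg a + Rg b)))
  | RSub d a b => Some (Config p.+1 N (upd Rg d (Rg a - Rg b)))
  | RMul d a b => Some (Config p.+1 N (upd Rg d (Rg a * Rg b)))
  | RDiv d a b => Some (Config p.+1 N (upd Rg d (Rg a / Rg b)))
  | ROfN d a => Some (Config p.+1 N (upd Rg d (N a)%:R))
  | RLoad d a => Some (Config p.+1 N (upd Rg d (Rg (N a))))
  | RStore a s => Some (Config p.+1 N (upd Rg (N a) (Rg s)))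
  | RJlt a b t => Some (Config (if Rg a < Rg b then t else p.+1) N Rg)
  | Query d a => Some (Config p.+1 N (upd Rg d (orc (N a))))
  | Halt => None
  end.

Fixpoint exec (R : realType) (P : seq instr) (orc : nat -> R) (t : nat)
  (cf : config R) : option (config R) :=
  match step P orc cf with
  | None => Some cf
  | Some cf' => match t with 0 => None | t'.+1 => exec P orc t' cf' end
  end.

Definition decode (n m : nat) : {set 'I_n} :=
  [set i : 'I_n | odd (m %/ 2 ^ i)].

Definition init (R : realType) (n k : nat) : config R :=
  Config 0 (fun j => if j == 0%N then n else if j == 1%N then k else 0%N)
    (fun _ => 0).

(* Main.v *)
(** With value queries to f one can compute, by inclusion-exclusion, the weight
    of the elements whose first M members (in index order) are exactly a given
    set A; truncating every element to its first M members only lowers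
    coverage, and leaves an explicit instance of polynomial size.

    On that instance let G(y) = sum_A w_A (1 - (1 - mean of y over A)^|A|).  It
    is concave, so a local search moving units of mass delta = 1/(K n^3) between
    coordinates maximises it over {0 <= y <= 1, sum y = k} up to O(delta n W),
    W being the total weight.  Comparing with alpha c + (1 - alpha) 1_O for an
    optimal O shows that the maximum is at least rho(c) f(O): an element with m
    members, one of them in O, is missed to the extent of at most
    sigma(alpha, m), and sigma is log-concave in m, hence largest at s and s + 1;
    a truncated element is missed at most (1 - alpha c)^M.  The multilinear
    extension dominates G by AM-GM and is convex in the directions e_i - e_j, so
    pipage rounding loses nothing.

    To absorb the error exactly, guess one j in O of largest f({j}), force it in,
    and force out s members of the complement of O; since c (s + 1) > 1 the
    residual problem has at least the same density k/n, and (1 - rho) f({j}) >=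
    (1 - rho) W / n^2 exceeds the error.  All guesses are tried. *)

(* The only real constants of the machine are 0 and 1, so the program depends on c only through
   natural numbers: s, a truncation length M with (1 - alpha c)^M <= 1 - rho, and K >= 2 / (1 -
   rho). The truncated instance is never stored: for a potential v with v(empty) = 1, the
   contribution 1 - v(A) of an element is the sum of v(C) - v(C + i) over the successive prefixes of
   A, and signed queries over the subsets of C + i single out the elements with exactly this prefix.
   One recursion thus evaluates both G and the multilinear extension; its queries all contain j,
   which removes the elements covered by j.

   An effective sweep of the local search gains more than W delta^2 and G never exceeds W, so
   delta^-2 = K^2 n^6 sweeps suffice. The remaining error is 2 delta W n = 2 W / (K n^2), which K
   makes small enough. The slack (1 - rho) f({j}) vanishes for c = 1, where rho = 1; in this case,
   and whenever at most s indices lie outside O, the guess can name the whole complement of O and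
   the rounding can only return O. *)
Require Import Defs.
From HB Require Import structures.
From mathcomp Require Import all_boot all_order all_algebra.
From mathcomp Require Import reals zify ring lra.
Set Implicit Arguments. Unset Strict Implicit. Unset Printing Implicit Defensive.
Import Order.TTheory GRing.Theory Num.Theory.

(** * A structured language compiled to the machine *)

Arguments upd : simpl never.
Arguments step : simpl never.

Lemma upd_same T (f : nat -> T) i v : upd f i v i = v.
Proof. by rewrite /upd eqxx. Qed.

Lemma upd_diff T (f : nat -> T) i v j : j != i -> upd f i v j = f j.
Proof. by rewrite /upd => /negPf->. Qed.

(* Register conventions: nat registers below 8 are read-only, namely n, k, 1,
   the constant K and 0 in registers 0 to 4; loops are bounded by register 0 or
   3 only; nat register 8 is an address temporary; the array y has y_i at real
   address 2i+1, so real scratch registers are even. *)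
Inductive cmd : Type :=
| Skip
| Bas of instr
| LdY (d i : nat)
| StY (i s : nat)
| Seq (c1 c2 : cmd)
| IfN (a b : nat) (c1 c2 : cmd)
| IfR (a b : nat) (c1 c2 : cmd)
| For (i b : nat) (c : cmd).

Notation "c1 ;; c2" := (Seq c1 c2) (at level 60, right associativity).

(** Jump targets are absolute, hence the start address [p]. A conditional jumps to its first branch,
    so the second one is laid out first. *)
Fixpoint comp (p : nat) (c : cmd) : seq instr :=
  match c with
  | Skip => [::]
  | Bas i => [:: i]
  | LdY d i => [:: NAdd 8 i i; NAdd 8 8 2; RLoad d 8]
  | StY i s => [:: NAdd 8 i i; NAdd 8 8 2; RStore 8 s]
  | Seq c1 c2 => let l1 := comp p c1 in l1 ++ comp (p + size l1)%N c2
  | IfN a b c1 c2 =>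
      let l2 := comp p.+1 c2 in
      let p1 := (p + (size l2).+2)%N in
      let l1 := comp p1 c1 in
      NJlt a b p1 :: l2 ++ Jmp (p1 + size l1)%N :: l1
  | IfR a b c1 c2 =>
      let l2 := comp p.+1 c2 in
      let p1 := (p + (size l2).+2)%N in
      let l1 := comp p1 c1 in
      RJlt a b p1 :: l2 ++ Jmp (p1 + size l1)%N :: l1
  | For i b c =>
      let l := comp (p + 3)%N c in
      NSet i 0 :: NJlt i b (p + 3)%N :: Jmp (p + size l + 5)%N ::
      l ++ [:: NAdd i i 2; Jmp p.+1]
  end.

(** Straight-line instructions without indirect addressing: the register they write can be read off
    the syntax. *)
Definition isbas (i : instr) : bool :=
  match i with
  | NLoad _ _ | NStore _ _ | NJlt _ _ _ | Jmp _ | RLoad _ _ | RStore _ _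
  | RJlt _ _ _ | Halt => false
  | _ => true
  end.

Definition ndst (i : instr) (x : nat) : bool :=
  match i with
  | NSet d _ | NAdd d _ _ | NSub d _ _ => x == d
  | _ => false
  end.

Definition rdst (i : instr) (x : nat) : bool :=
  match i with
  | RZero d | ROne d | RAdd d _ _ | RSub d _ _ | RMul d _ _ | RDiv d _ _
  | ROfN d _ | Query d _ => x == d
  | _ => false
  end.

Fixpoint wrN (c : cmd) (x : nat) : bool :=
  match c with
  | Skip => false
  | Bas i => ndst i x
  | LdY _ _ | StY _ _ => x == 8
  | Seq c1 c2 | IfN _ _ c1 c2 | IfR _ _ c1 c2 => wrN c1 x || wrN c2 x
  | For i b c => (x == i) || wrN c x
  end.

(** The address of an array store is known only at run time, so [StY] counts as a write to every odd
    register. *)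
Fixpoint wrR (c : cmd) (x : nat) : bool :=
  match c with
  | Skip => false
  | Bas i => rdst i x
  | LdY d _ => x == d
  | StY _ _ => odd x
  | Seq c1 c2 | IfN _ _ c1 c2 | IfR _ _ c1 c2 => wrR c1 x || wrR c2 x
  | For i b c => wrR c x
  end.

Definition ndge8 (i : instr) : bool :=
  match i with
  | NSet d _ | NAdd d _ _ | NSub d _ _ => (8 <= d)%N
  | _ => true
  end.

(** Registers below 8 are never written and a body never touches its own counter, so every loop runs
    exactly as often as register 0 or 3 says. *)
Fixpoint wf (c : cmd) : bool :=
  match c with
  | Skip => true
  | Bas i => isbas i && ndge8 i
  | LdY _ i | StY i _ => i != 8
  | Seq c1 c2 | IfN _ _ c1 c2 | IfR _ _ c1 c2 => wf c1 && wf c2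
  | For i b c =>
      [&& (8 <= i)%N, (b == 0%N) || (b == 3), ~~ wrN c i & wf c]
  end.

Section Semantics.
Variables (R : realType) (orc : nat -> R).

Definition st := ((nat -> nat) * (nat -> R))%type.

Definition bas (i : instr) (s : st) : st :=
  let N := s.1 in let Rg := s.2 in
  match i with
  | NSet d m => (upd N d m, Rg)
  | NAdd d a b => (upd N d (N a + N b), Rg)
  | NSub d a b => (upd N d (N a - N b), Rg)
  | RZero d => (N, upd Rg d 0%R)
  | ROne d => (N, upd Rg d 1%R)
  | RAdd d a b => (N, upd Rg d (Rg a + Rg b)%R)
  | RSub d a b => (N, upd Rg d (Rg a - Rg b)%R)
  | RMul d a b => (N, upd Rg d (Rg a * Rg b)%R)
  | RDiv d a b => (N, upd Rg d (Rg a / Rg b)%R)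
  | ROfN d a => (N, upd Rg d (N a)%:R%R)
  | Query d a => (N, upd Rg d (orc (N a)))
  | _ => s
  end.

Definition setN (i t : nat) (s : st) : st := (upd s.1 i t, s.2).

Definition addr (i : nat) (N : nat -> nat) : nat -> nat :=
  let N1 := upd N 8 (N i + N i)%N in upd N1 8 (N1 8 + N1 2)%N.

Definition forloop (F : nat -> st -> st) (m : nat) (s : st) : st :=
  foldl (fun s t => F t s) s (iota 0 m).

Fixpoint den (c : cmd) (s : st) : st :=
  match c with
  | Skip => s
  | Bas i => bas i s
  | LdY d i => let N := addr i s.1 in (N, upd s.2 d (s.2 (N 8)))
  | StY i r => let N := addr i s.1 in (N, upd s.2 (N 8) (s.2 r))
  | Seq c1 c2 => den c2 (den c1 s)
  | IfN a b c1 c2 => if (s.1 a < s.1 b)%N then den c1 s else den c2 s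
  | IfR a b c1 c2 => if (s.2 a < s.2 b)%R then den c1 s else den c2 s
  | For i b c =>
      setN i (s.1 b) (forloop (fun t s' => den c (setN i t s')) (s.1 b) s)
  end.

Lemma forloopS F m s : forloop F m.+1 s = F m (forloop F m s).
Proof. by rewrite /forloop -addn1 iotaD foldl_cat. Qed.

Lemma wf_const c x : wf c -> (x < 8)%N -> wrN c x = false.
Proof.
move=> + hx; elim: c => //=.
- by case=> //= *; lia.
- by move=> *; lia.
- by move=> *; lia.
- by move=> ? h1 ? h2 /andP[/h1-> /h2->].
- by move=> ? ? ? h1 ? h2 /andP[/h1-> /h2->].
- by move=> ? ? ? h1 ? h2 /andP[/h1-> /h2->].
- by move=> i b c0 IH /and4P[? ? ? /IH->]; lia.
Qed.

Lemma frameN c x s : ~~ wrN c x -> (den c s).1 x = s.1 x.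
Proof.
elim: c s => //=.
- by move=> i [N Rg]; case: i => //= *; rewrite upd_diff.
- by move=> d i s h; rewrite /addr /= !upd_diff.
- by move=> d i s h; rewrite /addr /= !upd_diff.
- by move=> c1 IH1 c2 IH2 s; rewrite negb_or => /andP[h1 h2]; rewrite IH2 ?IH1.
- move=> a b c1 IH1 c2 IH2 s; rewrite negb_or => /andP[h1 h2].
  by case: ifP; rewrite (IH1, IH2).
- move=> a b c1 IH1 c2 IH2 s; rewrite negb_or => /andP[h1 h2].
  by case: ifP; rewrite (IH1, IH2).
- move=> i b c IH s; rewrite negb_or => /andP[h1 h2].
  rewrite upd_diff //; elim: (s.1 b) => // m IHm.
  by rewrite forloopS IH //= upd_diff.
Qed.

Lemma den_const c x s : wf c -> (x < 8)%N -> (den c s).1 x = s.1 x.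
Proof. by move=> w h; rewrite frameN // wf_const. Qed.

(** Register 2 has to hold 1: array addresses are then [i + i + 1], hence odd, and a store cannot
    reach the even scratch registers. *)
Lemma frameR c x s : s.1 2 = 1%N -> wf c -> ~~ wrR c x -> (den c s).2 x = s.2 x.
Proof.
elim: c s => //=.
- by move=> i [N Rg]; case: i => //= *; rewrite upd_diff.
- by move=> d i s h1 h2 h; rewrite upd_diff.
- move=> d i s h1 h2 h; rewrite upd_diff //; apply: contra h => /eqP->.
  rewrite /addr /= !upd_same (upd_diff _ _ (_ : 2 != 8)) // h1; lia.
- move=> c1 IH1 c2 IH2 s h /andP[w1 w2]; rewrite negb_or => /andP[h1 h2].
  by rewrite IH2 ?den_const ?IH1.
- move=> a b c1 IH1 c2 IH2 s h /andP[w1 w2]; rewrite negb_or => /andP[h1 h2].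
  by case: ifP; rewrite (IH1, IH2).
- move=> a b c1 IH1 c2 IH2 s h /andP[w1 w2]; rewrite negb_or => /andP[h1 h2].
  by case: ifP; rewrite (IH1, IH2).
- move=> i b c IH s h /and4P[w1 w2 w3 w4] h1.
  suff: forall m, (forloop (fun t s' => den c (setN i t s')) m s).1 2 = 1%N /\
     (forloop (fun t s' => den c (setN i t s')) m s).2 x = s.2 x.
    by move=> /(_ (s.1 b)) [].
  elim=> // m [IH1 IH2]; rewrite forloopS; set s1 := forloop _ _ _ in IH1 IH2 *.
  have e : (setN i m s1).1 2 = 1%N by rewrite /= upd_diff //;
    case: i w1 {h1 w3 IH s1 IH1 IH2} => [|[|[|i]]].
  by rewrite den_const // IH.
Qed.

Definition wr_frame (c : cmd) (s s' : st) : Prop :=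
  (forall x, ~~ wrN c x -> s'.1 x = s.1 x) /\
  (forall x, ~~ wrR c x -> s'.2 x = s.2 x).

(** The step may also use that everything the loop does not write is still as at the start, so an
    invariant need only mention what changes. *)
Lemma for_inv (Inv : nat -> st -> Prop) i b c s :
  s.1 2 = 1%N -> wf (For i b c) -> Inv 0%N s ->
  (forall t s', (t < s.1 b)%N -> wr_frame (For i b c) s s' -> Inv t s' ->
     Inv t.+1 (den c (setN i t s'))) ->
  exists2 s', Inv (s.1 b) s' & den (For i b c) s = setN i (s.1 b) s'.
Proof.
move=> h2 w h0 hS; rewrite [den _ _]/=; eexists; last by [].
move: (s.1 b) hS => m hS; have: (m <= m)%N by [].
suff: forall t, (t <= m)%N ->
   Inv t (forloop (fun t s' => den c (setN i t s')) t s) /\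
   wr_frame (For i b c) s (forloop (fun t s' => den c (setN i t s')) t s).
  by move=> h /h [].
elim=> // t IH ht; have [IH1 IH2] := IH (ltnW ht).
rewrite forloopS; split; first exact: hS.
case: IH2 => f1 f2; move: (w) => /and4P[w1 w2 w3 w4]; split => x.
  move=> hx; rewrite frameN /=; last by move: hx; rewrite /= negb_or => /andP[].
  by rewrite upd_diff ?f1 //; move: hx; rewrite /= negb_or => /andP[].
move=> hx; rewrite frameR //; first exact: f2.
rewrite /= upd_diff; last by move: w1; case: (i) => [|[|[]]].
by rewrite f1 // wf_const.
Qed.

End Semantics.

(** * Worst-case running time and polynomial bounds *)

Fixpoint wc (n K : nat) (c : cmd) : nat :=
  match c with
  | Skip => 0
  | Bas _ => 1
  | LdY _ _ | StY _ _ => 3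
  | Seq c1 c2 => wc n K c1 + wc n K c2
  | IfN _ _ c1 c2 | IfR _ _ c1 c2 => wc n K c1 + wc n K c2 + 2
  | For _ b c => (if b == 0 then n else K) * (wc n K c + 3) + 3
  end%N.

Definition poly_bounded (h : nat -> nat) : Prop :=
  exists a d, forall n, (h n <= a * n ^ d + a)%N.

Lemma poly_const a : poly_bounded (fun=> a).
Proof. by exists a, 0%N => n; lia. Qed.

Lemma poly_id : poly_bounded id.
Proof. by exists 1%N, 1%N => n; lia. Qed.

(** For positive n a bound can be taken of the form a n^d, which is convenient for sums and
    products; the additive constant then only has to absorb the value at 0. *)
Lemma poly_boundedP (h : nat -> nat) a d :
  (forall n, (0 < n)%N -> (h n <= a * n ^ d)%N) -> poly_bounded h.
Proof.
move=> H; exists (a + h 0)%N, d => -[|n]; first by lia.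
by apply: leq_trans (H n.+1 isT) _; rewrite mulnDl -addnA leq_addr.
Qed.

Lemma poly_boundedE h : poly_bounded h ->
  exists a d, forall n, (0 < n)%N -> (h n <= a * n ^ d)%N.
Proof.
move=> [a [d H]]; exists a.*2, d => n n0; apply: leq_trans (H n) _.
have : (0 < n ^ d)%N by rewrite expn_gt0 n0.
by move: (n ^ d)%N => x hx; nia.
Qed.

Lemma polyD f g : poly_bounded f -> poly_bounded g ->
  poly_bounded (fun n => f n + g n)%N.
Proof.
move=> /poly_boundedE[a [d Hf]] /poly_boundedE[b [e Hg]].
apply: (@poly_boundedP _ (a + b) (d + e)) => n n0.
have := Hf n n0; have := Hg n n0; rewrite expnD.
have : (0 < n ^ d)%N by rewrite expn_gt0 n0.
have : (0 < n ^ e)%N by rewrite expn_gt0 n0.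
move: (n ^ d)%N (n ^ e)%N => x y; nia.
Qed.

Lemma polyM f g : poly_bounded f -> poly_bounded g ->
  poly_bounded (fun n => f n * g n)%N.
Proof.
move=> /poly_boundedE[a [d Hf]] /poly_boundedE[b [e Hg]].
apply: (@poly_boundedP _ (a * b) (d + e)) => n n0.
by rewrite expnD mulnACA leq_mul ?Hf ?Hg.
Qed.

Lemma poly_wc K c : poly_bounded (fun n => wc n K c).
Proof.
elim: c => /= [|i|d i|i s|c1 IH1 c2 IH2|a b c1 IH1 c2 IH2|a b c1 IH1 c2 IH2|i b c IH].
- exact: poly_const.
- exact: poly_const.
- exact: poly_const.
- exact: poly_const.
- exact: polyD.
- by do 2?[apply: polyD => //]; apply: poly_const.
- by do 2?[apply: polyD => //]; apply: poly_const.
- apply: polyD; last exact: poly_const.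
  apply: polyM; first by case: eqP => _; [apply: poly_id|apply: poly_const].
  by apply: polyD => //; apply: poly_const.
Qed.

(** * Correctness of the compiler, with step counts *)

Section Compile.
Variables (R : realType) (orc : nat -> R) (P : seq instr).

(** Exactly [t] steps, and no need to halt as in [exec], so that runs of code fragments compose. *)
Fixpoint runs (t : nat) (cf : config R) : option (config R) :=
  if t is t'.+1 then obind (runs t') (step P orc cf) else Some cf.

Lemma runsD t1 t2 cf cf1 : runs t1 cf = Some cf1 ->
  runs (t1 + t2) cf = runs t2 cf1.
Proof.
elim: t1 cf => [|t1 IH] cf /=; first by case=> ->.
by case: (step P orc cf) => //= cf' /IH.
Qed.

Lemma exec_runs t T cf cf1 : runs t cf = Some cf1 -> step P orc cf1 = None ->
  (t <= T)%N -> exec P orc T cf = Some cf1.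
Proof.
elim: t T cf => [|t IH] [|T] cf //=.
- by case=> ->->.
- by case=> ->->.
- by case: (step P orc cf) => //= cf' h1 h2 h3; apply: IH.
Qed.

Definition at_pos (p : nat) (c : seq instr) : Prop :=
  exists pre post, P = pre ++ c ++ post /\ size pre = p.

Lemma at_pos_cat p c1 c2 : at_pos p (c1 ++ c2) ->
  at_pos p c1 /\ at_pos (p + size c1)%N c2.
Proof.
move=> [pre [post [eP <-]]]; split; rewrite /at_pos {}eP.
  by exists pre, (c2 ++ post); rewrite -!catA.
by exists (pre ++ c1), post; rewrite size_cat -!catA.
Qed.

Lemma at_pos_cons p i c : at_pos p (i :: c) ->
  [/\ (p < size P)%N, nth Halt P p = i & at_pos p.+1 c].
Proof.
move=> [pre [post [eP <-]]]; rewrite /at_pos {}eP; split.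
- by rewrite !size_cat /=; lia.
- by rewrite nth_cat ltnn subnn.
- by exists (rcons pre i), post; rewrite size_rcons cat_rcons.
Qed.

Lemma at_pos_step p i c s : at_pos p (i :: c) -> isbas i ->
  step P orc (Config p s.1 s.2) =
    Some (Config p.+1 (bas orc i s).1 (bas orc i s).2).
Proof. by case/at_pos_cons=> hp hi _; rewrite /step leqNgt hp hi; case: s i {hi} => N Rg []. Qed.

Definition reach (b p : nat) (s : st R) (p' : nat) (s' : st R) : Prop :=
  exists2 t, (t <= b)%N &
    runs t (Config p s.1 s.2) = Some (Config p' s'.1 s'.2).

Lemma reach_trans b1 b2 b p s p1 s1 p2 s2 :
  reach b1 p s p1 s1 -> reach b2 p1 s1 p2 s2 -> (b1 + b2 <= b)%N ->
  reach b p s p2 s2.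
Proof.
move=> [t1 h1 r1] [t2 h2 r2] h; exists (t1 + t2)%N; first by lia.
by rewrite (runsD _ r1).
Qed.

Lemma reach1 p s p' s' :
  step P orc (Config p s.1 s.2) = Some (Config p' s'.1 s'.2) ->
  reach 1 p s p' s'.
Proof. by move=> h; exists 1%N => //=; rewrite h. Qed.

Lemma comp_correct K c p s : wf c -> at_pos p (comp p c) ->
  s.1 2 = 1%N -> s.1 3 = K ->
  reach (wc (s.1 0%N) K c) p s (p + size (comp p c))%N (den orc c s).
Proof.
elim: c p s => [|i|d i|i r|c1 IH1 c2 IH2|a b c1 IH1 c2 IH2|a b c1 IH1 c2 IH2|i b c IH] p s.
- by move=> _ _ _ _; exists 0%N => //=; rewrite addn0.
- move=> /andP[h1 h2] h _ _; rewrite addn1; apply: reach1.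
  exact: at_pos_step h h1.
- move=> h0 /= h _ _; exists 3%N => //=.
  have [p1 e1 h1] := at_pos_cons h; have [p2 e2 h2] := at_pos_cons h1.
  have [p3 e3 _] := at_pos_cons h2.
  by rewrite /step leqNgt p1 e1 /= leqNgt p2 e2 /= leqNgt p3 e3 /= addn3.
- move=> h0 /= h _ _; exists 3%N => //=.
  have [p1 e1 h1] := at_pos_cons h; have [p2 e2 h2] := at_pos_cons h1.
  have [p3 e3 _] := at_pos_cons h2.
  by rewrite /step leqNgt p1 e1 /= leqNgt p2 e2 /= leqNgt p3 e3 /= addn3.
- move=> /= /andP[w1 w2] /at_pos_cat[h1 h2] e2 eK.
  have r1 := IH1 _ _ w1 h1 e2 eK.
  have := IH2 _ (den orc c1 s) w2 h2; rewrite !den_const // => /(_ e2 eK) r2.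
  by rewrite size_cat addnA; apply: reach_trans r1 r2 _.
- move=> /= /andP[w1 w2] h e2 eK; have [hp hi hc] := at_pos_cons h.
  have [h2 hj] := at_pos_cat hc; have [jp ji h1] := at_pos_cons hj.
  have ep : (p.+1 + size (comp p.+1 c2)).+1 = (p + (size (comp p.+1 c2)).+2)%N.
    by lia.
  rewrite ep in h1; case: ifP => hab.
    have r0 : reach 1 p s (p + (size (comp p.+1 c2)).+2)%N s.
      by apply: reach1; rewrite /step /= leqNgt hp hi hab.
    have := reach_trans r0 (IH1 _ _ w1 h1 e2 eK) (leqnn _).
    rewrite size_cat /= => -[t ht rt]; exists t; first by lia.
    by rewrite rt; congr (Some (Config _ _ _)); lia.
  have r0 : reach 1 p s p.+1 s by apply: reach1; rewrite /step /= leqNgt hp hi hab.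
  have r1 := reach_trans r0 (IH2 _ _ w2 h2 e2 eK) (leqnn _).
  have r2 : reach 1 (p.+1 + size (comp p.+1 c2))%N (den orc c2 s)
     (p + (size (comp p.+1 c2)).+2 + size (comp (p + (size (comp p.+1 c2)).+2)%N c1))%N
     (den orc c2 s).
    by apply: reach1; rewrite /step /= leqNgt jp ji.
  have [t ht rt] := reach_trans r1 r2 (leqnn _); exists t; first by lia.
  by rewrite rt size_cat /=; congr (Some (Config _ _ _)); lia.
- move=> /= /andP[w1 w2] h e2 eK; have [hp hi hc] := at_pos_cons h.
  have [h2 hj] := at_pos_cat hc; have [jp ji h1] := at_pos_cons hj.
  have ep : (p.+1 + size (comp p.+1 c2)).+1 = (p + (size (comp p.+1 c2)).+2)%N.
    by lia.
  rewrite ep in h1; case: ifP => hab.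
    have r0 : reach 1 p s (p + (size (comp p.+1 c2)).+2)%N s.
      by apply: reach1; rewrite /step /= leqNgt hp hi hab.
    have := reach_trans r0 (IH1 _ _ w1 h1 e2 eK) (leqnn _).
    rewrite size_cat /= => -[t ht rt]; exists t; first by lia.
    by rewrite rt; congr (Some (Config _ _ _)); lia.
  have r0 : reach 1 p s p.+1 s by apply: reach1; rewrite /step /= leqNgt hp hi hab.
  have r1 := reach_trans r0 (IH2 _ _ w2 h2 e2 eK) (leqnn _).
  have r2 : reach 1 (p.+1 + size (comp p.+1 c2))%N (den orc c2 s)
     (p + (size (comp p.+1 c2)).+2 + size (comp (p + (size (comp p.+1 c2)).+2)%N c1))%N
     (den orc c2 s).
    by apply: reach1; rewrite /step /= leqNgt jp ji.
  have [t ht rt] := reach_trans r1 r2 (leqnn _); exists t; first by lia.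
  by rewrite rt size_cat /=; congr (Some (Config _ _ _)); lia.
- move=> w; rewrite [comp _ _]/= => h e2 eK.
  move: (w); rewrite /= => /and4P[w1 w2 w3 w4].
  have [hp hi hc] := at_pos_cons h.
  have [tp ti htc] := at_pos_cons hc; have [jp ji hjc] := at_pos_cons htc.
  rewrite -addn3 in hjc.
  have [hbody hend] := at_pos_cat hjc.
  have [ip ii hi2] := at_pos_cons hend; have [lp li _] := at_pos_cons hi2.
  set m := s.1 b; set L := size (comp (p + 3)%N c).
  have em : (if b == 0 then s.1 0%N else K) = m.
    by case/orP: w2 => /eqP hb; rewrite /m hb.
  rewrite em.
  set F := fun t s' => den orc c (setN i t s').
  have di2 : 2 != i by lia.
  have di3 : 3 != i by lia.
  have di0 : 0%N != i by lia.
  have dib : b != i by case/orP: w2 => /eqP->; lia.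
  have b8 : (b < 8)%N by case/orP: w2 => /eqP->.
  (* After t rounds control is back at the test with counter t. A round costs the body plus three
     steps: the test, the increment and the jump back. *)
  have inv : forall t, (t <= m)%N ->
     (forall x, (x < 8)%N -> (forloop F t s).1 x = s.1 x) /\
     reach (t * (wc (s.1 0%N) K c + 3) + 1)%N p s p.+1 (setN i t (forloop F t s)).
    elim=> [_|t IHt ht].
      by split=> //; apply: reach1; rewrite /step /= leqNgt hp hi.
    have [f1 r1] := IHt (ltnW ht).
    have f2 : forall x, (x < 8)%N -> (forloop F t.+1 s).1 x = s.1 x.
      move=> x hx; rewrite forloopS /F den_const //= upd_diff ?f1 //; lia.
    split=> //.
    have r2 : reach 1 p.+1 (setN i t (forloop F t s)) (p + 3)%N (setN i t (forloop F t s)).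
      apply: reach1; rewrite /step /= leqNgt tp ti /= upd_same upd_diff // f1 // -/m ht //.
    have r12 := reach_trans r1 r2 (leqnn _).
    have r3 := IH (p + 3)%N (setN i t (forloop F t s)) w4 hbody.
    rewrite /= !upd_diff // !f1 // in r3.
    have r123 := reach_trans r12 (r3 e2 eK) (leqnn _).
    rewrite -[den _ _ _]/(F t (forloop F t s)) -forloopS in r123.
    have e4 : step P orc (Config (p + 3 + L)%N (forloop F t.+1 s).1 (forloop F t.+1 s).2)
      = Some (Config (p + 3 + L).+1 (setN i t.+1 (forloop F t.+1 s)).1
               (setN i t.+1 (forloop F t.+1 s)).2).
      rewrite /step /= leqNgt ip ii (f2 2) // e2; congr (Some (Config _ (upd _ _ _) _)).
      by rewrite forloopS /F frameN //= upd_same addn1.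
    have r4 := reach_trans r123 (reach1 e4) (leqnn _).
    have r5 : reach 1 (p + 3 + L).+1 (setN i t.+1 (forloop F t.+1 s)) p.+1
       (setN i t.+1 (forloop F t.+1 s)) by apply: reach1; rewrite /step /= leqNgt lp li.
    by apply: reach_trans r4 r5 _; lia.
  have [f1 r1] := inv m (leqnn _).
  have r2 : reach 1 p.+1 (setN i m (forloop F m s)) p.+2 (setN i m (forloop F m s)).
    by apply: reach1; rewrite /step /= leqNgt tp ti /= upd_same upd_diff // f1 // -/m ltnn.
  have r3 : reach 1 p.+2 (setN i m (forloop F m s)) (p + L + 5)%N (setN i m (forloop F m s)).
    by apply: reach1; rewrite /step /= leqNgt jp ji.
  have [t ht rt] := reach_trans (reach_trans r1 r2 (leqnn _)) r3 (leqnn _).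
  exists t; first by lia.
  rewrite rt /= -/F; congr (Some (Config _ _ _)); rewrite size_cat /= -/L; lia.
Qed.

End Compile.

(** * Bit masks and the inclusion-exclusion recursion *)

Definition bit (m i : nat) : bool := odd (m %/ 2 ^ i).

Definition mask (B : pred nat) (t : nat) : nat := \sum_(0 <= i < t | B i) 2 ^ i.

Lemma maskS B t : mask B t.+1 = mask B t + (if B t then 2 ^ t else 0).
Proof. by rewrite /mask big_mkcond big_nat_recr //= -big_mkcond. Qed.

Lemma mask0 B : mask B 0 = 0.
Proof. by rewrite /mask big_geq. Qed.

Lemma mask_lt B t : mask B t < 2 ^ t.
Proof.
elim: t => [|t IH]; first by rewrite mask0.
rewrite maskS expnS; case: (B t); lia.
Qed.

Lemma eq_mask (B C : pred nat) t : (forall i, i < t -> B i = C i) -> mask B t = mask C t.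
Proof. move=> h; rewrite /mask big_nat_cond [RHS]big_nat_cond; apply: eq_bigl => i.
by case: (ltnP i t) => [/h->|]. Qed.

Lemma bit_add m i t : m < 2 ^ t -> bit (m + 2 ^ t) i = (i == t) || bit m i.
Proof.
move=> h; rewrite /bit; have p i' : 0 < 2 ^ i' by rewrite expn_gt0.
case: (ltngtP i t) => hit /=.
- have e : 2 ^ t = 2 ^ (t - i).-1.+1 * 2 ^ i by rewrite -expnD; congr (2 ^ _); lia.
  by rewrite e divnDMl // oddD expnS oddM /= addbF.
- have : 2 ^ t.+1 <= 2 ^ i by rewrite leq_exp2l.
  by rewrite expnS => h1; rewrite !divn_small //; lia.
- by rewrite hit divnDr ?dvdnn // divnn p divn_small.
Qed.

Lemma bit0 i : bit 0 i = false.
Proof. by rewrite /bit div0n. Qed.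

Lemma bit_mask B t i : bit (mask B t) i = (i < t) && B i.
Proof.
elim: t => [|t IH]; first by rewrite mask0 bit0.
rewrite maskS; case: (boolP (B t)) => hB; last first.
  rewrite addn0 IH; case: (eqVneq i t) => [->|hne]; first by rewrite (negPf hB) !andbF.
  by congr (_ && _); lia.
rewrite bit_add ?mask_lt // IH; case: (eqVneq i t) => [->|hne]; first by rewrite leqnn.
by congr (_ && _); lia.
Qed.

(** Disjointness makes the addition carry-free. The machine has no bitwise operations, so it forms
    unions this way, and differences as in [maskB]. *)
Lemma maskD (B C : pred nat) t : (forall i, i < t -> B i -> C i -> false) ->
  mask B t + mask C t = mask (fun i => B i || C i) t.
Proof.
elim: t => [|t IH] h; first by rewrite !mask0.
rewrite !maskS -IH => [|i hi]; last by apply: h; lia.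
by move: (h t (leqnn _)); case: (B t); case: (C t) => H /=; lia.
Qed.

Lemma maskB (B C : pred nat) t : (forall i, i < t -> C i -> B i) ->
  mask B t - mask C t = mask (fun i => B i && ~~ C i) t.
Proof.
elim: t => [|t IH] h; first by rewrite !mask0.
have h' i : i < t -> C i -> B i by move=> hi; apply: h; lia.
rewrite !maskS -(IH h').
have le : mask C t <= mask B t.
  by rewrite /mask big_mkcond [X in _ <= X]big_mkcond;
  rewrite big_nat [X in _ <= X]big_nat; apply: leq_sum => i /andP[_ /h'];
  case: (C i) (B i) => [] [] // /(_ isT).
move: (h t (leqnn _)); case: (B t); case: (C t) => H /=; lia.
Qed.

Lemma mask1 j t : j < t -> mask (fun i => i == j) t = 2 ^ j.
Proof.
move=> h; rewrite /mask -big_filter.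
have -> : [seq i <- index_iota 0 t | i == j] = [:: j].
  rewrite (eq_filter (a2 := pred1 j)) // filter_pred1_uniq ?iota_uniq //.
  by rewrite mem_index_iota.
by rewrite big_seq1.
Qed.

Lemma mask_le B t t' : t <= t' -> mask B t = mask (fun i => B i && (i < t)) t'.
Proof.
move=> h; elim: t' h => [|t' IH]; first by case: t => // _; rewrite !mask0.
rewrite leq_eqVlt => /orP[/eqP->|h].
  by apply: eq_mask => i ->; rewrite andbT.
by rewrite maskS -IH // ltnNge -ltnS h andbF addn0.
Qed.

Section Cov.
Local Open Scope ring_scope.
Variables (R : realType) (n : nat) (E : finType) (w : E -> R).
Variable S : 'I_n -> {set E}.

(** Membership on plain natural numbers, as the program sees indices; false from [n] on. *)
Definition hit (e : E) (i : nat) : bool :=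
  [exists j : 'I_n, (j == i :> nat) && (e \in S j)].

Lemma hit_ord e (i : 'I_n) : hit e i = (e \in S i).
Proof.
apply/existsP/idP => [[j /andP[/eqP/val_inj->]]|h] //.
by exists i; rewrite eqxx.
Qed.

End Cov.

Section Ev.
Local Open Scope ring_scope.
Variables (R : realType) (n : nat) (b : bool) (y : nat -> R).

(** [b] selects the potential: the multilinear extension accumulates a product of the 1 - y_i, the
    concave surrogate a sum that [vv] turns into the power of a mean. *)
Definition stepz (z yi : R) : R := if b then z * (1 - yi) else z + (1 - yi).
Definition vv (m : nat) (z : R) : R := if b then z else (z / m%:R) ^+ m.
Definition z0 : R := if b then 1 else 0.

(* The value 2 marks the coordinates that are forced in or out. *)
Definition fr (i : nat) : bool := ~~ (1 < y i).

(* C is the set of coordinates chosen so far and D the part of C put back into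
   the query set: l = #|C|, cm is the mask of C minus D, sg = (-1)^#|D|, z the
   accumulated state of C, v its value, lo the next candidate. *)
Fixpoint ev (orc : nat -> R) (jm : nat) (r l lo cm : nat) (z v sg : R) : R :=
  if r is r'.+1 then
    \sum_(0 <= i < n | fr i && (lo <= i)%N)
      let pm := (jm + mask fr i.+1)%N in
      let z' := stepz z (y i) in
      let v' := vv l.+1 z' in
      ((v' - v) * sg * orc (pm - (cm + 2 ^ i))%N
        + ev orc jm r' l.+1 i.+1 (cm + 2 ^ i)%N z' v' sg)
      + ((v' - v) * (0 - sg) * orc (pm - cm)%N
        + ev orc jm r' l.+1 i.+1 cm z' v' (0 - sg))
  else 0.

(** Linearity in the oracle: it is enough to understand oracles that report whether a single element
    is met. *)
Lemma ev_sum (I : finType) (c : I -> R) (o : I -> nat -> R) orc jm r l lo cm z v sg :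
  (forall m, orc m = \sum_e c e * o e m) ->
  ev orc jm r l lo cm z v sg = \sum_e c e * ev (o e) jm r l lo cm z v sg.
Proof.
move=> h; elim: r l lo cm z v sg => [|r IH] l lo cm z v sg /=.
  by rewrite big1 // => e _; rewrite mulr0.
under [RHS]eq_bigr => e _ do rewrite mulr_sumr.
rewrite exchange_big; apply: eq_bigr => i _ /=.
rewrite !IH !h !mulr_sumr -!big_split /=; apply: eq_bigr => e _; ring.
Qed.

(* Inclusion-exclusion over the subsets of the chosen prefix telescopes: an
   element met by the query set contributes 0, any other contributes the
   difference between its current value and its value after absorbing its
   next r free members. *)
Lemma ev_elem (h : nat -> bool) j r l lo (cp : pred nat) z sg :
  (j < n)%N -> ~~ fr j -> (lo <= n)%N ->
  (forall i, cp i -> fr i && (i < lo)%N) ->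
  let o m := (has (fun i => bit m i && h i) (iota 0 n))%:R : R in
  let A := take r [seq i <- iota lo (n - lo) | fr i && h i] in
  ev o (2 ^ j)%N r l lo (mask cp n) z (vv l z) sg =
    if h j || has (fun i => [&& fr i, ~~ cp i & h i]) (iota 0 lo) then 0
    else sg * (vv l z - vv (l + size A) (foldl (fun z i => stepz z (y i)) z A)).
Proof.
move=> hj hfj + + o; elim: r l lo cp z sg => [|r IH] l lo cp z sg hlo hcp.
  by move=> A /=; rewrite /A take0 /= addn0 subrr mulr0 if_same.
set q0 := h j || _.
(* The query consists of [j] and of the free coordinates below [t] outside [B]. *)
have oE t c' (B : pred nat) : (t <= n)%N ->
    c' = mask B n -> (forall x, B x -> fr x && (x < t)%N) ->
    o (2 ^ j + mask fr t - c')%N =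
     (h j || has (fun x => [&& fr x, ~~ B x & h x]) (iota 0 t))%:R.
  move=> hi -> hB; rewrite /o; congr ((_ : bool)%:R).
  rewrite -(mask1 hj) (mask_le _ hi) maskD; last first.
    by move=> x _ /eqP-> /andP[]; rewrite (negPf hfj).
  rewrite maskB; last by move=> x _ /hB ->; rewrite orbT.
  apply/hasP/orP.
    move=> [x]; rewrite mem_iota add0n => /= hx; rewrite bit_mask hx /=.
    case/andP=> /andP[/orP[/eqP->|/andP[h1 h2]] h3] h4; first by left.
    by right; apply/hasP; exists x; rewrite ?mem_iota ?add0n //= h1 h3.
  case=> [hh|/hasP[x]].
    exists j; rewrite ?mem_iota ?add0n //= bit_mask hj eqxx hh /= andbT.
    by apply/negP => /hB; rewrite (negPf hfj).
  rewrite mem_iota add0n => /= hx /and3P[h1 h2 h3].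
  have hxn : (x < n)%N by lia.
  by exists x; rewrite ?mem_iota ?add0n //= bit_mask hxn h1 hx h2 h3 orbT.
(* [H i] says that the element is met by [j] or by a free coordinate below [i] that stays in the
   query. [T i] is the value of the summand when [i] is the first further member. *)
pose H i := h j || has (fun x => [&& fr x, ~~ cp x & h x]) (iota 0 i).
pose T i := let z' := stepz z (y i) in
  let A' := take r [seq i <- iota i.+1 (n - i.+1) | fr i && h i] in
  sg * (vv l z - vv (l.+1 + size A') (foldl (fun z i => stepz z (y i)) z' A')).
(* The two halves differ in whether [i] belongs to the query and carry opposite signs, so they
   cancel unless the element contains [i] and is not met before. *)
have step i : (i < n)%N -> fr i -> (lo <= i)%N ->
   (let pm := (2 ^ j + mask fr i.+1)%N in
      let z' := stepz z (y i) in
      let v' := vv l.+1 z' in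
      ((v' - vv l z) * sg * o (pm - (mask cp n + 2 ^ i))%N
        + ev o (2 ^ j)%N r l.+1 i.+1 (mask cp n + 2 ^ i)%N z' v' sg)
      + ((v' - vv l z) * (0 - sg) * o (pm - mask cp n)%N
        + ev o (2 ^ j)%N r l.+1 i.+1 (mask cp n) z' v' (0 - sg))) =
   if ~~ H i && h i then T i else 0.
  move=> hi hfi hl /=.
  have hc0 : (mask cp n + 2 ^ i)%N = mask (fun x => cp x || (x == i)) n.
    rewrite -(mask1 hi) maskD // => x _ /hcp /andP[_ hx] /eqP ex; lia.
  have hcp0 x : cp x || (x == i) -> fr x && (x < i.+1)%N.
    by case/orP=> [/hcp /andP[-> ?]|/eqP->]; rewrite ?hfi //; lia.
  have hcp1 x : cp x -> fr x && (x < i.+1)%N.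
    by move=> /hcp /andP[-> ?] /=; lia.
  have hH0 : h j || has (fun x => [&& fr x, ~~ (cp x || (x == i)) & h x]) (iota 0 i.+1) = H i.
    rewrite /H -addn1 iotaD has_cat /= add0n eqxx orbT /= andbF !orbF; congr (_ || _).
    apply: eq_in_has => x; rewrite mem_iota add0n => /= hx.
    by rewrite (_ : x == i = false) ?orbF //; lia.
  have hH1 : h j || has (fun x => [&& fr x, ~~ cp x & h x]) (iota 0 i.+1) = H i || h i.
    rewrite /H -addn1 iotaD has_cat /= add0n !orbF orbA hfi /=.
    by case: (boolP (cp i)) => // /hcp /andP[_]; lia.
  rewrite (oE _ _ _ hi hc0 hcp0) (oE _ _ _ hi erefl hcp1).
  rewrite hc0 !IH //= hH0 hH1 /T /=.
  case: (H i) => /=; first by rewrite !addr0; ring.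
  by case: (h i) => /=; ring.
transitivity (\sum_(0 <= i < n | fr i && (lo <= i)%N)
    (if ~~ H i && h i then T i else 0)).
  rewrite [LHS]big_nat_cond [RHS]big_nat_cond; apply: eq_bigr => i.
  by case/andP=> /andP[_ hi] /andP[hfi hl]; exact: step.
have Hq : H lo = q0 by [].
have Hm i i' : (i <= i')%N -> H i -> H i'.
  rewrite /H => le /orP[->//|/hasP[x]]; rewrite mem_iota add0n => /= hx hh.
  by apply/orP; right; apply/hasP; exists x; rewrite ?mem_iota ?add0n //=; lia.
case: ifP => hq.
  rewrite big1 // => i /andP[_ hl]; rewrite (Hm lo) ?Hq //.
transitivity (\sum_(i <- iota lo (n - lo) | fr i) (if ~~ H i && h i then T i else 0)).
  rewrite /index_iota subn0 -{1}(subnKC hlo) iotaD big_cat /= add0n.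
  rewrite big_seq_cond big1 ?add0r => [|i]; last first.
    by rewrite mem_iota => /andP[? /andP[_ ?]]; lia.
  rewrite [LHS]big_seq_cond [RHS]big_seq_cond; apply: eq_bigl => i.
  by rewrite mem_iota; case: (fr i); rewrite ?andbF //=; lia.
rewrite -Hq in hq; rewrite /A; clear A q0 Hq IH oE step.
have: forall x, x \in iota lo (n - lo) -> ~~ cp x.
  by move=> x; rewrite mem_iota => hx; apply/negP => /hcp /andP[_]; lia.
(* Induction on the length of the remaining interval: up to the first member nothing is contributed,
   and beyond it [H] holds, so a single summand survives. *)
have [d hd] : exists d, d = (n - lo)%N by eexists.
rewrite -hd; clear hcp hlo; elim: d lo hq hd => [|d IHd] lo hq hd hcp /=.
  by rewrite big_nil /= addn0 subrr mulr0.
have hcl : ~~ cp lo by apply: hcp; rewrite inE eqxx.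
have HS : H lo.+1 = (fr lo && h lo).
  by rewrite /H -addn1 iotaD has_cat /= orbA -/(H lo) hq add0n orbF hcl.
rewrite big_cons; case: (boolP (fr lo && h lo)) => hl.
  case/andP: (hl) => hf hh; rewrite hf hq hh /=.
  rewrite big_seq_cond big1 ?addr0.
    rewrite /T; have -> : d = (n - lo.+1)%N by lia.
    by rewrite addSnnS.
  move=> i; rewrite mem_iota => /andP[hi _].
  by rewrite (Hm lo.+1) ?HS ?hl //; lia.
have hS : H lo.+1 = false by rewrite HS (negPf hl).
have hd' : d = (n - lo.+1)%N by lia.
have hc x : x \in iota lo.+1 d -> ~~ cp x.
  by move=> hx; apply: hcp; rewrite inE hx orbT.
have -> := IHd lo.+1 hS hd' hc.
by case: (fr lo) hl => //= /negPf->; rewrite andbF add0r.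
Qed.

End Ev.

(** * The evaluator *)

(* Registers of the evaluator at recursion level l; everything from iR l
   (resp. zR l.+1) on is private to the recursive call made at level l. *)
Definition loR l := 64 + 10 * l.
Definition cmR l := 66 + 10 * l.
Definition iR l := 68 + 10 * l.
Definition pmR l := 70 + 10 * l.
Definition p2R l := 72 + 10 * l.
Definition zR l := 64 + 6 * l.
Definition vR l := 66 + 6 * l.
Definition sgR l := 68 + 6 * l.

Ltac rlia := rewrite /loR /cmR /iR /pmR /p2R /zR /vR /sgR; lia.

Ltac regs := repeat first
  [ rewrite upd_same | rewrite upd_diff; [| solve [rlia]] ].

(** Unrolled, since the exponent is fixed when the program is written. *)
Fixpoint rpow (d x m : nat) : cmd :=
  if m is m'.+1 then Bas (RMul d d x) ;; rpow d x m' else Skip.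

Definition stepc (b : bool) (l : nat) : cmd :=
  Bas (RSub 10 0 8) ;;
  if b then
    Bas (RMul (zR l.+1) (zR l) 10) ;; Bas (RAdd (vR l.+1) (zR l.+1) 26)
  else
    Bas (RAdd (zR l.+1) (zR l) 10) ;; Bas (NSet 9 l.+1) ;; Bas (ROfN 14 9) ;;
    Bas (RDiv 14 (zR l.+1) 14) ;; Bas (ROne (vR l.+1)) ;;
    rpow (vR l.+1) 14 l.+1.

Definition nodec (l : nat) : cmd :=
  Bas (NSub 9 (pmR l) (cmR l.+1)) ;; Bas (Query 12 9) ;;
  Bas (RSub 10 (vR l.+1) (vR l)) ;; Bas (RMul 10 10 (sgR l.+1)) ;;
  Bas (RMul 10 10 12) ;; Bas (RAdd 6 6 10).

(** Register [a] holds 2^i when i stays out of the query; it is register 4, which holds 0, when i is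
    put back and the sign flips. Real register 26 is 0 and serves for copying and negation. *)
Definition halfc (b : bool) (l : nat) (neg : bool) (a : nat) (sub : cmd) : cmd :=
  Bas (NAdd (cmR l.+1) (cmR l) a) ;;
  Bas ((if neg then RSub else RAdd) (sgR l.+1) 26 (sgR l)) ;; nodec l ;; sub.

(** The prefix mask is extended before the test against [loR l]: it has to contain every free
    coordinate, also those below the first candidate. *)
Definition recif (b : bool) (l : nat) (sub : cmd) : cmd :=
  IfR 0 8 Skip (
    Bas (NAdd (pmR l) (pmR l) (p2R l)) ;;
    IfN (iR l) (loR l) Skip (
      stepc b l ;;
      Bas (NAdd (loR l.+1) (iR l) 2) ;;
      halfc b l false (p2R l) sub ;; halfc b l true 4 sub)).

Definition recbody (b : bool) (l : nat) (sub : cmd) : cmd :=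
  LdY 8 (iR l) ;; recif b l sub ;; Bas (NAdd (p2R l) (p2R l) (p2R l)).

(** The recursion is unrolled into nested loops with private registers for each level; its depth is
    the constant M, so the time stays polynomial in n. *)
Fixpoint rec (b : bool) (r l : nat) : cmd :=
  if r is r'.+1 then
    Bas (NSet (p2R l) 1) ;; Bas (NAdd (pmR l) 10 4) ;;
    For (iR l) 0 (recbody b l (rec b r' l.+1))
  else Skip.

Lemma wrN_rpow d x m r : wrN (rpow d x m) r = false.
Proof. by elim: m. Qed.

Lemma wrR_rpow d x m r : wrR (rpow d x m) r -> r == d.
Proof. by elim: m => //= m IH /orP[|/IH]. Qed.

Lemma wf_rpow d x m : wf (rpow d x m).
Proof. by elim: m. Qed.

Lemma wrN_rec b r l x : wrN (rec b r l) x ->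
  [|| x == 8, x == 9 | ~~ odd x && (iR l <= x)].
Proof.
elim: r l => // r IH l; rewrite /= /stepc /=.
case: b IH => IH /=; rewrite ?wrN_rpow ?orbF /=;
  do ![case/orP]; try solve [by move/eqP->; rlia | by move/IH; rlia | by []].
Qed.

Lemma wrR_rec b r l x : wrR (rec b r l) x ->
  [|| x \in [:: 6; 8; 10; 12; 14] | ~~ odd x && (zR l.+1 <= x)].
Proof.
elim: r l => // r IH l; rewrite /= /stepc !inE.
case: b IH => IH /=;
  do ![case/orP]; try solve [by move/eqP->; rlia
    | by move/wrR_rpow/eqP->; rlia | by move/IH; rewrite !inE; rlia | by []].
Qed.

Lemma wf_rec b r l : wf (rec b r l).
Proof.
elim: r l => // r IH l.
have hN : wrN (rec b r l.+1) (iR l) = false.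
  by apply/negP => /wrN_rec; rlia.
rewrite /= IH hN /= !orbF /stepc; case: b {IH hN} => /=; rewrite ?wrN_rpow ?wf_rpow; rlia.
Qed.

Section Spec.
Variables (R : realType) (orc : nat -> R).
Local Notation den := (den orc).
Local Open Scope ring_scope.

Lemma den_IfR a b c1 c2 s :
  den (IfR a b c1 c2) s = if s.2 a < s.2 b then den c1 s else den c2 s.
Proof. by []. Qed.

Lemma den_IfN a b c1 c2 s :
  den (IfN a b c1 c2) s = if (s.1 a < s.1 b)%N then den c1 s else den c2 s.
Proof. by []. Qed.

Lemma den_Seq c1 c2 s : den (c1 ;; c2) s = den c2 (den c1 s).
Proof. by []. Qed.

Lemma rec_keepN b r l s x :
  ~~ [|| x == 8%N, x == 9%N | ~~ odd x && (iR l <= x)%N] ->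
  (den (rec b r l) s).1 x = s.1 x.
Proof. by move=> h; apply: frameN; apply: contra h; apply: wrN_rec. Qed.

Lemma rec_keepR b r l s x : s.1 2%N = 1%N ->
  ~~ [|| x \in [:: 6; 8; 10; 12; 14]%N | ~~ odd x && (zR l.+1 <= x)%N] ->
  (den (rec b r l) s).2 x = s.2 x.
Proof.
by move=> h2 h; apply: frameR (wf_rec _ _ _) _ => //; apply: contra h; apply: wrR_rec.
Qed.

Lemma den_rpow d x m s : x != d ->
  (den (rpow d x m) s).1 = s.1 /\
  (den (rpow d x m) s).2 d = s.2 d * s.2 x ^+ m /\
  (forall r, r != d -> (den (rpow d x m) s).2 r = s.2 r).
Proof.
move=> hxd; elim: m s => [|m IH] s /=; first by rewrite expr0 mulr1.
have [e1 [e2 e3]] := IH (s.1, upd s.2 d (s.2 d * s.2 x)).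
split=> //; split=> [|r hr].
  by rewrite e2 /= upd_same upd_diff // exprS mulrA.
by rewrite e3 //= upd_diff.
Qed.

Opaque rpow.

Lemma den_stepc b l s : s.2 0%N = 1 -> s.2 26%N = 0 ->
  let s' := den (stepc b l) s in
  [/\ s'.2 (zR l.+1) = stepz b (s.2 (zR l)) (s.2 8%N),
      s'.2 (vR l.+1) = vv b l.+1 (stepz b (s.2 (zR l)) (s.2 8%N)),
      forall x, x != 9%N -> s'.1 x = s.1 x &
      forall x, x \notin [:: 10; 14; zR l.+1; vR l.+1]%N -> s'.2 x = s.2 x].
Proof.
move=> h1 h0; rewrite /stepc /stepz /vv; case: b => /=.
  split=> //; regs; rewrite ?h1 ?h0 ?addr0 //.
  by move=> x; rewrite !inE !negb_or => /and4P[? ? ? ?]; rewrite !upd_diff.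
set s1 := (X in den (rpow _ _ _) X).
have hx : 14%N != vR l.+1 by rlia.
have [e1 [e2 e3]] := den_rpow l.+1 s1 hx.
split.
- by rewrite e3 ?/s1 /=; [regs; rewrite h1|rlia].
- by rewrite e2 /s1 /=; regs; rewrite h1 mul1r.
- by move=> x hx'; rewrite e1 /s1 /= upd_diff.
- move=> x; rewrite !inE !negb_or => /and4P[? ? ? ?]; rewrite e3 // /s1 /=.
  by rewrite !upd_diff.
Qed.

Lemma den_nodec l s : let s' := den (nodec l) s in
  [/\ s'.2 6%N = s.2 6%N + (s.2 (vR l.+1) - s.2 (vR l)) * s.2 (sgR l.+1) *
                     orc (s.1 (pmR l) - s.1 (cmR l.+1))%N,
      forall x, x != 9%N -> s'.1 x = s.1 x &
      forall x, x \notin [:: 6; 10; 12]%N -> s'.2 x = s.2 x].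
Proof.
rewrite /=; split.
- by regs.
- by move=> x hx; rewrite upd_diff.
- by move=> x; rewrite !inE !negb_or => /and3P[? ? ?]; rewrite !upd_diff.
Qed.

Opaque stepc.
Opaque nodec.

(** The value is added to register 6, shared by all levels. A separate predicate lets [den_half]
    take it as induction hypothesis for the next level. *)
Definition rec_spec n b r jm (y : nat -> R) : Prop := forall l s,
  s.1 0%N = n -> s.1 2%N = 1%N -> s.1 4%N = 0%N -> s.1 10%N = jm ->
  s.2 0%N = 1 -> s.2 26%N = 0 -> (forall i, s.2 (i + i + 1)%N = y i) ->
  (den (rec b r l) s).2 6%N = s.2 6%N +
    ev n b y orc jm r l (s.1 (loR l)) (s.1 (cmR l)) (s.2 (zR l)) (s.2 (vR l))
      (s.2 (sgR l)).

Lemma den_half n b r jm (y : nat -> R) l neg a s : rec_spec n b r jm y ->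
  s.1 0%N = n -> s.1 2%N = 1%N -> s.1 4%N = 0%N -> s.1 10%N = jm ->
  s.2 0%N = 1 -> s.2 26%N = 0 -> (forall i, s.2 (i + i + 1)%N = y i) ->
  let c' := (s.1 (cmR l) + s.1 a)%N in
  let g' := if neg then 0 - s.2 (sgR l) else s.2 (sgR l) in
  let s' := den (halfc b l neg a (rec b r l.+1)) s in
  [/\ s'.2 6%N = s.2 6%N + ((s.2 (vR l.+1) - s.2 (vR l)) * g' *
          orc (s.1 (pmR l) - c')%N +
        ev n b y orc jm r l.+1 (s.1 (loR l.+1)) c' (s.2 (zR l.+1))
          (s.2 (vR l.+1)) g'),
      forall x, ~~ [|| x == 8%N, x == 9%N, x == cmR l.+1 |
        ~~ odd x && (iR l.+1 <= x)%N] -> s'.1 x = s.1 x &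
      forall x, ~~ [|| x \in [:: 6; 8; 10; 12; 14]%N, x == sgR l.+1 |
        ~~ odd x && (zR l.+2 <= x)%N] -> s'.2 x = s.2 x].
Proof.
move=> H hn h2 h4 hj h1 h0 hy c' g'.
set s1 := den (Bas ((if neg then RSub else RAdd) (sgR l.+1) 26 (sgR l)))
   (den (Bas (NAdd (cmR l.+1) (cmR l) a)) s).
have e1N x : x != cmR l.+1 -> s1.1 x = s.1 x.
  by rewrite /s1; case: (neg) => hx /=; rewrite upd_diff.
have e1R x : x != sgR l.+1 -> s1.2 x = s.2 x.
  by rewrite /s1; case: (neg) => hx /=; rewrite upd_diff.
have e1c : s1.1 (cmR l.+1) = c' by rewrite /s1; case: (neg); rewrite /= upd_same.
have e1g : s1.2 (sgR l.+1) = g'.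
  by rewrite /s1 /g'; case: (neg); rewrite /= upd_same h0 ?add0r.
have [f1 f2 f3] := den_nodec l s1; set s2 := den (nodec l) s1 in f1 f2 f3.
have hy2 i : s2.2 (i + i + 1)%N = y i.
  rewrite f3 ?e1R //; first by rlia.
  by rewrite !inE; lia.
have k2 x : x \in [:: 0; 2; 4; 10; loR l.+1]%N -> s2.1 x = s.1 x.
  by move=> hx; rewrite f2 ?e1N //; move: hx; rewrite !inE; rlia.
have kr2 x : x \in [:: 0; 26; zR l.+1; vR l.+1]%N -> s2.2 x = s.2 x.
  by move=> hx; rewrite f3 ?e1R //; move: hx; rewrite !inE; rlia.
have k2c : s2.1 (cmR l.+1) = c' by rewrite f2 // e1c.
have k2g : s2.2 (sgR l.+1) = g' by rewrite f3 // !inE; rlia.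
have := H l.+1 s2 (etrans (k2 0%N isT) hn) (etrans (k2 2%N isT) h2)
  (etrans (k2 4%N isT) h4) (etrans (k2 10%N isT) hj) (etrans (kr2 0%N isT) h1)
  (etrans (kr2 26%N isT) h0) hy2.
rewrite k2c k2g (k2 (loR l.+1)) ?(kr2 (zR _)) ?(kr2 (vR _)) => [e6|||];
  try by rewrite !inE eqxx !orbT.
rewrite -[den (halfc _ _ _ _ _) s]/(den (rec b r l.+1) s2); split.
- rewrite e6 f1 e1c e1g (e1N (pmR l)) ?(e1R (vR _)) ?(e1R 6%N); try rlia.
  by rewrite addrA.
- move=> x; rewrite !negb_or => /and4P[n1 n2 n3 n4].
  by rewrite rec_keepN ?f2 ?e1N // !negb_or n1 n2 n4.
- move=> x hx; have h22 : s2.1 2%N = 1%N by rewrite k2.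
  rewrite rec_keepR ?f3 ?e1R //; move: hx; rewrite !inE; rlia.
Qed.

Lemma den_rec n b r jm (y : nat -> R) : rec_spec n b r jm y.
Proof.
elim: r => [|r IH] l s hn h2 h4 hj h1 h0 hy; first by rewrite /= addr0.
have wfr := wf_rec b r.+1 l.
set body := recbody b l (rec b r l.+1).
have wfF : wf (For (iR l) 0 body) by case/andP: wfr => _ /andP[].
set s1 := den (Bas (NAdd (pmR l) 10 4)) (den (Bas (NSet (p2R l) 1)) s).
rewrite -[den _ _]/(den (For (iR l) 0 body) s1).
pose term i := let pm := (jm + mask (fr y) i.+1)%N in
      let z' := stepz b (s.2 (zR l)) (y i) in
      let v' := vv b l.+1 z' in
      ((v' - s.2 (vR l)) * s.2 (sgR l) * orc (pm - (s.1 (cmR l) + 2 ^ i))%N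
        + ev n b y orc jm r l.+1 i.+1 (s.1 (cmR l) + 2 ^ i)%N z' v' (s.2 (sgR l)))
      + ((v' - s.2 (vR l)) * (0 - s.2 (sgR l)) * orc (pm - s.1 (cmR l))%N
        + ev n b y orc jm r l.+1 i.+1 (s.1 (cmR l)) z' v' (0 - s.2 (sgR l))).
pose Inv t (s' : st R) := [/\ s'.1 (pmR l) = (jm + mask (fr y) t)%N,
   s'.1 (p2R l) = (2 ^ t)%N &
   s'.2 6%N = s.2 6%N + \sum_(0 <= i < t | fr y i && (s.1 (loR l) <= i)%N) term i].
have h12 : s1.1 2%N = 1%N by rewrite /s1 /=; regs.
have h1n : s1.1 0%N = n by rewrite /s1 /=; regs.
have I0 : Inv 0%N s1.
  split; rewrite /s1 /=; regs; rewrite ?hj ?h4 ?mask0 ?addn0 //.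
  by rewrite big_geq // addr0.
have [|s2 [_ _ i3] ->] := for_inv (orc := orc) (Inv := Inv) h12 wfF I0; last first.
  by rewrite /= i3 h1n.
rewrite h1n => t s' ht [fN fR] [i1 i2 i3].
have kN x : ~~ [|| x == 8%N, x == 9%N | ~~ odd x && (iR l <= x)%N] -> s'.1 x = s.1 x.
  move=> hx; rewrite fN.
    by rewrite /s1 /= upd_diff ?upd_diff //; apply: contra hx => /eqP->; rlia.
  apply: contra hx => hx; apply: (@wrN_rec b r.+1).
  by rewrite -[wrN _ _]/[|| x == p2R l, x == pmR l | wrN (For (iR l) 0 body) x] hx !orbT.
have kR x : ~~ [|| x \in [:: 6; 8; 10; 12; 14]%N | ~~ odd x && (zR l.+1 <= x)%N] ->
    s'.2 x = s.2 x.
  by move=> hx; rewrite fR //; apply: contra hx => hx; apply: (@wrR_rec b r.+1).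
clear fN fR.
have nat_ok : forall x, x \in [:: 0; 2; 4; 10; loR l; cmR l]%N -> s'.1 x = s.1 x.
  by move=> x; rewrite !inE => hx; apply: kN; move: hx; rlia.
have real_ok : forall x, (x \in [:: 0; 26; zR l; vR l; sgR l]%N) || odd x -> s'.2 x = s.2 x.
  by move=> x; rewrite !inE => hx; apply: kR; rewrite !inE; move: hx; rlia.
rewrite /body /recbody 2!den_Seq.
set s3 := den (LdY 8 (iR l)) (setN (iR l) t s').
set s5 := den (recif b l (rec b r l.+1)) s3.
have e3N x : x != 8%N -> s3.1 x = (setN (iR l) t s').1 x.
  by move=> hx; rewrite /s3 /= /addr 2!(upd_diff _ _ hx).
have e3R x : x != 8%N -> s3.2 x = s'.2 x.
  by move=> hx; rewrite /s3 /= upd_diff.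
have e38 : s3.2 8%N = y t.
  rewrite /s3 /= upd_same /addr /=; regs; rewrite nat_ok ?inE // h2.
  by rewrite real_ok ?hy //; lia.
(* Here and below a state is described by equations for its registers and then made opaque, which
   keeps it from unfolding into nested updates. *)
clearbody s3.
suff [g1 g2 g3] : [/\ s5.1 (pmR l) = (jm + mask (fr y) t.+1)%N,
   s5.1 (p2R l) = (2 ^ t)%N &
   s5.2 6%N = s.2 6%N +
     \sum_(0 <= i < t.+1 | fr y i && (s.1 (loR l) <= i)%N) term i].
  by split; rewrite /=; regs => //; rewrite g2 expnS; lia.
have e10 : s3.2 0%N = 1 by rewrite e3R // real_ok.
rewrite big_mkcond big_nat_recr //= -big_mkcond /= maskS.
rewrite /s5 /recif den_IfR e10 e38.
have -> : (1 < y t) = ~~ fr y t by rewrite /fr negbK.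
case: (boolP (fr y t)) => hfr; rewrite [~~ _]/=; last first.
  rewrite /= addn0 addr0.
  by split; rewrite ?e3R // e3N //=; regs; rewrite // i1.
rewrite den_Seq; set s6 := den (Bas (NAdd (pmR l) (pmR l) (p2R l))) s3.
have e6N x : x != pmR l -> s6.1 x = s3.1 x.
  by move=> hx; rewrite /s6 /= upd_diff.
have e6R x : s6.2 x = s3.2 x by [].
have e6p : s6.1 (pmR l) = (jm + (mask (fr y) t + 2 ^ t))%N.
  rewrite /s6 /= upd_same !e3N /=; try rlia.
  by regs; rewrite i1 i2 addnA.
have e6i : s6.1 (iR l) = t by rewrite e6N ?e3N /= ?upd_same //; rlia.
have e6lo : s6.1 (loR l) = s.1 (loR l).
  by rewrite e6N ?e3N /=; try rlia; regs; rewrite nat_ok ?inE ?eqxx ?orbT.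
rewrite den_IfN e6i e6lo andTb.
have e6p2 : s6.1 (p2R l) = (2 ^ t)%N by rewrite e6N ?e3N /=; try rlia; regs.
have e6acc : s6.2 6%N = s'.2 6%N by rewrite e6R e3R.
have k6 x : x \in [:: 0; 2; 4; 10; loR l; cmR l]%N -> s6.1 x = s.1 x.
  move=> hx; rewrite e6N ?e3N /= ?upd_diff ?nat_ok //; move: hx; rewrite !inE; rlia.
have k6R x : (x \in [:: 0; 26; zR l; vR l; sgR l]%N) || odd x -> s6.2 x = s.2 x.
  by move=> hx; rewrite e6R e3R ?real_ok //; move: hx; rewrite !inE; rlia.
have e68 : s6.2 8%N = y t by rewrite e6R.
clearbody s6.
case: ltnP => hlo; first by split; rewrite /= ?e6acc ?i3 ?addr0.
rewrite 3!den_Seq; set s7 := den (stepc b l) s6.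
have [z7 v7 n7 r7] := den_stepc b l (etrans (k6R 0%N isT) h1) (etrans (k6R 26%N isT) h0).
rewrite -/s7 in z7 v7 n7 r7.
set s8 := den (Bas (NAdd (loR l.+1) (iR l) 2)) s7.
have n8 x : x != loR l.+1 -> s8.1 x = s7.1 x by move=> hx; rewrite /s8 /= upd_diff.
have r8 x : s8.2 x = s7.2 x by [].
have lo8 : s8.1 (loR l.+1) = t.+1.
  rewrite /s8 /= upd_same !n7; try rlia.
  by rewrite e6i (k6 2%N) // h2 addn1.
have k8 x : x != 9%N -> x != loR l.+1 -> s8.1 x = s6.1 x.
  by move=> h9 hx; rewrite n8 ?n7.
have z8 : s8.2 (zR l.+1) = stepz b (s.2 (zR l)) (y t).
  by rewrite r8 z7 e68 k6R // !inE eqxx !orbT.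
have v8 : s8.2 (vR l.+1) = vv b l.+1 (stepz b (s.2 (zR l)) (y t)).
  by rewrite r8 v7 e68 k6R // !inE eqxx !orbT.
have k8R x : x \notin [:: 10; 14; zR l.+1; vR l.+1]%N -> s8.2 x = s6.2 x.
  by move=> hx; rewrite r8 r7.
clearbody s8; clear s7 z7 v7 n7 r7 n8 r8.
have kk8 x : x \in [:: 0; 2; 4; 10; loR l; cmR l]%N -> s8.1 x = s.1 x.
  by move=> hx; rewrite k8 ?k6 //; move: hx; rewrite !inE; rlia.
have kk8R x : (x \in [:: 0; 26; zR l; vR l; sgR l]%N) || odd x -> s8.2 x = s.2 x.
  by move=> hx; rewrite k8R ?k6R //; move: hx; rewrite !inE; rlia.
have hy8 i : s8.2 (i + i + 1)%N = y i by rewrite kk8R ?hy //; lia.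
have [a9 n9 r9] := den_half l false (p2R l) IH
  (etrans (kk8 0%N isT) hn) (etrans (kk8 2%N isT) h2)
  (etrans (kk8 4%N isT) h4) (etrans (kk8 10%N isT) hj) (etrans (kk8R 0%N isT) h1)
  (etrans (kk8R 26%N isT) h0) hy8.
set s9 := den (halfc b l false _ _) s8 in a9 n9 r9 *.
have kk9 x : x \in [:: 0; 2; 4; 10; loR l; cmR l; p2R l; pmR l; loR l.+1]%N -> s9.1 x = s8.1 x.
  by move=> hx; rewrite n9 //; move: hx; rewrite !inE; rlia.
have kk9R x : (x \in [:: 0; 26; zR l; vR l; sgR l; zR l.+1; vR l.+1]%N) || odd x ->
    s9.2 x = s8.2 x.
  by move=> hx; rewrite r9 //; move: hx; rewrite !inE; rlia.
have hy9 i : s9.2 (i + i + 1)%N = y i by rewrite kk9R ?hy8 //; lia.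
clearbody s9.
have [a10 n10 r10] := den_half l true 4 IH
  (etrans (kk9 0%N isT) (etrans (kk8 0%N isT) hn))
  (etrans (kk9 2%N isT) (etrans (kk8 2%N isT) h2))
  (etrans (kk9 4%N isT) (etrans (kk8 4%N isT) h4))
  (etrans (kk9 10%N isT) (etrans (kk8 10%N isT) hj))
  (etrans (kk9R 0%N isT) (etrans (kk8R 0%N isT) h1))
  (etrans (kk9R 26%N isT) (etrans (kk8R 26%N isT) h0)) hy9.
set s10 := den (halfc b l true _ _) s9 in a10 n10 r10 *.
split.
- by rewrite n10 ?kk9 ?k8 ?e6p ?inE ?eqxx ?orbT //; rlia.
- by rewrite n10 ?kk9 ?k8 ?e6p2 ?inE ?eqxx ?orbT //; rlia.
- rewrite a10 a9.
  have -> : s8.2 6%N = s'.2 6%N by rewrite k8R ?e6acc // !inE; rlia.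
  have E0 x : x \in [:: zR l; vR l; sgR l]%N -> s8.2 x = s.2 x.
    by move=> hx; rewrite kk8R //; move: hx; rewrite !inE; rlia.
  have E1 x : x \in [:: zR l; vR l; sgR l; zR l.+1; vR l.+1]%N -> s9.2 x = s8.2 x.
    by move=> hx; rewrite kk9R //; move: hx; rewrite !inE; rlia.
  have E2 x : x \in [:: cmR l; p2R l; pmR l; loR l.+1; 4]%N -> s9.1 x = s8.1 x.
    by move=> hx; rewrite kk9 //; move: hx; rewrite !inE; rlia.
  have E3 x : x \in [:: p2R l; pmR l]%N -> s8.1 x = s6.1 x.
    by move=> hx; rewrite k8 //; move: hx; rewrite !inE; rlia.
  rewrite !(E1 (zR _), E1 (vR _), E1 (sgR _)) ?inE ?eqxx ?orbT //.
  rewrite !(E2 (cmR _), E2 (pmR _), E2 (loR _), E2 4%N) ?inE ?eqxx ?orbT //.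
  rewrite !(E0 (vR l), E0 (sgR l)) ?inE ?eqxx ?orbT //.
  rewrite !(E3 (pmR l), E3 (p2R l)) ?inE ?eqxx ?orbT //.
  rewrite lo8 z8 v8 e6p e6p2 /term maskS hfr
    !(kk8 (cmR l)) ?inE ?eqxx ?orbT // (kk8 4%N) // h4 addn0.
  by rewrite i3 -!addrA.
Qed.

End Spec.

(** * Local search and pipage rounding as programs *)

Definition evalc (b : bool) (M : nat) : cmd :=
  Bas (NAdd (loR 0) 4 4) ;; Bas (NAdd (cmR 0) 4 4) ;;
  Bas ((if b then ROne else RZero) (zR 0)) ;;
  Bas (ROne (vR 0)) ;; Bas (ROne (sgR 0)) ;; Bas (RZero 6) ;; rec b M 0.

Lemma wrN_evalc b M x : wrN (evalc b M) x ->
  [|| x == 8, x == 9 | ~~ odd x && (64 <= x)].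
Proof.
rewrite /=; case: b => /=;
by case/or3P => [/eqP->|/eqP->|/wrN_rec]; rlia.
Qed.

Lemma wrR_evalc b M x : wrR (evalc b M) x ->
  [|| x \in [:: 6; 8; 10; 12; 14] | ~~ odd x && (64 <= x)].
Proof.
rewrite /= !inE; case: b => /=;
case/or4P => [/eqP->|/eqP->|/eqP->|]; try rlia;
by case/orP => [/eqP->|/wrR_rec]; rewrite ?inE; rlia.
Qed.

Lemma wf_evalc b M : wf (evalc b M).
Proof. by rewrite /= wf_rec; case: b. Qed.

Opaque evalc.

(* From here on real registers 0, 26, 24, 2, 4 hold 1, 0, 2, delta and the
   improvement threshold; nat registers 16, 17 hold the current pair (i, j). *)
Definition ifne (a b : nat) (c : cmd) : cmd := IfN a b c (IfN b a c Skip).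

(** The move is made in place and undone unless it gains more than the threshold; real registers 16
    and 18 keep the old values of y_i and y_j. *)
Definition lsmovec (M : nat) : cmd :=
  evalc false M ;; Bas (RAdd 20 6 4) ;;
  Bas (RSub 22 16 2) ;; StY 16 22 ;; Bas (RAdd 22 18 2) ;; StY 17 22 ;;
  evalc false M ;;
  IfR 20 6 Skip (StY 17 18 ;; StY 16 16).

(** Forced coordinates hold 2, so they fail y_i <= 1 as a source and y_j < 1 as a target. *)
Definition lsbody (M : nat) : cmd :=
  ifne 16 17 (LdY 16 16 ;; LdY 18 17 ;;
    IfR 0 16 Skip (IfR 26 16 (IfR 18 0 (lsmovec M) Skip) Skip)).

Definition sweepc (M : nat) : cmd := For 16 0 (For 17 0 (lsbody M)).

(** Two loops of length K and six of length n give K^2 n^6 = delta^-2 sweeps. *)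
Definition sweepsc (M : nat) : cmd :=
  For 20 3 (For 21 3 (For 22 0 (For 23 0 (For 24 0 (For 25 0 (For 26 0
    (For 27 0 (sweepc M)))))))).

Definition minc (d a b : nat) : cmd :=
  Bas (RSub d 0 b) ;; IfR a d (Bas (RAdd d a 26)) Skip.

Definition putc (neg : bool) (e : nat) : cmd :=
  Bas ((if neg then RSub else RAdd) 30 16 e) ;; StY 16 30 ;;
  Bas ((if neg then RAdd else RSub) 30 18 e) ;; StY 17 30.

(** Both extreme moves along e_i - e_j are computed from the old values in registers 16 and 18, and
    the better one is kept. *)
Definition pipmovec (M : nat) : cmd :=
  minc 22 18 16 ;; minc 32 16 18 ;;
  putc false 22 ;; evalc true M ;; Bas (RAdd 20 6 26) ;;
  putc true 32 ;; evalc true M ;;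
  IfR 6 20 (putc false 22) Skip.

Definition pipbody (M : nat) : cmd :=
  ifne 16 17 (LdY 16 16 ;; LdY 18 17 ;;
    IfR 26 16 (IfR 16 0 (IfR 26 18 (IfR 18 0 (pipmovec M) Skip) Skip) Skip) Skip).

Definition pipc (M : nat) : cmd := For 16 0 (For 17 0 (pipbody M)).

Definition noclob (c : cmd) : bool :=
  [&& wf c, ~~ wrN c 10 & all (fun x => ~~ wrR c x) [:: 0; 26; 24; 2; 4]].

Lemma wrN_evalcF b M x : (x < 64) || odd x -> x != 8 -> x != 9 ->
  wrN (evalc b M) x = false.
Proof. by move=> h1 h2 h3; apply/negP => /wrN_evalc; lia. Qed.

Lemma wrR_evalcF b M x : (x < 64) || odd x -> x \notin [:: 6; 8; 10; 12; 14] ->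
  wrR (evalc b M) x = false.
Proof. by move=> h1 h2; apply/negP => /wrR_evalc; rewrite (negPf h2); lia. Qed.

Lemma noclob_lsbody M : noclob (lsbody M).
Proof. by rewrite /noclob /= !wf_evalc !wrN_evalcF // !wrR_evalcF. Qed.

Lemma noclob_pipbody M : noclob (pipbody M).
Proof. by rewrite /noclob /= !wf_evalc !wrN_evalcF // !wrR_evalcF. Qed.

Lemma wrN_lsbodyF M x : (9 < x) -> (x < 64) || odd x -> wrN (lsbody M) x = false.
Proof. by move=> h1 h2; rewrite /= !wrN_evalcF //; lia. Qed.

Lemma wrN_pipbodyF M x : (9 < x) -> (x < 64) || odd x -> wrN (pipbody M) x = false.
Proof. by move=> h1 h2; rewrite /= !wrN_evalcF //; lia. Qed.

Lemma wrR_lsbody28 M : wrR (lsbody M) 28 = false.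
Proof. by rewrite /= !wrR_evalcF. Qed.

Lemma wrR_pipbody28 M : wrR (pipbody M) 28 = false.
Proof. by rewrite /= !wrR_evalcF. Qed.

(** * Local search and rounding as maps on the array *)

Section Arr.
Variables (R : realType) (orc : nat -> R) (n k K jm M : nat) (delta thr : R).
Local Notation den := (den orc).
Local Open Scope ring_scope.

Definition env (s : st R) : Prop :=
  [/\ s.1 0%N = n, s.1 1%N = k, s.1 2%N = 1%N, s.1 3%N = K & s.1 4%N = 0%N] /\
  [/\ s.2 0%N = 1, s.2 26%N = 0, s.2 24%N = 1 + 1, s.2 2%N = delta & s.2 4%N = thr].

Definition arr (s : st R) (y : nat -> R) : Prop := forall i, s.2 (i + i + 1)%N = y i.

Definition Phi (b : bool) (y : nat -> R) : R :=
  ev n b y orc jm M 0 0 0 (z0 R b) 1 1.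

Definition shift (y : nat -> R) (i j : nat) (e : R) : nat -> R :=
  fun x => if x == i then y i + e else if x == j then y j - e else y x.

Lemma env_den c s : noclob c -> env s -> env (den c s).
Proof.
case/and3P=> w _ /and5P[a1 a2 a3 a4 /andP[a5 _]] [[e1 e2 e3 e4 e5] [f1 f2 f3 f4 f5]].
by split; split; rewrite ?den_const // frameR.
Qed.

Lemma jm_den c s : noclob c -> (den c s).1 10%N = s.1 10%N.
Proof. by case/and3P=> _ h _; rewrite frameN. Qed.

Lemma env_setN i t s : (8 <= i)%N -> env s -> env (setN i t s).
Proof.
move=> hi [[e1 e2 e3 e4 e5] h]; split=> //.
by split; rewrite /= upd_diff //; lia.
Qed.

Lemma arr_den c s y : s.1 2%N = 1%N -> wf c -> (forall x, odd x -> ~~ wrR c x) ->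
  arr s y -> arr (den c s) y.
Proof. by move=> h2 w h a i; rewrite frameR // h //; lia. Qed.

Lemma arr_for i b c (g : nat -> (nat -> R) -> nat -> R) s y :
  noclob c -> wf (For i b c) -> i != 10%N -> env s -> s.1 10%N = jm -> arr s y ->
  (forall t s' y', (t < s.1 b)%N -> env s' -> s'.1 10%N = jm ->
     (forall x, ~~ wrN (For i b c) x -> s'.1 x = s.1 x) -> s'.1 i = t ->
     arr s' y' -> arr (den c s') (g t y')) ->
  arr (den (For i b c) s) (foldl (fun y t => g t y) y (iota 0 (s.1 b))).
Proof.
move=> nc w hi he hj ha H.
have h2 : s.1 2%N = 1%N by case: he => [[]].
pose Inv t (s' : st R) := [/\ env s', s'.1 10%N = jm &
   arr s' (foldl (fun y t => g t y) y (iota 0 t))].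
have [//|t s' ht [fN fR] [i1 i2 i3]|s' [_ _ i3] -> //] :=
  for_inv (orc := orc) (Inv := Inv) h2 w.
have w8 : (8 <= i)%N by case/and4P: w.
have e' := env_setN t w8 i1.
have j' : (setN i t s').1 10%N = jm by rewrite /= upd_diff // eq_sym.
split; [exact: env_den|by rewrite jm_den|].
rewrite -addn1 iotaD foldl_cat /=; apply: H => //.
  by move=> x hx; rewrite /= upd_diff ?fN //; case/norP: hx.
by rewrite /= upd_same.
Qed.

Lemma arr_iter i b c (f : (nat -> R) -> nat -> R) m s y :
  noclob c -> wf (For i b c) -> i != 10%N -> env s -> s.1 10%N = jm -> arr s y ->
  (forall s' y', env s' -> s'.1 10%N = jm -> arr s' y' ->
     arr (den c s') (iter m f y')) ->
  arr (den (For i b c) s) (iter (s.1 b * m) f y).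
Proof.
move=> nc w hi he hj ha H.
have := arr_for (g := fun _ y => iter m f y) nc w hi he hj ha
  (fun t s' y' _ he' hj' _ _ ha' => H s' y' he' hj' ha').
have -> : forall y (q : seq nat), foldl (fun y _ => iter m f y) y q = iter (size q * m) f y.
  by move=> y' q; elim: q y' => //= _ q IH y'; rewrite IH -iterD addnC mulSn.
by rewrite size_iota.
Qed.

Definition dbl (g : nat -> nat -> (nat -> R) -> nat -> R) (y : nat -> R) : nat -> R :=
  foldl (fun y i => foldl (fun y j => g i j y) y (iota 0 n)) y (iota 0 n).

Lemma arr_dbl c g s y : noclob c -> ~~ wrN c 16 -> ~~ wrN c 17 ->
  env s -> s.1 10%N = jm -> arr s y ->
  (forall s y, env s -> s.1 10%N = jm -> arr s y ->
     arr (den c s) (g (s.1 16%N) (s.1 17%N) y)) ->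
  arr (den (For 16 0 (For 17 0 c)) s) (dbl g y).
Proof.
move=> nc h16 h17 he hj ha H.
have w : wf c by case/and3P: nc.
have wi : wf (For 17 0 c) by rewrite /= h17 w.
have wo : wf (For 16 0 (For 17 0 c)) by rewrite /= h16 h17 w.
have nci : noclob (For 17 0 c).
  by move: nc; rewrite /noclob wi => /and3P[_ h1 h2] /=; rewrite h1.
have hn : s.1 0%N = n by case: he => [[]].
rewrite /dbl -[X in foldl _ y (iota 0 X)]hn;
  apply: (arr_for (g := fun i y => foldl (fun y j => g i j y) y (iota 0 n)) nci wo) => // t s' y' ht he' hj' fN e16 ha'.
have hn' : s'.1 0%N = n by case: he' => [[]].
change (arr (den (For 17 0 c) s') (foldl (fun y j => g t j y) y' (iota 0 n))).
rewrite -[X in iota 0 X]hn'; apply: (arr_for (g := fun j y => g t j y) nc wi) => //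
  u s2 y2 hu he2 hj2 fN2 e17 ha2.
by have := H s2 y2 he2 hj2 ha2; rewrite e17 fN2 ?e16 //= h16.
Qed.

Lemma den_evalc b s y : env s -> s.1 10%N = jm -> arr s y ->
  [/\ (den (evalc b M) s).2 6%N = Phi b y,
      arr (den (evalc b M) s) y,
      env (den (evalc b M) s),
      forall x, x != 8%N -> x != 9%N -> (x < 64)%N || odd x ->
        (den (evalc b M) s).1 x = s.1 x &
      forall x, x \notin [:: 6; 8; 10; 12; 14]%N -> (x < 64)%N || odd x ->
        (den (evalc b M) s).2 x = s.2 x].
Proof.
move=> he hj ha.
have h2 : s.1 2%N = 1%N by case: he => [[]].
split.
- case: he => [[e1 e2 e3 e4 e5] [f1 f2 f3 f4 f5]].
  set s1 := den (Bas (NAdd (loR 0) 4 4) ;; Bas (NAdd (cmR 0) 4 4) ;;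
    Bas ((if b then ROne else RZero) (zR 0)) ;;
    Bas (ROne (vR 0)) ;; Bas (ROne (sgR 0)) ;; Bas (RZero 6)) s.
  have -> : den (evalc b M) s = den (rec b M 0) s1 by [].
  have k1 x : x \notin [:: loR 0; cmR 0]%N -> s1.1 x = s.1 x.
    rewrite !inE negb_or => /andP[n1 n2].
    by rewrite /s1; case: (b); rewrite /= !upd_diff.
  have k2 x : x \notin [:: 6; zR 0; vR 0; sgR 0]%N -> s1.2 x = s.2 x.
    rewrite !inE !negb_or => /and4P[n1 n2 n3 n4].
    by rewrite /s1; case: (b); rewrite /= !upd_diff.
  have hy1 i : s1.2 (i + i + 1)%N = y i by rewrite k2 ?ha // !inE; rlia.
  rewrite (@den_rec R orc n b M jm y 0%N s1 (etrans (k1 0%N isT) e1)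
    (etrans (k1 2%N isT) e3) (etrans (k1 4%N isT) e5) (etrans (k1 10%N isT) hj)
    (etrans (k2 0%N isT) f1) (etrans (k2 26%N isT) f2) hy1).
  by rewrite /Phi /s1 /z0; case: (b); rewrite /=; regs; rewrite e5 add0r.
- apply: arr_den => //; first exact: wf_evalc.
  by move=> x hx; apply/negP => /wrR_evalc; rewrite !inE; lia.
- by apply: env_den => //; rewrite /noclob wf_evalc !wrN_evalcF //= !wrR_evalcF.
- by move=> x h8 h9 hx; rewrite frameN // wrN_evalcF.
- by move=> x h8 hx; rewrite frameR ?wf_evalc // wrR_evalcF.
Qed.

Lemma den_StY i r s y : s.1 2%N = 1%N -> i != 8%N -> arr s y -> ~~ odd r ->
  let s' := den (StY i r) s in
  [/\ arr s' (upd y (s.1 i) (s.2 r)), forall x, x != 8%N -> s'.1 x = s.1 x &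
      forall x, ~~ odd x -> s'.2 x = s.2 x].
Proof.
move=> h2 hi ha hr s'.
have e8 : addr i s.1 8%N = (s.1 i + s.1 i + 1)%N by rewrite /addr; regs; rewrite h2.
split.
- move=> x; rewrite /s' /= e8 /upd.
  have -> : (x + x + 1 == s.1 i + s.1 i + 1)%N = (x == s.1 i) by apply/eqP/eqP; lia.
  by case: eqP.
- by move=> x hx; rewrite /s' /= /addr 2!(upd_diff _ _ hx).
- by move=> x hx; rewrite /s' /= e8 upd_diff //; lia.
Qed.

Lemma den_LdY d i s y : s.1 2%N = 1%N -> i != 8%N -> arr s y -> ~~ odd d ->
  let s' := den (LdY d i) s in
  [/\ s'.2 d = y (s.1 i), arr s' y, forall x, x != 8%N -> s'.1 x = s.1 x &
      forall x, x != d -> s'.2 x = s.2 x].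
Proof.
move=> h2 hi ha hr s'.
have e8 : addr i s.1 8%N = (s.1 i + s.1 i + 1)%N by rewrite /addr; regs; rewrite h2.
split.
- by rewrite /s' /= upd_same e8 ha.
- by move=> x; rewrite /s' /= upd_diff ?ha //; lia.
- by move=> x hx; rewrite /s' /= /addr 2!(upd_diff _ _ hx).
- by move=> x hx; rewrite /s' /= upd_diff.
Qed.

Definition lsstep (i j : nat) (y : nat -> R) : nat -> R :=
  if [&& i != j, ~~ (1 < y i), 0 < y i, y j < 1 &
      Phi false y + thr < Phi false (shift y i j (- delta))]
  then shift y i j (- delta) else y.

Lemma arr_ext s y1 y2 : (forall x, y1 x = y2 x) -> arr s y1 -> arr s y2.
Proof. by move=> h a i; rewrite a h. Qed.

Lemma den_ifne a b c s : den (ifne a b c) s = if s.1 a != s.1 b then den c s else s.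
Proof. by rewrite /= ; case: ltngtP. Qed.

Lemma arr_lsbody s y : env s -> s.1 10%N = jm -> arr s y ->
  arr (den (lsbody M) s) (lsstep (s.1 16%N) (s.1 17%N) y).
Proof.
move=> he hj ha; rewrite /lsbody den_ifne /lsstep.
set i := s.1 16%N; set j := s.1 17%N.
case: (eqVneq i j) => hij; first by [].
rewrite [~~ false]/= 2!den_Seq.
have h2 : s.1 2%N = 1%N by case: he => [[]].
have [a1 a2 a3 a4] := den_LdY (d := 16) h2 (isT : 16 != 8)%N ha isT.
set s1 := den (LdY 16 16) s in a1 a2 a3 a4 *.
have h21 : s1.1 2%N = 1%N by rewrite a3.
have [b1 b2 b3 b4] := den_LdY (d := 18) h21 (isT : 17 != 8)%N a2 isT.
set s2 := den (LdY 18 17) s1 in b1 b2 b3 b4 *.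
have e2 : env s2 by do 2![apply: env_den => //].
have j2 : s2.1 10%N = jm by rewrite b3 ?a3.
have i2 : s2.1 16%N = i by rewrite b3 ?a3.
have jj2 : s2.1 17%N = j by rewrite b3 ?a3.
have yi2 : s2.2 16%N = y i by rewrite b4 // a1.
have yj2 : s2.2 18%N = y j by rewrite b1 a3.
clearbody s2; clear s1 a1 a2 a3 a4 h21 b1 b3 b4.
have [[n1 n2 n3 n4 n5] [r1 r2 r3 r4 r5]] := e2.
rewrite !den_IfR r1 yi2 yj2 r2.
case: ltP => h1; first by [].
case: ltP => h3; last by [].
case: ltP => h4; last by [].
rewrite !andTb.
rewrite /lsmovec !den_Seq.
have [c1 c2 c3 c4 c5] := den_evalc false e2 j2 b2.
set s3 := den (evalc _ _) s2 in c1 c2 c3 c4 c5 *.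
have [[m1 m2 m3 m4 m5] [q1 q2 q3 q4 q5]] := c3.
set s4 := den _ s3.
set s5 := den _ s4.
have e5 : env s5 by do 2![apply: env_den => //].
have a4 : arr s4 y by apply: arr_den => // x hx; apply/eqP; lia.
have a5 : arr s5 y by apply: arr_den => // x hx; apply/eqP; lia.
have n5x x : s5.1 x = s3.1 x by [].
have e520 : s5.2 20%N = Phi false y + thr by rewrite /s5 /s4 /=; regs; rewrite c1 q5.
have e522 : s5.2 22%N = y i - delta.
  by rewrite /s5 /s4 /=; regs; rewrite q4 c5 // yi2.
have e516 : s5.2 16%N = y i by rewrite /s5 /s4 /=; regs; rewrite c5 // yi2.
have e518 : s5.2 18%N = y j by rewrite /s5 /s4 /=; regs; rewrite c5 // yj2.
have i5 : s5.1 16%N = i by rewrite n5x c4.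
have j5 : s5.1 17%N = j by rewrite n5x c4.
have jm5 : s5.1 10%N = jm by rewrite n5x c4.
clearbody s5; clear a4; clear s4 s3 c1 c2 c3 c4 c5 m1 m2 m3 m4 m5 q1 q2 q3 q4 q5 n5x.
have h25 : s5.1 2%N = 1%N by case: e5 => [[]].
have [d1 d2 d3] := den_StY h25 (isT : 16 != 8)%N a5 (isT : ~~ odd 22).
rewrite i5 e522 in d1.
set s6 := den (StY 16 22) s5 in d1 d2 d3 *.
have e6 : env s6 by apply: env_den.
clearbody s6; set s7 := den _ s6.
have e7 : env s7 by apply: env_den.
have h27 : s7.1 2%N = 1%N by case: e7 => [[]].
have a7 : arr s7 (upd y i (y i - delta)).
  have h26 : s6.1 2%N = 1%N by rewrite d2.
  by apply: arr_den => // x hx; apply/eqP; lia.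
have e722 : s7.2 22%N = y j + delta.
  rewrite /s7 /=; regs; rewrite !d3 // e518; congr (_ + _).
  by case: e5 => _ [].
have n7 x : x != 8%N -> s7.1 x = s5.1 x by move=> hx; rewrite /s7 /= d2.
have r7 x : x != 22%N -> ~~ odd x -> s7.2 x = s5.2 x.
  by move=> hx hx'; rewrite /s7 /= upd_diff // d3.
clearbody s7; clear s6 d1 d2 d3 e6.
have [d1 d2 d3] := den_StY h27 (isT : 17 != 8)%N a7 (isT : ~~ odd 22).
rewrite n7 // j5 e722 in d1.
set s8 := den (StY 17 22) s7 in d1 d2 d3 *.
have e8 : env s8 by apply: env_den.
have a8 : arr s8 (shift y i j (- delta)).
  apply: arr_ext d1 => x; rewrite /shift /upd.
  by case: (eqVneq x j) => [->|_]; rewrite ?(negPf hij) 1?eq_sym ?(negPf hij) ?opprK.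
have j8 : s8.1 10%N = jm by rewrite d2 ?n7.
have [c1 c2 c3 c4 c5] := den_evalc false e8 j8 a8.
set s9 := den (evalc _ _) s8 in c1 c2 c3 c4 c5 *.
rewrite den_IfR c1 c5 // d3 // r7 // e520.
case: ltP => // h5.
rewrite den_Seq.
have h29 : s9.1 2%N = 1%N by case: c3 => [[]].
have [f1 f2 f3] := den_StY h29 (isT : 17 != 8)%N c2 (isT : ~~ odd 18).
set s10 := den _ s9 in f1 f2 f3 *.
have h210 : s10.1 2%N = 1%N by rewrite f2.
have [g1 g2 g3] := den_StY h210 (isT : 16 != 8)%N f1 (isT : ~~ odd 16).
apply: arr_ext g1 => x; rewrite f2 // f3 // !c4 // !c5 // !d2 // !d3 // !n7 // !r7 //.
rewrite i5 j5 e516 e518 /upd /shift.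
by case: (eqVneq x i) => [->//|_]; case: (eqVneq x j) => [->|].
Qed.

Definition pipstep (i j : nat) (y : nat -> R) : nat -> R :=
  if [&& i != j, 0 < y i, y i < 1, 0 < y j & y j < 1] then
    let y1 := shift y i j (Num.min (y j) (1 - y i)) in
    let y2 := shift y i j (- Num.min (y i) (1 - y j)) in
    if Phi true y2 < Phi true y1 then y1 else y2
  else y.

Lemma den_minc d a b s : s.2 0%N = 1 -> s.2 26%N = 0 -> d \notin [:: 0; 26; a; b]%N ->
  let s' := den (minc d a b) s in
  [/\ s'.2 d = Num.min (s.2 a) (1 - s.2 b), s'.1 = s.1 &
      forall x, x != d -> s'.2 x = s.2 x].
Proof.
rewrite !inE !negb_or => h1 h0 /and4P[d0 d26 da db] s'.
rewrite /s' /minc den_Seq den_IfR /= upd_same upd_diff 1?eq_sym // h1.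
rewrite /Num.min /Order.min; case: ifP => h /=; split=> //.
- by rewrite upd_same !upd_diff 1?eq_sym // h0 addr0.
- by move=> x hx; rewrite !upd_diff.
- by rewrite upd_same.
- by move=> x hx; rewrite upd_diff.
Qed.

Lemma den_putc neg e s y y' i j : env s -> i != j -> s.1 16%N = i -> s.1 17%N = j ->
  s.2 16%N = y i -> s.2 18%N = y j -> e != 30%N -> ~~ odd e ->
  arr s y' -> (forall x, x != i -> x != j -> y' x = y x) ->
  let s' := den (putc neg e) s in
  [/\ arr s' (shift y i j (if neg then - s.2 e else s.2 e)), env s',
      forall x, x != 8%N -> s'.1 x = s.1 x &
      forall x, ~~ odd x -> x != 30%N -> s'.2 x = s.2 x].
Proof.
move=> he hij hi hj yi yj he30 hoe ha hy' s'.
rewrite /s' /putc 3!den_Seq.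
set s1 := den (Bas ((if neg then RSub else RAdd) 30 16 e)) s.
have a1 : arr s1 y'.
  have h2 : s.1 2%N = 1%N by case: he => [[]].
  by rewrite /s1; case: (neg); apply: arr_den => // x hx; apply/eqP; lia.
have e1 : env s1 by rewrite /s1; case: (neg); apply: env_den.
have n1 x : s1.1 x = s.1 x by rewrite /s1; case: (neg).
have r1 x : x != 30%N -> s1.2 x = s.2 x.
  by rewrite /s1; case: (neg) => hx /=; rewrite upd_diff.
have v1 : s1.2 30%N = y i + (if neg then - s.2 e else s.2 e).
  by rewrite /s1; case: (neg); rewrite /= upd_same yi.
clearbody s1.
have h21 : s1.1 2%N = 1%N by case: e1 => [[]].
have [a2 n2 r2] := den_StY h21 (isT : 16 != 8)%N a1 (isT : ~~ odd 30).
set s2 := den (StY 16 30) s1 in a2 n2 r2 *.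
have e2 : env s2 by apply: env_den.
clearbody s2.
set s3 := den (Bas ((if neg then RAdd else RSub) 30 18 e)) s2.
have a3 : arr s3 (upd y' (s1.1 16%N) (s1.2 30%N)).
  have h2 : s2.1 2%N = 1%N by case: e2 => [[]].
  by rewrite /s3; case: (neg); apply: arr_den => // x hx; apply/eqP; lia.
have e3 : env s3 by rewrite /s3; case: (neg); apply: env_den.
have n3 x : s3.1 x = s2.1 x by rewrite /s3; case: (neg).
have r3 x : x != 30%N -> s3.2 x = s2.2 x.
  by rewrite /s3; case: (neg) => hx /=; rewrite upd_diff.
have v3 : s3.2 30%N = y j - (if neg then - s.2 e else s.2 e).
  rewrite /s3; case: (neg); rewrite /= upd_same !r2 // !r1 // yj //.
  by rewrite opprK.
clearbody s3.
have h23 : s3.1 2%N = 1%N by case: e3 => [[]].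
have [a4 n4 r4] := den_StY h23 (isT : 17 != 8)%N a3 (isT : ~~ odd 30).
have e4 : env (den (StY 17 30) s3) by apply: env_den.
split=> //.
- apply: arr_ext a4 => x; rewrite v3 n3 n2 // !n1 v1 hi hj /upd /shift.
  case: (eqVneq x j) => [->|hxj]; first by rewrite eq_sym (negPf hij).
  by case: (eqVneq x i) => [//|hxi]; apply: hy'.
- by move=> x hx; rewrite n4 // n3 n2.
- by move=> x hx hx'; rewrite r4 // r3 // r2 // r1.
Qed.

Lemma arr_pipbody s y : env s -> s.1 10%N = jm -> arr s y ->
  arr (den (pipbody M) s) (pipstep (s.1 16%N) (s.1 17%N) y).
Proof.
move=> he hj ha; rewrite /pipbody den_ifne /pipstep.
set i := s.1 16%N; set j := s.1 17%N.
case: (eqVneq i j) => hij; first by [].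
rewrite [~~ false]/= 2!den_Seq.
have h2 : s.1 2%N = 1%N by case: he => [[]].
have [a1 a2 a3 a4] := den_LdY (d := 16) h2 (isT : 16 != 8)%N ha isT.
set s1 := den (LdY 16 16) s in a1 a2 a3 a4 *.
have h21 : s1.1 2%N = 1%N by rewrite a3.
have [b1 b2 b3 b4] := den_LdY (d := 18) h21 (isT : 17 != 8)%N a2 isT.
set s2 := den (LdY 18 17) s1 in b1 b2 b3 b4 *.
have e2 : env s2 by do 2![apply: env_den => //].
have j2 : s2.1 10%N = jm by rewrite b3 ?a3.
have i2 : s2.1 16%N = i by rewrite b3 ?a3.
have jj2 : s2.1 17%N = j by rewrite b3 ?a3.
have yi2 : s2.2 16%N = y i by rewrite b4 // a1.
have yj2 : s2.2 18%N = y j by rewrite b1 a3.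
have h22 : s2.1 2%N = 1%N by rewrite b3 ?a3.
clearbody s2; clear s1 a1 a2 a3 a4 h21 b1 b3 b4.
have [[n1 n2 n3 n4 n5] [r1 r2 r3 r4 r5]] := e2.
rewrite !den_IfR r1 yi2 yj2 r2.
case: ltP => h3; last by [].
case: ltP => h4; last by [].
case: ltP => h5; last by [].
case: ltP => h6; last by [].
rewrite !andTb.
set y1 := shift y i j (Num.min (y j) (1 - y i)).
set y2 := shift y i j (- Num.min (y i) (1 - y j)).
change (arr (den (pipmovec M) s2) (if Phi true y2 < Phi true y1 then y1 else y2)).
rewrite /pipmovec 7!den_Seq.
have [w3 m3 k3] := den_minc (d := 22) (a := 18) (b := 16) r1 r2 isT.
set s3 := den (minc 22 18 16) s2 in w3 m3 k3 *.
have e3 : env s3 by apply: env_den.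
have a3 : arr s3 y by apply: arr_den => // x hx; rewrite /=; lia.
rewrite yi2 yj2 in w3; clearbody s3.
have [w4 m4 k4] := den_minc (d := 32) (a := 16) (b := 18) (etrans (k3 0%N isT) r1)
  (etrans (k3 26%N isT) r2) isT.
set s4 := den (minc 32 16 18) s3 in w4 m4 k4 *.
have e4 : env s4 by apply: env_den.
have a4 : arr s4 y.
  have h23 : s3.1 2%N = 1%N by case: e3 => [[]].
  by apply: arr_den => // x hx; rewrite /=; lia.
rewrite !k3 // yi2 yj2 in w4; clearbody s4.
have k42 x : x != 22%N -> x != 32%N -> s4.2 x = s2.2 x by move=> *; rewrite k4 ?k3.
have i4 : s4.1 16%N = i by rewrite m4 m3.
have jj4 : s4.1 17%N = j by rewrite m4 m3.
have v422 : s4.2 22%N = Num.min (y j) (1 - y i) by rewrite k4.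
have [a5 e5 n5' r5'] := den_putc false e4 hij i4 jj4 (etrans (k42 16%N isT isT) yi2)
  (etrans (k42 18%N isT isT) yj2) (isT : 22 != 30)%N isT a4 (fun x _ _ => erefl).
set s5 := den (putc false 22) s4 in a5 e5 n5' r5' *.
rewrite v422 -/y1 in a5; clearbody s5.
have j5 : s5.1 10%N = jm by rewrite n5' // m4 m3.
have [c1 c2 c3 c4 c5] := den_evalc true e5 j5 a5.
set s6 := den (evalc true M) s5 in c1 c2 c3 c4 c5 *; clearbody s6.
set s7 := den (Bas (RAdd 20 6 26)) s6.
have e7 : env s7 by apply: env_den.
have a7 : arr s7 y1.
  have h2' : s6.1 2%N = 1%N by case: c3 => [[]].
  by apply: arr_den => // x hx; rewrite /=; lia.
have w7 : s7.2 20%N = Phi true y1.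
  rewrite /s7 /= upd_same c1; case: c3 => _ [_ -> _ _ _]; exact: addr0.
have k7 x : x \in [:: 16; 18; 22; 32]%N -> s7.2 x = s4.2 x.
  rewrite !inE => hx; rewrite /s7 /= upd_diff; last by lia.
  by rewrite c5 ?r5' ?inE //; lia.
have n7 x : x \in [:: 10; 16; 17]%N -> s7.1 x = s4.1 x.
  by rewrite !inE => hx; rewrite /s7 /= c4 ?n5' //; lia.
clearbody s7; clear s6 c1 c2 c3 c4 c5.
have y1E x : x != i -> x != j -> y1 x = y x.
  by move=> hx hx'; rewrite /y1 /shift (negPf hx) (negPf hx').
have y2E x : x != i -> x != j -> y2 x = y x.
  by move=> hx hx'; rewrite /y2 /shift (negPf hx) (negPf hx').
have v716 : s7.2 16%N = y i by rewrite k7 // k42.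
have v718 : s7.2 18%N = y j by rewrite k7 // k42.
have [a8 e8 n8 r8] := den_putc true e7 hij (etrans (n7 16%N isT) i4)
  (etrans (n7 17%N isT) jj4) v716 v718 (isT : 32 != 30)%N isT a7 y1E.
set s8 := den (putc true 32) s7 in a8 e8 n8 r8 *.
rewrite k7 // w4 -/y2 in a8; clearbody s8.
have j8 : s8.1 10%N = jm by rewrite n8 // n7 // m4 m3.
have [c1 c2 c3 c4 c5] := den_evalc true e8 j8 a8.
set s9 := den (evalc true M) s8 in c1 c2 c3 c4 c5 *; clearbody s9.
rewrite den_IfR c1 c5 // r8 // w7; case: ifP => // _.
have v916 : s9.2 16%N = y i by rewrite c5 // r8.
have v918 : s9.2 18%N = y j by rewrite c5 // r8.
have i9 : s9.1 16%N = i by rewrite c4 // n8 // n7.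
have j9 : s9.1 17%N = j by rewrite c4 // n8 // n7.
have [a10 _ _ _] := den_putc false c3 hij i9 j9 v916 v918 (isT : 22 != 30)%N isT c2 y2E.
by move: a10; rewrite c5 // r8 // k7 // v422.
Qed.

Definition sweep : (nat -> R) -> nat -> R := dbl lsstep.

Lemma arr_sweepc s y : env s -> s.1 10%N = jm -> arr s y ->
  arr (den (sweepc M) s) (sweep y).
Proof.
move=> he hj ha; apply: arr_dbl => //; first exact: noclob_lsbody.
- by rewrite wrN_lsbodyF.
- by rewrite wrN_lsbodyF.
- by move=> *; apply: arr_lsbody.
Qed.

Lemma arr_pipc s y : env s -> s.1 10%N = jm -> arr s y ->
  arr (den (pipc M) s) (dbl pipstep y).
Proof.
move=> he hj ha; apply: arr_dbl => //; first exact: noclob_pipbody.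
- by rewrite wrN_pipbodyF.
- by rewrite wrN_pipbodyF.
- by move=> *; apply: arr_pipbody.
Qed.

Opaque lsbody pipbody.

Lemma noclob_For i b c : noclob c -> wf (For i b c) -> i != 10%N -> noclob (For i b c).
Proof. by case/and3P=> _ h1 h2 h3 h4; rewrite /noclob h3 /= negb_or eq_sym h4 h1. Qed.

Lemma arr_sweepsc s y : env s -> s.1 10%N = jm -> arr s y ->
  arr (den (sweepsc M) s) (iter (K * (K * (n * (n * (n * (n * (n * (n * 1)))))))) sweep y).
Proof.
have nc0 := noclob_lsbody M; have w0 : wf (lsbody M) by case/and3P: nc0.
have W x : (9 < x)%N -> (x < 64)%N -> wrN (lsbody M) x = false.
  by move=> h h'; rewrite wrN_lsbodyF // h'.
have hn s' : env s' -> s'.1 0%N = n by case=> [[]].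
have hK s' : env s' -> s'.1 3%N = K by case=> [[]].
have I i c m : (19 < i)%N -> (i < 64)%N -> noclob c -> wf (For i 0 c) ->
   (forall s' y', env s' -> s'.1 10%N = jm -> arr s' y' -> arr (den c s') (iter m sweep y')) ->
   forall s' y', env s' -> s'.1 10%N = jm -> arr s' y' ->
     arr (den (For i 0 c) s') (iter (n * m) sweep y').
  move=> h1 h2 nc wc H s' y' he hj ha; rewrite -(hn _ he).
  by apply: arr_iter => //; lia.
have I3 i c m : (19 < i)%N -> (i < 64)%N -> noclob c -> wf (For i 3 c) ->
   (forall s' y', env s' -> s'.1 10%N = jm -> arr s' y' -> arr (den c s') (iter m sweep y')) ->
   forall s' y', env s' -> s'.1 10%N = jm -> arr s' y' ->
     arr (den (For i 3 c) s') (iter (K * m) sweep y').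
  move=> h1 h2 nc wc H s' y' he hj ha; rewrite -(hK _ he).
  by apply: arr_iter => //; lia.
move: s y; rewrite /sweepsc.
have N1 : noclob (sweepc M) by do 2!(apply: noclob_For => //; try by rewrite /= ?w0 !W).
do 2![apply: (I3 _ _ _) => //; try by (do ?[apply: noclob_For => //]; rewrite /= ?w0 !W)].
do 6![apply: (I _ _ _) => //; try by (do ?[apply: noclob_For => //]; rewrite /= ?w0 !W)].
by move=> s' y' he hj ha /=; apply: arr_sweepc.
Qed.

End Arr.

(** * The complete program *)

Opaque rpow stepc nodec evalc lsbody pipbody.

(* The guessed indices: gR 0 is forced in, the others are forced out.  Nat
   register 10 holds the mask of gR 0, nat 14 and real 28 the best query set so
   far and its value. *)
Definition gR l := 65 + 2 * l.

Fixpoint markc (m : nat) : cmd :=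
  if m is m'.+1 then markc m' ;; StY (gR m') 24 else Skip.

Definition zeroc : cmd := For 15 0 (StY 15 26).

Definition jmc : cmd :=
  Bas (NSet 10 1) ;; For 15 0 (IfN 15 (gR 0) (Bas (NAdd 10 10 10)) Skip).

(** Register 11 starts at 1, the unit of budget spent on the forced index, so at most k - 1 free
    coordinates are filled. *)
Definition fillbody : cmd :=
  LdY 16 15 ;;
  IfR 0 16 Skip (IfN 11 1 (StY 15 0 ;; Bas (NAdd 11 11 2)) Skip).

Definition fillc : cmd := Bas (NSet 11 1) ;; For 15 0 fillbody.

Definition selbody : cmd :=
  LdY 16 15 ;;
  IfR 16 0 Skip (IfR 0 16 Skip (Bas (NAdd 12 12 13))) ;;
  Bas (NAdd 13 13 13).

Definition finalc : cmd :=
  Bas (NAdd 12 10 4) ;; Bas (NSet 13 1) ;; For 15 0 selbody ;;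
  Bas (Query 30 12) ;;
  IfR 28 30 (Bas (NAdd 14 12 4) ;; Bas (RAdd 28 30 26)) Skip.

Definition innerc (s M : nat) : cmd :=
  zeroc ;; markc s.+1 ;; jmc ;; fillc ;; sweepsc M ;; pipc M ;; finalc.

Fixpoint nestc (l : nat) (c : cmd) : cmd :=
  if l is l'.+1 then For (gR l') 0 (nestc l' c) else c.

(** Real register 2 becomes delta = 1 / (K n^3). The mask of all indices is built in order to query
    the total weight W, and register 4 becomes the threshold W delta^2. *)
Definition setupc : cmd :=
  Bas (ROne 0) ;; Bas (RZero 26) ;; Bas (RAdd 24 0 0) ;;
  Bas (ROfN 2 3) ;; Bas (ROfN 30 0) ;;
  Bas (RMul 2 2 30) ;; Bas (RMul 2 2 30) ;; Bas (RMul 2 2 30) ;;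
  Bas (RDiv 2 0 2) ;;
  Bas (NSet 12 0) ;; Bas (NSet 13 1) ;;
  For 15 0 (Bas (NAdd 12 12 13) ;; Bas (NAdd 13 13 13)) ;;
  Bas (Query 4 12) ;; Bas (RMul 4 4 2) ;; Bas (RMul 4 4 2) ;;
  Bas (RZero 28) ;; Bas (NSet 14 0).

Definition mainc (s M : nat) : cmd := setupc ;; nestc s.+1 (innerc s M).

(** Commands cannot write registers below 8, so the constants are loaded and the answer is moved to
    register 0 by raw instructions around the compiled code. *)
Definition program (s M K : nat) : seq instr :=
  [:: NSet 2 1; NSet 3 K] ++ comp 2 (mainc s M) ++ [:: NAdd 0 14 4; Halt].

Lemma wrN_markc m x : wrN (markc m) x -> x == 8.
Proof. by elim: m => //= m IH /orP[/IH|]. Qed.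

Lemma wrR_markc m x : wrR (markc m) x -> odd x.
Proof. by elim: m => //= m IH /orP[/IH|]. Qed.

Lemma wf_markc m : wf (markc m).
Proof. by elim: m => //= m ->; rewrite /gR; lia. Qed.

Opaque markc.

Lemma wrN_sweepsc M x : wrN (sweepsc M) x ->
  [|| x == 8, x == 9, (16 <= x) && (x <= 27) | ~~ odd x && (64 <= x)].
Proof.
have H : wrN (lsbody M) x -> [|| x == 8, x == 9 | ~~ odd x && (64 <= x)].
  move=> hx; case: (boolP ((9 < x) && ((x < 64) || odd x))) => [/andP[h1 h2]|].
    by rewrite wrN_lsbodyF in hx.
  have : x < 8 -> False.
    move=> h8; move: hx; rewrite wf_const //.
    by case/and3P: (noclob_lsbody M).
  lia.
rewrite /=; case: (wrN (lsbody M) x) H => H; last by lia.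
by have := H isT; lia.
Qed.

Lemma wrN_pipc M x : wrN (pipc M) x ->
  [|| x == 8, x == 9, (16 <= x) && (x <= 17) | ~~ odd x && (64 <= x)].
Proof.
have H : wrN (pipbody M) x -> [|| x == 8, x == 9 | ~~ odd x && (64 <= x)].
  move=> hx; case: (boolP ((9 < x) && ((x < 64) || odd x))) => [/andP[h1 h2]|].
    by rewrite wrN_pipbodyF in hx.
  have : x < 8 -> False.
    move=> h8; move: hx; rewrite wf_const //.
    by case/and3P: (noclob_pipbody M).
  lia.
rewrite /=; case: (wrN (pipbody M) x) H => H; last by lia.
by have := H isT; lia.
Qed.

Lemma wf_sweepsc M : wf (sweepsc M).
Proof.
have w : wf (lsbody M) by case/and3P: (noclob_lsbody M).
by rewrite /= w !wrN_lsbodyF.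
Qed.

Lemma wf_pipc M : wf (pipc M).
Proof.
have w : wf (pipbody M) by case/and3P: (noclob_pipbody M).
by rewrite /= w !wrN_pipbodyF.
Qed.

Lemma noclob_sweepsc M : noclob (sweepsc M).
Proof.
rewrite /noclob wf_sweepsc; apply/and3P; split=> //.
  by apply/negP => /wrN_sweepsc.
by case/and3P: (noclob_lsbody M).
Qed.

Lemma noclob_pipc M : noclob (pipc M).
Proof.
rewrite /noclob wf_pipc; apply/and3P; split=> //.
  by apply/negP => /wrN_pipc.
by case/and3P: (noclob_pipbody M).
Qed.

Lemma wrR_sweepsc28 M : wrR (sweepsc M) 28 = false.
Proof. by rewrite /= wrR_lsbody28. Qed.

Lemma wrR_pipc28 M : wrR (pipc M) 28 = false.
Proof. by rewrite /= wrR_pipbody28. Qed.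

Opaque sweepsc pipc.

(** * Effect of the pieces of the main program *)

Section Spec.
Variables (R : realType) (orc : nat -> R) (n k K M : nat) (delta thr : R).
Local Notation den := (den orc).
Local Notation env := (env n k K delta thr).
Local Open Scope ring_scope.

Lemma env_den' c s : wf c -> all (fun x => ~~ wrR c x) [:: 0; 26; 24; 2; 4]%N ->
  env s -> env (den c s).
Proof.
move=> w /and5P[a1 a2 a3 a4 /andP[a5 _]] [[e1 e2 e3 e4 e5] [f1 f2 f3 f4 f5]].
by split; split; rewrite ?den_const // frameR.
Qed.

Lemma arr_self (s : st R) : arr s (fun i => s.2 (i + i + 1)%N).
Proof. by []. Qed.

Lemma den_zeroc s : env s -> exists2 y, arr (den zeroc s) y &
  forall x, (x < n)%N -> y x = 0.
Proof.
move=> he; have hn : s.1 0%N = n by case: he => [[]].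
have H t s' y' : (t < s.1 0)%N -> env s' -> s'.1 10%N = s.1 10%N ->
    (forall x, ~~ wrN zeroc x -> s'.1 x = s.1 x) -> s'.1 15%N = t -> arr s' y' ->
    arr (den (StY 15 26) s') (upd y' t 0).
  move=> ht he' hj fN e15 ha.
  have h2 : s'.1 2%N = 1%N by case: he' => [[]].
  have [a _ _] := den_StY orc h2 (isT : 15 != 8)%N ha (isT : ~~ odd 26).
  by move: a; rewrite e15; case: he' => _ [_ ->].
have A := arr_for (g := fun t y => upd y t 0) (isT : noclob (StY 15 26)) (isT : wf zeroc)
  isT he erefl (arr_self s) H.
eexists; first exact: A.
rewrite hn; move: (fun i : nat => _) => y x.
elim: n => [//|t IH] hx; rewrite -addn1 iotaD foldl_cat /= add0n.
case: (eqVneq x t) => [->|hne]; first by rewrite upd_same.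
by rewrite upd_diff // IH //; lia.
Qed.

Lemma den_markc m s y : s.1 2%N = 1%N -> s.2 24%N = 1 + 1 -> arr s y ->
  arr (den (markc m) s)
    (fun x => if has (fun l => s.1 (gR l) == x) (iota 0 m) then 1 + 1 else y x).
Proof.
move=> h2 h24 ha; elim: m => [//|m IH].
rewrite -[den _ s]/(den (StY (gR m) 24) (den (markc m) s)).
have kN x : x != 8%N -> (den (markc m) s).1 x = s.1 x.
  by move=> hx; apply: frameN; apply: contra hx; apply: wrN_markc.
have kR : (den (markc m) s).2 24%N = 1 + 1.
  by rewrite frameR ?wf_markc //; apply/negP => /wrR_markc.
have h2' : (den (markc m) s).1 2%N = 1%N by rewrite kN.
have h8 : gR m != 8%N by rewrite /gR; lia.
have [a _ _] := den_StY orc h2' h8 IH (isT : ~~ odd 24).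
apply: arr_ext a => x; rewrite kR kN // /upd -(addn1 m) iotaD has_cat /= orbF add0n.
by rewrite eq_sym; case: eqP; rewrite ?orbT ?orbF.
Qed.

Lemma den_jmc s : s.1 0%N = n -> s.1 2%N = 1%N -> (s.1 (gR 0) < n)%N ->
  (den jmc s).1 10%N = (2 ^ s.1 (gR 0))%N.
Proof.
move=> hn h2 hg; rewrite /jmc den_Seq; set s1 := den _ s.
have e0 : s1.1 0%N = n by rewrite /s1 /= upd_diff.
have e2 : s1.1 2%N = 1%N by rewrite /s1 /= upd_diff.
have eg : s1.1 (gR 0) = s.1 (gR 0) by rewrite /s1 /= upd_diff.
pose Inv t (s' : st R) := s'.1 10%N = (2 ^ minn t (s.1 (gR 0)))%N.
have i0 : Inv 0%N s1 by rewrite /Inv min0n /s1 /= upd_same.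
have [t s' ht [fN _] I|s' I ->] := for_inv (orc := orc) (Inv := Inv) e2
  (isT : wf (For 15 0 (IfN 15 (gR 0) (Bas (NAdd 10 10 10)) Skip))) i0.
  rewrite /Inv den_IfN /= upd_same upd_diff // fN // eg.
  case: ltnP => h; rewrite /= ?upd_same !upd_diff // I.
    have -> : minn t.+1 (s.1 (gR 0)) = (minn t (s.1 (gR 0))).+1 by lia.
    by rewrite expnS; lia.
  by congr (2 ^ _)%N; lia.
rewrite /= upd_diff // I e0; congr (2 ^ _)%N; lia.
Qed.

Lemma den_fillc s y : env s -> arr s y ->
  exists2 y', arr (den fillc s) y' & forall x, (x < n)%N ->
    y' x = if fr y x then
             if ((count (fr y) (iota 0 x)).+1 < k)%N then 1 else y x
           else y x.
Proof.
move=> he ha; rewrite /fillc den_Seq; set s1 := den _ s.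
have e1 : env s1 by apply: env_den'.
have a1 : arr s1 y by [].
have c1 : s1.1 11%N = 1%N by rewrite /s1 /= upd_same.
clearbody s1.
have [[g0 g1 g2 g3 g4] _] := e1.
pose target x := if fr y x then if ((count (fr y) (iota 0 x)).+1 < k)%N then 1 else y x
   else y x.
(* The counter stops at k; [maxn] covers k = 0, where it keeps its initial value 1. *)
pose Inv t (s' : st R) := [/\ env s',
   s'.1 11%N = minn (count (fr y) (iota 0 t)).+1 (maxn k 1) &
   arr s' (fun x => if (x < t)%N then target x else y x)].
have i0 : Inv 0%N s1 by split=> //; rewrite c1 /=; lia.
have [t s' ht _ [I1 I2 I3]|s' [I1 I2 I3] ->] := for_inv (orc := orc) (Inv := Inv) g2
  (isT : wf (For 15 0 fillbody)) i0; last first.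
  by eexists; [exact: I3|move=> x hx; rewrite g0 hx].
have E1 : env (setN 15 t s') by apply: env_setN.
set s2 := setN 15 t s' in E1 *.
have A2 : arr s2 (fun x => if (x < t)%N then target x else y x) by [].
have N2 x : x != 15%N -> s2.1 x = s'.1 x by move=> hx; rewrite /s2 /= upd_diff.
have N15 : s2.1 15%N = t by rewrite /s2 /= upd_same.
clearbody s2.
rewrite /fillbody den_Seq.
have h22 : s2.1 2%N = 1%N by case: E1 => [[]].
have [b1 b2 b3 b4] := den_LdY orc (d := 16) h22 (isT : 15 != 8)%N A2 isT.
have E3 : env (den (LdY 16 15) s2) by apply: env_den'.
set s3 := den (LdY 16 15) s2 in b1 b2 b3 b4 E3 *; clearbody s3.
rewrite N15 ltnn in b1.
have [[_ k1 k2 _ _] [r1 _ _ _ _]] := E3.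
have cS : count (fr y) (iota 0 t.+1) = (count (fr y) (iota 0 t) + fr y t)%N.
  by rewrite -addn1 iotaD count_cat /= addn0 add0n.
have tE : target t = if fr y t then
    if ((count (fr y) (iota 0 t)).+1 < k)%N then 1 else y t else y t by [].
rewrite den_IfR r1 b1; have -> : (1 < y t) = ~~ fr y t by rewrite /fr negbK.
have ltE x : (x < t.+1)%N = (x == t) || (x < t)%N by lia.
have skip : target t = y t -> forall m, (forall x, x != 8%N -> m.1 x = s2.1 x) ->
   env m -> arr m (fun x => if (x < t)%N then target x else y x) ->
   arr m (fun x => if (x < t.+1)%N then target x else y x).
  move=> et m _ _; apply: arr_ext => x; rewrite ltE.
  by case: (eqVneq x t) => [->|_] //=; rewrite ltnn et.
case: (boolP (fr y t)) => hf; rewrite [~~ _]/=; last first.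
  split=> //; first by rewrite b3 // N2 // I2 cS (negPf hf) addn0.
  by apply: (skip _ s3) => //; rewrite tE (negPf hf).
rewrite den_IfN b3 // N2 // I2 k1.
have -> : (minn (count (fr y) (iota 0 t)).+1 (maxn k 1) < k)%N =
  ((count (fr y) (iota 0 t)).+1 < k)%N by lia.
case: ifP => hk; last first.
  split=> //; first by rewrite b3 // N2 // I2 cS hf; lia.
  by apply: (skip _ s3) => //; rewrite tE hf hk.
rewrite den_Seq.
have [d1 d2 d3] := den_StY orc k2 (isT : 15 != 8)%N b2 (isT : ~~ odd 0).
have E4 : env (den (StY 15 0) s3) by apply: env_den'.
set s4 := den (StY 15 0) s3 in d1 d2 d3 E4 *; clearbody s4.
rewrite b3 // N15 r1 in d1.
split.
- exact: env_den'.
- rewrite cS /= upd_same !d2 // !b3 // N2 // I2 (N2 2%N) //.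
  have -> : s'.1 2%N = 1%N by case: I1 => [[]].
  by rewrite hf; lia.
- have A5 := arr_ext (y2 := fun x => if (x < t.+1)%N then target x else y x) _ d1.
  have : arr s4 (fun x => if (x < t.+1)%N then target x else y x).
    apply: A5 => x; rewrite /upd ltE.
    by case: (eqVneq x t) => [->|_] //=; rewrite tE hf hk.
  by [].
Qed.

Lemma den_finalc s y : env s -> arr s y ->
  let X := (s.1 10%N + mask (fun i => ~~ (y i < 1)%R && ~~ (1 < y i)%R) n)%N in
  let s' := den finalc s in
  s'.1 14%N = (if s.2 28%N < orc X then X else s.1 14%N) /\
  s'.2 28%N = (if s.2 28%N < orc X then orc X else s.2 28%N).
Proof.
move=> he ha X s'; rewrite /s' /finalc 4!den_Seq.
set s1 := den (Bas (NSet 13 1)) _.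
have e1 : env s1 by do 2![apply: env_den' => //].
have a1 : arr s1 y by [].
have m1 : s1.1 12%N = s.1 10%N.
  by rewrite /s1 /=; regs; case: he => [[_ _ _ _ ->] _]; rewrite addn0.
have p1 : s1.1 13%N = 1%N by rewrite /s1 /= upd_same.
have b1 : s1.1 14%N = s.1 14%N by rewrite /s1 /=; regs.
have v1 : s1.2 28%N = s.2 28%N by [].
clearbody s1.
have [[g0 g1 g2 g3 g4] [f1 f2 _ _ _]] := e1.
pose B i := ~~ (y i < 1)%R && ~~ (1 < y i)%R.
pose Inv t (s' : st R) := [/\ env s', arr s' y, s'.1 13%N = (2 ^ t)%N &
   s'.1 12%N = (s.1 10%N + mask B t)%N].
have i0 : Inv 0%N s1 by split; rewrite // mask0 addn0.
have fr14 : (den (For 15 0 selbody) s1).1 14%N = s.1 14%N by rewrite frameN ?b1.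
have fr28 : (den (For 15 0 selbody) s1).2 28%N = s.2 28%N by rewrite frameR ?v1.
have [t s2 ht _ [I1 I2 I3 I4]|s2 [I1 I2 I3 I4] e2] := for_inv (orc := orc) (Inv := Inv) g2
  (isT : wf (For 15 0 selbody)) i0; last first.
  set s3 := den (For 15 0 selbody) s1 in fr14 fr28 e2 *.
  have e12 : s3.1 12%N = X by rewrite e2 /= upd_diff // I4 g0.
  have e4 : s3.1 4%N = 0%N by rewrite e2 /= upd_diff //; case: I1 => [[]].
  have e26 : s3.2 26%N = 0 by rewrite e2 /=; case: I1 => [_ []].
  clearbody s3.
  rewrite den_IfR /= upd_same upd_diff // e12 fr28.
  case: ifP => _ /=; split; regs; rewrite ?e12 ?e4 ?e26 ?addn0 ?addr0 ?fr14 ?fr28 //.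
set s3 := setN 15 t s2.
have E3 : env s3 by apply: env_setN.
have A3 : arr s3 y by [].
have N3 x : x != 15%N -> s3.1 x = s2.1 x by move=> hx; rewrite /s3 /= upd_diff.
have N15 : s3.1 15%N = t by rewrite /s3 /= upd_same.
clearbody s3; rewrite /selbody 2!den_Seq.
have h23 : s3.1 2%N = 1%N by case: E3 => [[]].
have [q1 q2 q3 q4] := den_LdY orc (d := 16) h23 (isT : 15 != 8)%N A3 isT.
have E4 : env (den (LdY 16 15) s3) by apply: env_den'.
set s4 := den (LdY 16 15) s3 in q1 q2 q3 q4 E4 *; clearbody s4.
rewrite N15 in q1; have [_ [r1 _ _ _ _]] := E4.
have n12 : s4.1 12%N = (s.1 10%N + mask B t)%N by rewrite q3 // N3.
have n13 : s4.1 13%N = (2 ^ t)%N by rewrite q3 // N3.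
rewrite den_IfR r1 q1; set s5 := (if _ then _ else _).
have [E5 A5 n5 p5] : [/\ env s5, arr s5 y, s5.1 13%N = (2 ^ t)%N &
    s5.1 12%N = (s.1 10%N + mask B t.+1)%N].
  rewrite /s5 maskS {2}/B; case: ifP => h1 /=; first by rewrite addn0.
  rewrite r1 q1; case: ifP => h2 /=; first by rewrite addn0.
  split=> //.
  by rewrite upd_same n12 n13 addnA.
clearbody s5; split.
- exact: env_den'.
- by [].
- by rewrite /= upd_same n5 expnS; lia.
- by rewrite /= upd_diff.
Qed.

Lemma den_setupc s : s.1 0%N = n -> s.1 1%N = k -> s.1 2%N = 1%N -> s.1 3%N = K ->
  s.1 4%N = 0%N -> delta = 1 / (K%:R * n%:R * n%:R * n%:R) ->
  thr = orc (mask xpredT n) * delta * delta ->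
  [/\ env (den setupc s), (den setupc s).1 14%N = 0%N & (den setupc s).2 28%N = 0].
Proof.
move=> h0 h1 h2 h3 h4 hd ht; rewrite /setupc 11!den_Seq.
set s1 := den (Bas (NSet 13 1)) _.
have N1 x : (x < 12)%N -> s1.1 x = s.1 x by move=> hx; rewrite /s1 /=; regs.
have c12 : s1.1 12%N = 0%N by rewrite /s1 /=; regs.
have c13 : s1.1 13%N = 1%N by rewrite /s1 /=; regs.
have R0 : s1.2 0%N = 1 by rewrite /s1 /=; regs.
have R26 : s1.2 26%N = 0 by rewrite /s1 /=; regs.
have R24 : s1.2 24%N = 1 + 1 by rewrite /s1 /=; regs.
have R2 : s1.2 2%N = delta by rewrite /s1 /=; regs; rewrite h0 h3 hd.
clearbody s1; rewrite 5!den_Seq.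
pose Inv t (s' : st R) := s'.1 13%N = (2 ^ t)%N /\ s'.1 12%N = mask xpredT t.
have i0 : Inv 0%N s1 by split; rewrite // mask0.
have g2 : s1.1 2%N = 1%N by rewrite N1.
pose lc := For 15 0 (Bas (NAdd 12 12 13) ;; Bas (NAdd 13 13 13)).
rewrite -/lc.
have kR x : (den lc s1).2 x = s1.2 x by apply: frameR.
have kN x : (x < 12)%N -> (den lc s1).1 x = s1.1 x.
  by move=> hx; apply: frameN => /=; lia.
have [t s' ht' _ [I1 I2]|s' [I1 I2] e] := for_inv (orc := orc) (Inv := Inv) g2
  (isT : wf lc) i0.
  split; rewrite /=; regs; rewrite I1 ?I2 ?maskS ?expnS //; lia.
set s2 := den lc s1 in kR kN e *.
have e12 : s2.1 12%N = mask xpredT n by rewrite e /= upd_diff // I2 N1 // h0.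
clearbody s2; split; last first.
- by rewrite /=; regs.
- by rewrite /=; regs.
split; split; rewrite /=; regs; rewrite ?e12 ?kN ?N1 ?kR ?R0 ?R26 ?R24 ?R2 -?ht //.
Qed.

(** The best value never decreases, so it is enough that the one iteration whose counters agree with
    [g] reaches [V]. *)
Lemma den_nestc (J : st R -> Prop) c L (g : nat -> nat) (V : R) l s :
  wf c -> (forall m, (m < L)%N -> ~~ wrN c (gR m)) ->
  (forall s, J s -> s.1 0%N = n /\ s.1 2%N = 1%N) ->
  (forall m t s, (m < L)%N -> J s -> J (setN (gR m) t s)) ->
  (forall s, J s -> (forall m, (m < L)%N -> (s.1 (gR m) < n)%N) ->
    [/\ J (den c s), s.2 28%N <= (den c s).2 28%N &
       (forall m, (m < L)%N -> s.1 (gR m) = g m) -> V <= (den c s).2 28%N]) ->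
  (forall m, (m < L)%N -> (g m < n)%N) ->
  (l <= L)%N -> J s -> (forall m, (l <= m < L)%N -> (s.1 (gR m) < n)%N) ->
  [/\ J (den (nestc l c) s), s.2 28%N <= (den (nestc l c) s).2 28%N &
     (forall m, (l <= m < L)%N -> s.1 (gR m) = g m) ->
     V <= (den (nestc l c) s).2 28%N].
Proof.
move=> w wg Jc JN H gn; elim: l s => [|l IH] s hl hJ hs; first exact: H.
have wn q x : wrN (nestc q c) x -> wrN c x || has (fun m => x == gR m) (iota 0 q).
  elim: q => [|q IHq]; first by move=> /= ->.
  rewrite [wrN _ _]/= => /orP[/eqP->|/IHq /orP[->//|/hasP[m hm /eqP->]]];
    apply/orP; right; apply/hasP; first by exists q; rewrite ?mem_iota ?add0n ?ltnSn ?eqxx.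
  by exists m => //; move: hm; rewrite !mem_iota; lia.
have wfn q : (q <= L)%N -> wf (nestc q c).
  elim: q => [|q IHq] hq; first exact: w.
  apply/and4P; split; [by rewrite /gR; lia|by []| |by apply: IHq; lia].
  apply/negP => /wn /orP[|/hasP[m]]; first by apply/negP/wg; lia.
  by rewrite mem_iota /gR; lia.
have [hn h2] := Jc _ hJ.
(* If the outer counters agree with [g], then [V] has been reached as soon as this counter has
   passed [g l]. *)
pose Inv t (s' : st R) := [/\ J s', s.2 28%N <= s'.2 28%N &
   (forall m, (l < m < L)%N -> s.1 (gR m) = g m) -> (g l < t)%N -> V <= s'.2 28%N].
have i0 : Inv 0%N s by split.
have [t s' ht [fN _] [I1 I2 I3]|s' [I1 I2 I3] e] :=
  for_inv (orc := orc) (Inv := Inv) h2 (wfn l.+1 hl) i0; last first.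
  rewrite [nestc _ _]/= e; split=> //; first exact: JN.
  by move=> hg; apply: I3 => //; rewrite hn gn.
have hk m : (l < m < L)%N -> s'.1 (gR m) = s.1 (gR m).
  move=> hm; apply: fN; apply/negP => /(wn l.+1) /orP[|/hasP[q]].
    by apply/negP/wg; lia.
  by rewrite mem_iota /gR; lia.
have J2 : J (setN (gR l) t s') by apply: JN.
have e1 m : (l <= m < L)%N -> (setN (gR l) t s').1 (gR m) =
    if m == l then t else s.1 (gR m).
  move=> hm; rewrite /=; case: eqP => [->|hne]; first by rewrite upd_same.
  by rewrite upd_diff ?hk //; [lia|rewrite /gR; apply/eqP; lia].
have [||H1 H2 H3] := IH (setN (gR l) t s') _ J2; first by lia.
  move=> m hm; rewrite e1 //; case: eqP => [_|hne]; first by rewrite -hn.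
  by apply: hs; lia.
split=> //; first exact: le_trans I2 _.
move=> hg; rewrite ltnS leq_eqVlt => /orP[/eqP et|hlt].
  by apply: H3 => m hm; rewrite e1 //; case: eqP => [->//|hne]; apply: hg; lia.
by apply: le_trans H2; apply: I3.
Qed.

End Spec.

Lemma wf_innerc s M : wf (innerc s M).
Proof. by rewrite /innerc /= wf_markc wf_sweepsc wf_pipc. Qed.

Lemma wrN_innerc_guess s M m : wrN (innerc s M) (gR m) = false.
Proof.
apply/negP; rewrite /=; case: (boolP (wrN (markc s.+1) _)) => [/wrN_markc|_].
  by rewrite /gR; lia.
case: (boolP (wrN (sweepsc M) _)) => [/wrN_sweepsc|_]; first by rewrite /gR; lia.
case: (boolP (wrN (pipc M) _)) => [/wrN_pipc|_]; first by rewrite /gR; lia.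
by rewrite /gR; lia.
Qed.

Lemma wf_mainc s M : wf (mainc s M).
Proof.
have wn q x : wrN (nestc q (innerc s M)) x ->
    wrN (innerc s M) x || has (fun m => x == gR m) (iota 0 q).
  elim: q => [|q IHq]; first by move=> /= ->.
  rewrite [wrN _ _]/= => /orP[/eqP->|/IHq /orP[->//|/hasP[m hm /eqP->]]];
    apply/orP; right; apply/hasP; first by exists q; rewrite ?mem_iota ?add0n ?ltnSn ?eqxx.
  by exists m => //; move: hm; rewrite !mem_iota; lia.
have wfn q : wf (nestc q (innerc s M)).
  elim: q => [|q IHq]; first exact: wf_innerc.
  apply/and4P; split; [by rewrite /gR; lia|by []| |by []].
  apply/negP => /wn /orP[|/hasP[m]]; first by rewrite wrN_innerc_guess.
  by rewrite mem_iota /gR; lia.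
exact: (wfn s.+1).
Qed.

Section Inner.
Variables (R : realType) (orc : nat -> R) (n k K M : nat) (delta thr : R).
Local Notation den := (den orc).
Local Notation env := (env n k K delta thr).
Local Open Scope ring_scope.

Definition guessed (N : nat -> nat) (s0 i : nat) : bool :=
  has (fun l => N (gR l) == i) (iota 0 s0.+1).

Definition sweeps : nat := (K * (K * (n * (n * (n * (n * (n * (n * 1))))))))%N.

Lemma den_innerc s0 s : env s -> (forall l, (l < s0.+1)%N -> (s.1 (gR l) < n)%N) ->
  exists2 y : nat -> R,
    forall i, (i < n)%N -> y i =
      if ~~ guessed s.1 s0 i then
        if ((count (fun i => ~~ guessed s.1 s0 i) (iota 0 i)).+1 < k)%N then 1 else 0
      else 1 + 1 &
    let j0 := s.1 (gR 0) in
    let z := dbl n (pipstep orc n (2 ^ j0)%N M)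
      (iter sweeps (sweep orc n (2 ^ j0)%N M delta thr) y) in
    let X := (2 ^ j0 + mask (fun i => ~~ (z i < 1)%R && ~~ (1 < z i)%R) n)%N in
    let s' := den (innerc s0 M) s in
    [/\ env s',
     s'.1 14%N = (if s.2 28%N < orc X then X else s.1 14%N) &
     s'.2 28%N = (if s.2 28%N < orc X then orc X else s.2 28%N)].
Proof.
move=> he hg; rewrite /innerc 6!den_Seq.
have [y1 a1 z1] := den_zeroc orc he.
have e1 : env (den zeroc s) by apply: env_den'.
have g1 l : (den zeroc s).1 (gR l) = s.1 (gR l).
  by apply: frameN; rewrite /= /gR; lia.
have b1 : (den zeroc s).1 14%N = s.1 14%N by apply: frameN.
have v1 : (den zeroc s).2 28%N = s.2 28%N.
  by apply: frameR => //; case: he => [[]].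
set s1 := den zeroc s in a1 e1 g1 b1 v1 *; clearbody s1.
have h21 : s1.1 2%N = 1%N by case: e1 => [[]].
have h24 : s1.2 24%N = 1 + 1 by case: e1 => [_ []].
have a2 := den_markc orc s0.+1 h21 h24 a1.
have wm x : ~~ odd x -> ~~ wrR (markc s0.+1) x.
  by move=> hx; apply/negP => /wrR_markc; apply/negP.
have e2 : env (den (markc s0.+1) s1).
  by apply: env_den'; rewrite ?wf_markc //= !wm.
have N2 x : x != 8%N -> (den (markc s0.+1) s1).1 x = s1.1 x.
  by move=> hx; apply: frameN; apply: contra hx; apply: wrN_markc.
have v2 : (den (markc s0.+1) s1).2 28%N = s.2 28%N by rewrite frameR ?wf_markc ?wm.
set s2 := den (markc s0.+1) s1 in a2 e2 N2 v2 *.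
have gn8 l : gR l != 8%N by rewrite /gR; lia.
have g2 l : s2.1 (gR l) = s.1 (gR l) by rewrite N2 // g1.
have b2 : s2.1 14%N = s.1 14%N by rewrite N2.
have {}a2 : arr s2 (fun x => if guessed s.1 s0 x then 1 + 1 else y1 x).
  apply: arr_ext a2 => x; rewrite /guessed; congr (if _ then _ else _).
  by apply: eq_has => l; rewrite g1.
clearbody s2.
set y2 := (fun x => if _ then _ else _) in a2.
have h22 : s2.1 2%N = 1%N by case: e2 => [[]].
have h02 : s2.1 0%N = n by case: e2 => [[]].
have j3 := den_jmc orc h02 h22 _; rewrite g2 in j3; have {}j3 := j3 (hg 0%N isT).
have e3 : env (den jmc s2) by apply: env_den'.
have a3 : arr (den jmc s2) y2 by apply: arr_den.
have g3 l : (den jmc s2).1 (gR l) = s.1 (gR l).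
  by rewrite -g2; apply: frameN; rewrite /= /gR; lia.
have b3 : (den jmc s2).1 14%N = s.1 14%N by rewrite frameN.
have v3 : (den jmc s2).2 28%N = s.2 28%N by rewrite frameR.
set s3 := den jmc s2 in j3 e3 a3 g3 b3 v3 *; clearbody s3.
have [y a4 hy] := den_fillc orc e3 a3.
have h23 : s3.1 2%N = 1%N by case: e3 => [[]].
have e4 : env (den fillc s3) by apply: env_den'.
have j4 : (den fillc s3).1 10%N = (2 ^ s.1 (gR 0))%N by rewrite frameN.
have b4 : (den fillc s3).1 14%N = s.1 14%N by rewrite frameN.
have v4 : (den fillc s3).2 28%N = s.2 28%N by rewrite frameR.
set s4 := den fillc s3 in a4 e4 j4 b4 v4 *; clearbody s4.
exists y.
  move=> i hi; rewrite hy //.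
  have fE x : (x < n)%N -> fr y2 x = ~~ guessed s.1 s0 x.
    move=> hx; rewrite /fr /y2; case: (guessed _ _ _); first by rewrite ltrDl ltr01.
    by rewrite z1 // ltNge ler01.
  rewrite fE // (@eq_in_count _ _ (fun i => ~~ guessed s.1 s0 i)); last first.
    by move=> x; rewrite mem_iota add0n => /andP[_ hx]; apply: fE; lia.
  by rewrite /y2; case: (guessed _ _ _) => //=; rewrite z1.

have a5 := @arr_sweepsc R orc n k K _ M delta thr s4 y e4 j4 a4.
have e5 : env (den (sweepsc M) s4) by apply: env_den => //; apply: noclob_sweepsc.
have N5 x : x \in [:: 10; 14]%N -> (den (sweepsc M) s4).1 x = s4.1 x.
  by rewrite !inE => hx; apply: frameN; apply/negP => /wrN_sweepsc; lia.
have h24' : s4.1 2%N = 1%N by case: e4 => [[]].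
have v5 : (den (sweepsc M) s4).2 28%N = s.2 28%N.
  by rewrite frameR ?wf_sweepsc ?wrR_sweepsc28.
set s5 := den (sweepsc M) s4 in a5 e5 N5 v5 *; clearbody s5.
have j5 : s5.1 10%N = (2 ^ s.1 (gR 0))%N by rewrite N5.
have a6 := @arr_pipc R orc n k K _ M delta thr s5 _ e5 j5 a5.
have e6 : env (den (pipc M) s5) by apply: env_den => //; apply: noclob_pipc.
have N6 x : x \in [:: 10; 14]%N -> (den (pipc M) s5).1 x = s5.1 x.
  by rewrite !inE => hx; apply: frameN; apply/negP => /wrN_pipc; lia.
have h25 : s5.1 2%N = 1%N by case: e5 => [[]].
have v6 : (den (pipc M) s5).2 28%N = s.2 28%N.
  by rewrite frameR ?wf_pipc ?wrR_pipc28.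
set s6 := den (pipc M) s5 in a6 e6 N6 v6 *.
have j6 : s6.1 10%N = (2 ^ s.1 (gR 0))%N by rewrite N6.
have b6 : s6.1 14%N = s.1 14%N by rewrite N6 // N5.
clearbody s6.
have [f1 f2] := den_finalc orc e6 a6; rewrite j6 b6 v6 in f1 f2.
split; [exact: env_den'|exact: f1|exact: f2].
Qed.

End Inner.

Section Program.
Variable R : realType.

(** The coverage oracle equals its index form only pointwise; this replaces one by the other without
    functional extensionality. *)
Lemma exec_ext (P : seq instr) (o1 o2 : nat -> R) t cf :
  (forall m, o1 m = o2 m) -> exec P o1 t cf = exec P o2 t cf.
Proof.
move=> h; have hs c : step P o1 c = step P o2 c.
  by case: c => p N Rg; rewrite /step; case: ifP => // _; case: nth => // d a; rewrite h.
elim: t cf => [|t IH] cf /=; rewrite hs //.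
by case: (step P o2 cf) => // cf'; rewrite IH.
Qed.

Definition start (n k K : nat) : st R :=
  (upd (upd (nreg (init R n k)) 2 1) 3 K, fun=> 0%R).

Lemma program_exec s M K : exists a d, forall n k (orc : nat -> R),
  exists fin, exec (program s M K) orc (a * n ^ d + a) (init R n k) = Some fin /\
    nreg fin 0 = (den orc (mainc s M) (start n k K)).1 14.
Proof.
have [a [d H]] := polyD (poly_wc K (mainc s M)) (poly_const 4).
exists a, d => n k orc; set s1 := den orc (mainc s M) (start n k K).
set p := 2 + size (comp 2 (mainc s M)).
have e4 : s1.1 4 = 0 by rewrite /s1 den_const ?wf_mainc.
have pos : at_pos (program s M K) 2 (comp 2 (mainc s M)).
  by exists [:: NSet 2 1; NSet 3 K], [:: NAdd 0 14 4; Halt].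
have pend : at_pos (program s M K) p [:: NAdd 0 14 4; Halt].
  exists ([:: NSet 2 1; NSet 3 K] ++ comp 2 (mainc s M)), [::].
  by rewrite cats0 size_cat -catA.
have [t ht rt] := comp_correct orc (K := K) (s := start n k K)
   (wf_mainc s M) pos erefl erefl.
rewrite -/s1 -/p in rt; clearbody s1.
exists (Config p.+1 (upd s1.1 0 (s1.1 14 + s1.1 4)) s1.2).
split; last by rewrite /= upd_same e4 addn0.
have [p1 q1 pe2] := at_pos_cons pend; have [p2 q2 _] := at_pos_cons pe2.
have r1 : runs orc (program s M K) 2 (init R n k) =
   Some (Config 2 (start n k K).1 (start n k K).2) by [].
have r2 := runsD t r1; rewrite rt in r2.
have r4 : runs orc (program s M K) 1 (Config p s1.1 s1.2) =
   Some (Config p.+1 (upd s1.1 0 (s1.1 14 + s1.1 4)) s1.2).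
  by rewrite /= /step leqNgt p1 q1.
apply: (@exec_runs _ orc (program s M K) (2 + t + 1)).
- by rewrite (runsD _ r2) -r4.
- by rewrite /step leqNgt p2 q2.
- have e0 : (start n k K).1 0 = n by [].
  apply: leq_trans (H n); rewrite e0 in ht.
  by move: (wc n K (mainc s M)) ht => q ht; clear -ht; lia.
Qed.

End Program.

(** * The concave surrogate and the multilinear extension *)

Local Open Scope ring_scope.

Section Powers.
Variable R : realType.
Implicit Types a b : R.

(** The tangent at [b] of a convex power. Multiplying the bound for m by [a] overshoots the next one
    by (m + 1) b^m (a - b)^2, up to the shift of m. *)
Lemma expr_tangent a b m : 0 <= a -> 0 <= b ->
  b ^+ m + m%:R * b ^+ m.-1 * (a - b) <= a ^+ m.
Proof.
move=> a0 b0; elim: m => [|m IH]; first by rewrite !expr0 mul0r mul0r addr0.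
rewrite [X in _ <= X]exprS; apply: le_trans (ler_wpM2l a0 IH); rewrite -subr_ge0.
case: m {IH} => [|m] /=.
  by rewrite [X in 0 <= X](_ : _ = 0) // !expr0 expr1; ring.
have -> : a * (b ^+ m.+1 + m.+1%:R * b ^+ m * (a - b)) -
   (b ^+ m.+2 + m.+2%:R * b ^+ m.+1 * (a - b)) =
   m.+1%:R * b ^+ m * ((a - b) * (a - b)).
  rewrite !exprS -[m.+2%:R]natr1 -[m.+1%:R]natr1; ring.
apply: mulr_ge0; last by rewrite -expr2 sqr_ge0.
by rewrite mulr_ge0 ?ler0n ?exprn_ge0.
Qed.

Lemma expr_lip a b m : 0 <= a <= 1 -> 0 <= b <= 1 ->
  `|a ^+ m - b ^+ m| <= m%:R * `|a - b|.
Proof.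
have H (x y : R) : 0 <= x <= 1 -> 0 <= y <= 1 -> y ^+ m - x ^+ m <= m%:R * `|x - y|.
  move=> /andP[x0 x1] /andP[y0 y1]; have h := expr_tangent m x0 y0.
  apply: le_trans (_ : m%:R * y ^+ m.-1 * (y - x) <= _).
      have -> : m%:R * y ^+ m.-1 * (y - x) = - (m%:R * y ^+ m.-1 * (x - y)) by ring.
      by move: h; lra.
    rewrite -mulrA ler_wpM2l ?ler0n // distrC.
    have p0 : 0 <= y ^+ m.-1 by rewrite exprn_ge0.
    have p1 : y ^+ m.-1 <= 1 by rewrite exprn_ile1.
    apply: le_trans (_ : y ^+ m.-1 * `|y - x| <= _); first by rewrite ler_wpM2l ?ler_norm.
    by rewrite ler_piMl.
move=> ha hb; rewrite ler_norml; apply/andP; split.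
  by rewrite lerNl opprB; apply: H.
by rewrite distrC; apply: H.
Qed.

End Powers.

Section Analysis.
Variables (R : realType) (n : nat) (E : finType) (w : E -> R) (A : E -> seq nat).
Variable fr0 : pred nat.
Hypothesis w_ge0 : forall e, 0 <= w e.
Hypothesis A_uniq : forall e, uniq (A e).
Hypothesis A_sub : forall e x, x \in A e -> (x < n)%N && fr0 x.

(** For an element without listed members the quotient 0 / 0 is 0 and its zeroth power is 1, so the
    element contributes nothing to [Gf]. *)
Definition mean (e : E) (y : nat -> R) : R :=
  (\sum_(x <- A e) (1 - y x)) / (size (A e))%:R.

Definition Gf (y : nat -> R) : R := \sum_e w e * (1 - mean e y ^+ size (A e)).

Definition Ff (y : nat -> R) : R := \sum_e w e * (1 - \prod_(x <- A e) (1 - y x)).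

(** The partial derivatives of [Gf]: the factor [size (A e)] from the power cancels the denominator
    of the mean. *)
Definition grad (y : nat -> R) (x : nat) : R :=
  \sum_e w e * ((x \in A e)%:R * mean e y ^+ (size (A e)).-1).

Definition dom (y : nat -> R) : Prop :=
  forall x, (x < n)%N -> fr0 x -> 0 <= y x <= 1.

Lemma sum_A e (g : nat -> R) :
  \sum_(x <- A e) g x = \sum_(0 <= x < n | fr0 x) (x \in A e)%:R * g x.
Proof.
have p : perm_eq (A e) [seq x <- iota 0 n | x \in A e].
  apply: uniq_perm; rewrite ?filter_uniq ?iota_uniq // => x.
  rewrite mem_filter mem_iota add0n; case: (boolP (x \in A e)) => //= /A_sub.
  by case/andP.
rewrite (perm_big _ p) big_filter /index_iota subn0 big_mkcond [RHS]big_mkcond.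
apply: eq_bigr => x _; case: (boolP (x \in A e)) => [/A_sub /andP[_ ->]|_].
  by rewrite mul1r.
by rewrite mul0r if_same.
Qed.

Lemma mean_range e y : dom y -> 0 <= mean e y <= 1.
Proof.
move=> d; rewrite /mean; have hA x : x \in A e -> 0 <= 1 - y x <= 1.
  by move=> /A_sub /andP[h1 h2]; have /andP[] := d x h1 h2; lra.
have [->|s0] := posnP (size (A e)); first by rewrite invr0 mulr0 lexx ler01.
rewrite divr_ge0 ?ler0n //=; last first.
  by rewrite big_seq; apply: sumr_ge0 => x /hA /andP[].
rewrite ler_pdivrMr ?ltr0n // mul1r.
apply: le_trans (_ : \sum_(x <- A e) 1 <= _).
  by rewrite big_seq [X in _ <= X]big_seq; apply: ler_sum => x /hA /andP[].
by rewrite big_const_seq count_predT iter_addr_0.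
Qed.

Lemma size_mean e y : (size (A e))%:R * mean e y = \sum_(x <- A e) (1 - y x).
Proof.
have [s0|s0] := posnP (size (A e)); last by rewrite /mean mulrC divfK // pnatr_eq0; lia.
by rewrite s0 mul0r (size0nil s0) big_nil.
Qed.

(** [expr_tangent] for each element, after exchanging the sums over elements and coordinates. *)
Lemma G_concave y y' : dom y -> dom y' ->
  Gf y' <= Gf y + \sum_(0 <= x < n | fr0 x) grad y x * (y' x - y x).
Proof.
move=> d d'.
have -> : \sum_(0 <= x < n | fr0 x) grad y x * (y' x - y x) =
   \sum_e w e * (mean e y ^+ (size (A e)).-1 * \sum_(x <- A e) (y' x - y x)).
  under eq_bigr => x _ do rewrite /grad mulr_suml.
  rewrite exchange_big; apply: eq_bigr => e _ /=.
  rewrite sum_A !mulr_sumr; apply: eq_bigr => x _; ring.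
rewrite /Gf -big_split; apply: ler_sum => e _ /=; rewrite -mulrDr ler_wpM2l //.
have /andP[m0 _] := mean_range e d; have /andP[m0' _] := mean_range e d'.
have := expr_tangent (size (A e)) m0' m0.
have -> : \sum_(x <- A e) (y' x - y x) = (size (A e))%:R * (mean e y - mean e y').
  rewrite mulrBr !size_mean -sumrB; apply: eq_bigr => x _; ring.
move: (mean e y) (mean e y') (size (A e)) => a b s.
have -> : s%:R * a ^+ s.-1 * (b - a) = - (a ^+ s.-1 * (s%:R * (a - b))) by ring.
by move: (a ^+ s.-1 * _) => q; lra.
Qed.

Lemma sum_shift e (y : nat -> R) i j (t : R) : i != j ->
  \sum_(x <- A e) (1 - shift y i j t x) =
  \sum_(x <- A e) (1 - y x) - t * ((i \in A e)%:R - (j \in A e)%:R).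
Proof.
move=> hij.
have H z : (z \in A e)%:R = \sum_(x <- A e) (x == z)%:R :> R.
  rewrite -(count_uniq_mem z (A_uniq e)) -sum1_count natr_sum big_mkcond.
  by apply: eq_bigr => x _ /=; case: (x == z).
rewrite !H -sumrB mulr_sumr -sumrB; apply: eq_bigr => x _; rewrite /shift.
case: (eqVneq x i) => [->|hx]; first by rewrite (negPf hij) /=; ring.
by case: (eqVneq x j) => [->|hx'] /=; ring.
Qed.

(* Moving t from i to j gains the first-order term up to t^2 times the total
   weight, so an approximate local optimum is an approximate critical point. *)
Lemma G_step (y : nat -> R) i j (t : R) : i != j ->
  dom y -> dom (shift y i j (- t)) -> 0 <= t ->
  t * (grad y j - grad y i) - t ^+ 2 * (\sum_e w e) <=
  Gf (shift y i j (- t)) - Gf y.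
Proof.
move=> hij d d' t0.
rewrite /grad /Gf -!sumrB !mulr_sumr -sumrB; apply: ler_sum => e _.
have -> : t * (w e * ((j \in A e)%:R * mean e y ^+ (size (A e)).-1) -
   w e * ((i \in A e)%:R * mean e y ^+ (size (A e)).-1)) - t ^+ 2 * w e =
   w e * (t * ((j \in A e)%:R - (i \in A e)%:R) * mean e y ^+ (size (A e)).-1 - t ^+ 2).
  by ring.
rewrite -mulrBr ler_wpM2l //.
set dd := t * _; set y' := shift y i j (- t) in d' *.
have ed : (size (A e))%:R * (mean e y - mean e y') = dd.
  rewrite mulrBr !size_mean /y' sum_shift // /dd; ring.
have add : `|dd| <= t.
  rewrite /dd normrM ger0_norm // ler_piMr //.
  by case: (_ \in _); case: (_ \in _); rewrite ?subrr ?subr0 ?sub0r ?normrN ?normr0 ?normr1.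
have r := mean_range e d; have r' := mean_range e d'.
have /andP[m0 m1] := r; have /andP[m0' m1'] := r'.
have T := expr_tangent (size (A e)) m0 m0'.
have L := expr_lip (size (A e)).-1 r r'.
set u := mean e y in r m0 m1 T L ed *; set u' := mean e y' in r' m0' m1' T L ed *.
(* The change of the mean times [size (A e)] is [dd], so the Lipschitz bound for the exponent
   [(size (A e)).-1] yields t^2 without a factor for the size. *)
have L2 : `|dd * (u ^+ (size (A e)).-1 - u' ^+ (size (A e)).-1)| <= t ^+ 2.
  rewrite normrM expr2 ler_pM //; apply: le_trans L _; apply: le_trans add.
  rewrite -ed normrM ger0_norm ?ler0n // ler_wpM2r ?normr_ge0 // ler_nat; lia.
have h1 := ler_norm (dd * (u ^+ (size (A e)).-1 - u' ^+ (size (A e)).-1)).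
have e2 : (size (A e))%:R * u' ^+ (size (A e)).-1 * (u - u') =
   dd * u' ^+ (size (A e)).-1 by rewrite -ed; ring.
rewrite e2 in T; have := le_trans h1 L2; rewrite mulrBr; clear -T; lra.
Qed.

(** Approximate optimality conditions. The multiplier [mu] is the largest gradient among coordinates
    that can still grow; gradients at positive coordinates are at least [mu - kp]. As [mu] is
    nonnegative and the total does not grow, each coordinate adds at most [kp] to the first-order
    change, and concavity does the rest. *)
Lemma G_local_opt (y y' : nat -> R) (t th : R) : 0 < t -> 0 <= th -> dom y -> dom y' ->
  (forall i j, (i < n)%N -> (j < n)%N -> fr0 i -> fr0 j -> i != j ->
     0 < y i -> y j < 1 ->
     dom (shift y i j (- t)) /\ Gf (shift y i j (- t)) <= Gf y + th) ->
  \sum_(0 <= x < n | fr0 x) y' x <= \sum_(0 <= x < n | fr0 x) y x ->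
  Gf y' <= Gf y + (th / t + t * \sum_e w e) * n%:R.
Proof.
move=> t0 th0 d d' H hs.
set W := \sum_e w e; set kp := th / t + t * W.
have W0 : 0 <= W by apply: sumr_ge0.
have kp0 : 0 <= kp by rewrite addr_ge0 ?divr_ge0 ?mulr_ge0 // ltW.
have g0 x : 0 <= grad y x.
  apply: sumr_ge0 => e _; rewrite mulr_ge0 // mulr_ge0 ?ler0n // exprn_ge0 //.
  by have /andP[] := mean_range e d.
have gle i j : (i < n)%N -> (j < n)%N -> fr0 i -> fr0 j -> 0 < y i -> y j < 1 ->
    grad y j <= grad y i + kp.
  move=> hi hj fi fj yi yj; case: (eqVneq i j) => [->|hij]; first by rewrite lerDl.
  have [d2 h2] := H i j hi hj fi fj hij yi yj.
  have := G_step hij d d2 (ltW t0); rewrite -/W => h3.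
  have h4 : t * (grad y j - grad y i) <= th + t ^+ 2 * W by lra.
  have h5 : t * (grad y j - grad y i) <= t * kp.
    by apply: le_trans h4 _; rewrite /kp mulrDr mulrCA divff ?gt_eqF // mulr1 expr2 mulrA.
  by rewrite ler_pM2l // in h5; lra.
pose mu := \big[Num.max/0]_(0 <= x < n | fr0 x && (y x < 1)) grad y x.
have mu0 : 0 <= mu.
  by rewrite /mu; elim/big_ind: _ => // a b ha hb; rewrite le_max ha.
have mu1 x : (x < n)%N -> fr0 x -> y x < 1 -> grad y x <= mu.
  move=> hx fx yx; rewrite /mu; apply: (Order.TotalTheory.le_bigmax_seq 0 x) => //.
    by rewrite mem_index_iota.
  by rewrite fx yx.
have mu2 x : (x < n)%N -> fr0 x -> 0 < y x -> mu - kp <= grad y x.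
  move=> hx fx yx; rewrite lerBlDr /mu big_seq_cond.
  elim/big_ind: _ => [|a b ha hb|z /andP[]].
  - by rewrite addr_ge0.
  - by rewrite ge_max ha hb.
  - by rewrite mem_index_iota => /= hz /andP[fz yz]; apply: gle.
apply: le_trans (G_concave d d') _; rewrite lerD2l.
have -> : \sum_(0 <= x < n | fr0 x) grad y x * (y' x - y x) =
   \sum_(0 <= x < n | fr0 x) (grad y x - mu) * (y' x - y x) +
   mu * (\sum_(0 <= x < n | fr0 x) y' x - \sum_(0 <= x < n | fr0 x) y x).
  rewrite -sumrB mulr_sumr -big_split; apply: eq_bigr => x _ /=; ring.
apply: le_trans (_ : \sum_(0 <= x < n | fr0 x) kp <= _); last first.
  by rewrite big_mkcond mulr_natr -[X in _ *+ X]subn0 -sumr_const_nat; apply: ler_sum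
    => x _; case: ifP.
rewrite -[X in _ <= X]addr0; apply: lerD; last by rewrite mulr_ge0_le0 // subr_le0.
rewrite big_seq_cond [X in _ <= X]big_seq_cond; apply: ler_sum => x.
rewrite mem_index_iota => /andP[/= hx fx].
have /andP[a0 a1] := d x hx fx; have /andP[b0 b1] := d' x hx fx.
have [h|h] := lerP (y' x) (y x).
  have [e0|p0] := leP (y x) 0; first by rewrite [X in _ * X](_ : _ = 0) ?mulr0 //; lra.
  have := mu2 x hx fx p0; nra.
have := mu1 x hx fx (lt_le_trans h b1); nra.
Qed.

(** Only the factors at [i] and [j] vary, in opposite directions: the product is a concave quadratic
    in t, with a square term just when both indices belong to the element. *)
Lemma prod_shift e (y : nat -> R) i j : i != j -> dom y ->
  exists a c : R, 0 <= c /\ forall t : R,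
    \prod_(x <- A e) (1 - shift y i j t x) =
    \prod_(x <- A e) (1 - y x) + a * t - c * t ^+ 2.
Proof.
move=> hij d.
have si t : shift y i j t i = y i + t by rewrite /shift eqxx.
have sj t : shift y i j t j = y j - t by rewrite /shift eq_sym (negPf hij) eqxx.
have so t x : x != i -> x != j -> shift y i j t x = y x.
  by rewrite /shift => /negPf-> /negPf->.
have Q t (s : seq nat) : i \notin s -> j \notin s ->
    \prod_(x <- s) (1 - shift y i j t x) = \prod_(x <- s) (1 - y x).
  move=> hi hj; apply: eq_big_seq => x hx.
  by rewrite so //; apply: contraNneq hi => <- || apply: contraNneq hj => <-.
have Ui : i \notin rem i (A e) by rewrite mem_rem_uniqF.
have Uj : j \notin rem j (A e) by rewrite mem_rem_uniqF.
have [hi|hi] := boolP (i \in A e); have [hj|hj] := boolP (j \in A e).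
- have hj' : j \in rem i (A e) by rewrite mem_rem_uniq // inE eq_sym hij hj.
  have Uij : i \notin rem j (rem i (A e)).
    by rewrite mem_rem_uniq ?rem_uniq // inE (negPf Ui) andbF.
  have Ujj : j \notin rem j (rem i (A e)) by rewrite mem_rem_uniqF ?rem_uniq.
  set q := \prod_(x <- rem j (rem i (A e))) (1 - y x).
  exists (((1 - y i) - (1 - y j)) * q), q; split.
    rewrite /q big_seq; apply: prodr_ge0 => x /mem_rem/mem_rem/A_sub /andP[h1 h2].
    by have /andP[] := d x h1 h2; lra.
  move=> t; rewrite (big_rem i hi) (big_rem j hj') /= Q // si sj -/q.
  rewrite [\prod_(x <- A e) _](big_rem i hi) (big_rem j hj') /= -/q; ring.
- have hj' : j \notin rem i (A e) by apply: contra hj => /mem_rem.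
  exists (- \prod_(x <- rem i (A e)) (1 - y x)), 0; split=> // t.
  rewrite (big_rem i hi) /= Q // si [\prod_(x <- A e) _](big_rem i hi) /=; ring.
- have hi' : i \notin rem j (A e) by apply: contra hi => /mem_rem.
  exists (\prod_(x <- rem j (A e)) (1 - y x)), 0; split=> // t.
  rewrite (big_rem j hj) /= Q // sj [\prod_(x <- A e) _](big_rem j hj) /=; ring.
- by exists 0, 0; split=> // t; rewrite Q //; ring.
Qed.

(** Convexity along e_i - e_j: the point 0 is the average of t1 and -t2 with weights proportional to
    t2 and t1. *)
Lemma F_pair (y : nat -> R) i j (t1 t2 : R) : i != j -> dom y -> 0 <= t1 -> 0 <= t2 ->
  (t1 + t2) * Ff y <= t2 * Ff (shift y i j t1) + t1 * Ff (shift y i j (- t2)).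
Proof.
move=> hij d h1 h2; rewrite /Ff !mulr_sumr -big_split /=; apply: ler_sum => e _.
have [a [c [c0 H]]] := prod_shift e hij d; rewrite !H.
move: (\prod_(x <- A e) _) => p.
rewrite -subr_ge0 [X in 0 <= X](_ : _ = w e * (c * (t1 * t2 * (t1 + t2)))); last by ring.
by rewrite !mulr_ge0 // addr_ge0.
Qed.

Lemma G_le_F y : dom y -> Gf y <= Ff y.
Proof.
move=> d; apply: ler_sum => e _; rewrite ler_wpM2l // lerD2l lerN2 /mean.
set s := A e; have hA x : x \in s -> 0 <= 1 - y x.
  by move=> /A_sub /andP[h1 h2]; have /andP[] := d x h1 h2; lra.
rewrite (big_nth 0%N) big_mkord [X in _ <= (X / _) ^+ _](big_nth 0%N) big_mkord.
have := @leif_AGM R _ [set: 'I_(size s)] (fun i => 1 - y (nth 0%N s i)).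
rewrite cardsT card_ord => /(_ (fun i _ => hA _ (mem_nth _ (ltn_ord i)))) [hle _].
apply: le_trans (le_trans _ hle) _; rewrite le_eqVlt; apply/orP; left; apply/eqP.
  by apply: eq_bigl => i; rewrite inE.
by congr ((_ / _) ^+ _); apply: eq_bigl => i; rewrite inE.
Qed.

End Analysis.

(** * What the evaluator computes on the truncated residual instance *)

Section Dynamics.
Variables (R : realType) (n M j0 : nat) (E : finType) (w : E -> R).
Variables (h : E -> nat -> bool) (fr0 : pred nat).
Hypothesis w_ge0 : forall e, 0 <= w e.
Hypothesis j0_lt : (j0 < n)%N.
Hypothesis j0_fixed : ~~ fr0 j0.

Definition orcE (m : nat) : R :=
  \sum_e w e * (has (fun i => bit m i && h e i) (iota 0 n))%:R.

Definition Ae (e : E) : seq nat := take M [seq i <- iota 0 n | fr0 i && h e i].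

(* What remains to be covered once j0 is forced in. *)
Definition wj (e : E) : R := if h e j0 then 0 else w e.

Definition frok (y : nat -> R) : Prop := forall i, (i < n)%N -> fr y i = fr0 i.

Notation G := (Gf wj Ae).
Notation F := (Ff wj Ae).
Notation Phi' := (Phi orcE n (2 ^ j0)%N M).

Lemma wj_ge0 e : 0 <= wj e.
Proof. by rewrite /wj; case: ifP. Qed.

Lemma Ae_uniq e : uniq (Ae e).
Proof. by rewrite take_uniq // filter_uniq // iota_uniq. Qed.

Lemma Ae_sub e x : x \in Ae e -> (x < n)%N && fr0 x.
Proof.
by move/mem_take; rewrite mem_filter mem_iota add0n => /andP[/andP[-> _]]; rewrite andbT.
Qed.

(** The queries see [y] only through its marks, so linearity and [ev_elem] apply as soon as these
    marks agree with [fr0]. *)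
Lemma PhiE b y : frok y -> Phi' b y = if b then F y else G y.
Proof.
move=> ok; have hfj : ~~ fr y j0 by rewrite ok.
rewrite /Phi (@ev_sum R n b y E w
  (fun e m => (has (fun i => bit m i && h e i) (iota 0 n))%:R)) //.
have H e : ev n b y (fun m => (has (fun i => bit m i && h e i) (iota 0 n))%:R : R)
    (2 ^ j0)%N M 0 0 0 (z0 R b) 1 1 =
    if h e j0 then 0 else
      1 - vv b (size (Ae e)) (foldl (fun z i => stepz b z (y i)) (z0 R b) (Ae e)).
  have v1 : vv b 0 (z0 R b) = 1 by rewrite /vv /z0; case: (b) => //; rewrite expr0.
  have m0 : mask (fun _ => false) n = 0%N by rewrite /mask big_pred0.
  have := @ev_elem R n b y (h e) j0 M 0 0 (fun _ => false) (z0 R b) 1 j0_lt hfj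
    (leq0n _) _; rewrite /= v1 m0 subn0 orbF mul1r => -> //.
  rewrite /Ae (@eq_in_filter _ (fun i => fr y i && h e i) (fun i => fr0 i && h e i)) //.
  by move=> i; rewrite mem_iota add0n => /= /ok ->.
have foldT s z : foldl (fun z i => stepz true z (y i)) z s = z * \prod_(x <- s) (1 - y x).
  elim: s z => [|x s IH] z /=; first by rewrite big_nil mulr1.
  by rewrite IH big_cons /stepz mulrA.
have foldF s z : foldl (fun z i => stepz false z (y i)) z s = z + \sum_(x <- s) (1 - y x).
  elim: s z => [|x s IH] z /=; first by rewrite big_nil addr0.
  by rewrite IH big_cons /stepz (addrA z (1 - y x)).
case: b H => H; apply: eq_bigr => e _; rewrite H /wj; case: ifP => _.
- by rewrite mulr0 mul0r.
- by rewrite foldT /vv /z0 mul1r.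
- by rewrite mulr0 mul0r.
- by rewrite foldF /vv /z0 add0r.
Qed.

End Dynamics.

(** * Local search and rounding *)

Section Runs.
Variables (R : realType) (n M j0 : nat) (E : finType) (w : E -> R).
Variables (h : E -> nat -> bool) (fr0 : pred nat).
Hypothesis w_ge0 : forall e, 0 <= w e.
Hypothesis j0_lt : (j0 < n)%N.
Hypothesis j0_fixed : ~~ fr0 j0.
Variables (T : nat) (delta thr W : R).
Hypothesis T_delta : T%:R * delta = 1.
Hypothesis delta_gt0 : 0 < delta.
Hypothesis thrE : thr = W * delta * delta.
Hypothesis W_ge : \sum_e wj j0 w h e <= W.

Notation G := (Gf (wj j0 w h) (Ae n M h fr0)).
Notation F := (Ff (wj j0 w h) (Ae n M h fr0)).
Notation orc := (orcE n w h).
Notation frok := (frok n fr0).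
Notation dom := (dom n fr0).
Notation lsstep := (lsstep orc n (2 ^ j0)%N M delta thr).
Notation sweep := (sweep orc n (2 ^ j0)%N M delta thr).
Notation pipstep := (pipstep orc n (2 ^ j0)%N M).

Let wj0 e : 0 <= wj j0 w h e. Proof. exact: wj_ge0. Qed.
Let Au e : uniq (Ae n M h fr0 e). Proof. exact: Ae_uniq. Qed.
Let As e x : x \in Ae n M h fr0 e -> (x < n)%N && fr0 x. Proof. exact: Ae_sub. Qed.

Let PE b y : frok y -> Phi orc n (2 ^ j0)%N M b y = if b then F y else G y.
Proof. exact: PhiE. Qed.

Lemma foldl_pairs (Y : Type) (g : nat -> nat -> Y -> Y) (s t : seq nat) y :
  foldl (fun y i => foldl (fun y j => g i j y) y t) y s =
  foldl (fun y p => g p.1 p.2 y) y [seq (i, j) | i <- s, j <- t].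
Proof.
elim: s y => //= i s IH y; rewrite foldl_cat IH; congr foldl.
by elim: t y {IH} => //= j t IH y; rewrite IH.
Qed.

Definition total (y : nat -> R) : R := \sum_(0 <= x < n | fr0 x) y x.

Lemma total_shift (y : nat -> R) i j t : (i < n)%N -> (j < n)%N -> fr0 i -> fr0 j ->
  i != j -> total (shift y i j t) = total y.
Proof.
move=> hi hj fi fj hij.
have S z : (z < n)%N -> fr0 z -> \sum_(0 <= x < n | fr0 x) (x == z)%:R = 1 :> R.
  move=> hz fz; rewrite (big_rem z) ?mem_index_iota //= fz eqxx big1_seq ?addr0 //.
  move=> x /andP[_]; rewrite mem_rem_uniq ?iota_uniq // inE => /andP[/negPf-> _] //.
rewrite /total -[RHS](addr0) -[X in _ = _ + X](_ : \sum_(0 <= x < n | fr0 x)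
   (t * (x == i)%:R - t * (x == j)%:R) = 0); last first.
  by rewrite sumrB -!mulr_sumr !S // subrr.
rewrite -big_split; apply: eq_bigr => x _ /=; rewrite /shift.
case: (eqVneq x i) => [->|hx]; first by rewrite (negPf hij) /=; ring.
by case: (eqVneq x j) => [->|hx'] /=; ring.
Qed.

(** On multiples of delta = 1/T a positive coordinate is at least delta and one below 1 is at most 1
    - delta, so the sign tests of the local search already keep each move inside the cube. *)
Definition grid (y : nat -> R) : Prop := forall i, (i < n)%N -> fr0 i ->
  exists2 a : nat, (a <= T)%N & y i = a%:R * delta.

Lemma grid_dom y : grid y -> dom y.
Proof.
move=> g i hi fi; have [a ha ->] := g i hi fi.
have d0 := ltW delta_gt0; rewrite mulr_ge0 ?ler0n //=.
by rewrite -[X in _ <= X]T_delta ler_wpM2r ?ler_nat.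
Qed.

Definition ls_inv (Q : R) (y : nat -> R) : Prop := [/\ frok y, grid y & total y = Q].

Lemma ls_inv_shift Q (y : nat -> R) i j : ls_inv Q y ->
  (i < n)%N -> (j < n)%N -> fr0 i -> fr0 j -> i != j -> 0 < y i -> y j < 1 -> ls_inv Q (shift y i j (- delta)).
Proof.
move=> [ok g s] hi hj fi fj hij yi yj.
have g' : grid (shift y i j (- delta)).
  move=> x hx fx; have [a ha ea] := g x hx fx; rewrite /shift.
  case: (eqVneq x i) => [ex|_].
    rewrite -ex ea; case: a ha ea => [|a] ha ea.
      by move: yi; rewrite -ex ea mul0r ltxx.
    by exists a; [lia|rewrite -natr1; ring].
  case: (eqVneq x j) => [ex|_]; last by exists a.
  rewrite -ex ea; exists a.+1; last by rewrite -natr1; ring.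
  by move: yj; rewrite -ex ea -[X in _ < X]T_delta ltr_pM2r // ltr_nat.
split=> //; last by rewrite total_shift.
move=> x hx; case: (boolP (fr0 x)) => fx.
  by rewrite /fr -leNgt; have /andP[] := grid_dom g' hx fx.
rewrite /fr /shift; case: (eqVneq x i) => [ex|_]; first by rewrite -ex (negPf fx) in fi.
case: (eqVneq x j) => [ex|_]; first by rewrite -ex (negPf fx) in fj.
by rewrite -/(fr y x) ok // (negPf fx).
Qed.

Lemma ls_inv_step Q (y : nat -> R) i j : ls_inv Q y -> (i < n)%N -> (j < n)%N ->
  ls_inv Q (lsstep i j y) /\
  (lsstep i j y = y \/ G y + thr < G (lsstep i j y)).
Proof.
move=> I hi hj; rewrite /lsstep; have [ok g s] := I.
case: ifP => [/and5P[hij nfi yi yj]|_]; last by split=> //; left.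
have fi : fr0 i by rewrite -ok.
have fj : fr0 j by rewrite -ok // /fr -leNgt ltW.
have I' := ls_inv_shift I hi hj fi fj hij yi yj.
have [ok' _ _] := I'.
by rewrite !PE // => hG; split=> //; right.
Qed.

Lemma thr_ge0 : 0 <= thr.
Proof.
have W0 : 0 <= W by apply: le_trans W_ge; apply: sumr_ge0 => e _; apply: wj0.
by rewrite thrE !mulr_ge0 // ltW.
Qed.

Definition local_opt (y : nat -> R) : Prop :=
  forall i j, (i < n)%N -> (j < n)%N -> lsstep i j y = y.

(** If no move is accepted, the point stays the same throughout and every pair has been tested at
    this very point. *)
Lemma ls_sweep Q (y : nat -> R) : ls_inv Q y -> ls_inv Q (sweep y) /\
  ((sweep y = y /\ local_opt y) \/ G y + thr < G (sweep y)).
Proof.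
move=> I; rewrite /sweep /dbl foldl_pairs.
have P p : p \in [seq (i, j) | i <- iota 0 n, j <- iota 0 n] = (p.1 < n)%N && (p.2 < n)%N.
  case: p => i j; apply/allpairsP/andP => [[[a b] /= [ha hb [-> ->]]]|[hi hj]].
    by move: ha hb; rewrite !mem_iota !add0n.
  by exists (i, j); rewrite !mem_iota !add0n.
pose l := [seq (i, j) | i <- iota 0 n, j <- iota 0 n]; rewrite -/l.
have hl : {subset l <= l} by [].
suff [I' H] : ls_inv Q (foldl (fun y p => lsstep p.1 p.2 y) y l) /\
  ((foldl (fun y p => lsstep p.1 p.2 y) y l = y /\
     forall p, p \in l -> lsstep p.1 p.2 y = y) \/
   G y + thr < G (foldl (fun y p => lsstep p.1 p.2 y) y l)).
  split=> //; case: H => [[H1 H2]|H]; [left|by right]; split=> // i j hi hj.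
  by apply: (H2 (i, j)); rewrite P hi hj.
have : forall p, p \in l -> (p.1 < n)%N && (p.2 < n)%N by move=> p; rewrite P.
elim: (l) y I => [|p l' IH] y I hp /=; first by split=> //; left.
have /andP[p1 p2] : (p.1 < n)%N && (p.2 < n)%N by apply: hp; rewrite inE eqxx.
have hp' q : q \in l' -> (q.1 < n)%N && (q.2 < n)%N.
  by move=> hq; apply: hp; rewrite inE hq orbT.
have [I1 H1] := ls_inv_step I p1 p2.
have [I2 H2] := IH _ I1 hp'; split=> //.
have t0 := thr_ge0.
case: H1 => [e1|H1].
  rewrite e1 in H2 *; case: H2 => [[H2 H3]|H2]; last by right.
  by left; split=> // q; rewrite inE => /orP[/eqP->|/H3].
by right; case: H2 => [[-> _]|H2] //; lra.
Qed.

(** A local optimum is a fixed point of the sweep; until one is met the gains add up. The case q = 0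
    stands apart because the strict inequality may fail there. *)
Lemma ls_iter Q q (y : nat -> R) : ls_inv Q y -> ls_inv Q (iter q sweep y) /\
  (local_opt (iter q sweep y) \/ q = 0%N \/ q%:R * thr < G (iter q sweep y)).
Proof.
move=> I; elim: q => [|q [I1 H1]] /=; first by split=> //; right; left.
have [I2 H2] := ls_sweep I1; split=> //.
case: H2 => [[e lo]|H2]; first by left; rewrite e.
case: H1 => [lo|H1].
  have e : sweep (iter q sweep y) = iter q sweep y.
    rewrite {1}/sweep /dbl foldl_pairs.
    have P p : p \in [seq (i, j) | i <- iota 0 n, j <- iota 0 n] -> (p.1 < n)%N && (p.2 < n)%N.
      case: p => i j /allpairsP[[a b] /= [ha hb [-> ->]]].
      by move: ha hb; rewrite !mem_iota !add0n /= => -> ->.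
    move: [seq (i, j) | i <- iota 0 n, j <- iota 0 n] P; elim=> //= p l IH hp.
    have /andP[p1 p2] := hp p (mem_head _ _).
    by rewrite (lo _ _ p1 p2) IH // => r hr; apply: hp; rewrite inE hr orbT.
  by left; rewrite e.
right; right; rewrite -natr1 mulrDl mul1r; apply: le_lt_trans H2; rewrite lerD2r.
case: H1 => [q0|/ltW //]; rewrite [X in X%:R * _]q0 mul0r.
have [_ g _] := I1; apply: sumr_ge0 => e _; rewrite mulr_ge0 //.
have /andP[m0 m1] := mean_range As e (grid_dom g).
by rewrite subr_ge0 exprn_ile1.
Qed.

Lemma G_le_W y : dom y -> G y <= W.
Proof.
move=> d; apply: le_trans W_ge; apply: ler_sum => e _; rewrite -[X in _ <= X]mulr1.
rewrite ler_wpM2l // gerBl exprn_ge0 //.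
by have /andP[] := mean_range As e d.
Qed.

(** Without a local optimum the accumulated gain q W delta^2 >= W would exceed the bound W on G. The
    error is (thr / delta + delta W) n with thr = W delta^2. *)
Lemma ls_result Q q (y y' : nat -> R) : ls_inv Q y -> (0 < q)%N ->
  1 <= q%:R * delta * delta ->
  dom y' -> total y' <= Q ->
  ls_inv Q (iter q sweep y) /\
  G y' <= G (iter q sweep y) + 2%:R * delta * W * n%:R.
Proof.
move=> I q0 hq d' ht; have [I' H] := ls_iter q I; split=> //.
set z := iter q sweep y in I' H *; have [ok g s] := I'; have d := grid_dom g.
have lo : local_opt z.
  case: H => [//|[e|H]]; first by rewrite e in q0.
  have := lt_le_trans H (G_le_W d).
  have W0 : 0 <= W by apply: le_trans W_ge; apply: sumr_ge0 => e _; apply: wj0.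
  rewrite thrE => h1; have : W <= q%:R * (W * delta * delta).
    rewrite (_ : q%:R * _ = W * (q%:R * delta * delta)); last by ring.
    by rewrite -[X in X <= _]mulr1 ler_wpM2l.
  by rewrite leNgt h1.
have hs : total y' <= total z by rewrite s.
have := G_local_opt wj0 Au As delta_gt0 thr_ge0 d d' _ hs.
have W0 : \sum_e wj j0 w h e <= W := W_ge.
move=> L; apply: le_trans (L _) _.
  move=> i j hi hj fi fj hij yi yj.
  have I2 := ls_inv_shift I' hi hj fi fj hij yi yj.
  have [ok2 g2 _] := I2; split; first exact: grid_dom.
  rewrite leNgt; apply/negP => hG; have := lo i j hi hj; rewrite /lsstep.
  rewrite !PE // hG yi yj hij andbT /= -/(fr z i) ok // fi /=.
  move/(congr1 (fun f => f i)); rewrite /shift eqxx => /eqP.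
  by rewrite -subr_eq0 addrAC subrr add0r oppr_eq0 gt_eqF.
rewrite lerD2l ler_wpM2r ?ler0n //.
have -> : thr / delta = W * delta by rewrite thrE mulfK // gt_eqF.
have := ler_wpM2l (ltW delta_gt0) W0; rewrite -mulrA => h1.
rewrite mulr_natl mulr2n; apply: lerD => //; by rewrite mulrC.
Qed.

Definition pip_inv (Q : R) (y : nat -> R) : Prop := [/\ frok y, dom y & total y = Q].

Definition frac (x : R) : bool := (0 < x) && (x < 1).

Lemma pip_inv_shift Q (y : nat -> R) i j t : pip_inv Q y -> (i < n)%N -> (j < n)%N ->
  fr0 i -> fr0 j -> i != j -> 0 <= y i + t <= 1 -> 0 <= y j - t <= 1 ->
  pip_inv Q (shift y i j t).
Proof.
move=> [ok d s] hi hj fi fj hij yi yj.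
have d' : dom (shift y i j t).
  move=> x hx fx; rewrite /shift; case: eqP => // _; case: eqP => // _; exact: d.
split=> //; last by rewrite total_shift.
move=> x hx; case: (boolP (fr0 x)) => fx.
  by rewrite /fr -leNgt; have /andP[] := d' x hx fx.
rewrite /fr /shift; case: (eqVneq x i) => [ex|_]; first by rewrite -ex (negPf fx) in fi.
case: (eqVneq x j) => [ex|_]; first by rewrite -ex (negPf fx) in fj.
by rewrite -/(fr y x) ok // (negPf fx).
Qed.

(** Each extreme move stops when y_i or y_j reaches 0 or 1, and by [F_pair] the better of the two
    does not decrease F. *)
Lemma pip_step Q (y : nat -> R) i j : pip_inv Q y -> (i < n)%N -> (j < n)%N ->
  [/\ pip_inv Q (pipstep i j y), F y <= F (pipstep i j y),
      forall x, frac (pipstep i j y x) -> frac (y x) &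
      i != j -> ~~ (frac (pipstep i j y i) && frac (pipstep i j y j))].
Proof.
move=> I hi hj; rewrite /pipstep.
case: ifP => [/and5P[hij yi0 yi1 yj0 yj1]|hn]; last first.
  split=> // hij; apply/negP => /andP[/andP[a b] /andP[c d]].
  by rewrite hij a b c d in hn.
set e1 := Num.min (y j) (1 - y i); set e2 := Num.min (y i) (1 - y j).
have fi : fr0 i by have [ok _ _] := I; rewrite -ok // /fr -leNgt ltW.
have fj : fr0 j by have [ok _ _] := I; rewrite -ok // /fr -leNgt ltW.
have e10 : 0 < e1 by rewrite /e1 lt_min yj0 subr_gt0.
have e20 : 0 < e2 by rewrite /e2 lt_min yi0 subr_gt0.
have e1a : e1 <= y j by rewrite /e1 ge_min lexx.
have e1b : e1 <= 1 - y i by rewrite /e1 ge_min lexx orbT.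
have e2a : e2 <= y i by rewrite /e2 ge_min lexx.
have e2b : e2 <= 1 - y j by rewrite /e2 ge_min lexx orbT.
have I1 : pip_inv Q (shift y i j e1) by apply: pip_inv_shift => //; lra.
have I2 : pip_inv Q (shift y i j (- e2)) by apply: pip_inv_shift => //; lra.
have sx (t : R) x : frac (shift y i j t x) -> frac (y x).
  rewrite /shift; case: (eqVneq x i) => [->|_]; first by rewrite /frac yi0 yi1.
  by case: (eqVneq x j) => [->|//]; rewrite /frac yj0 yj1.
have hc := F_pair wj0 Au As hij (let: And3 _ d _ := I in d) (ltW e10) (ltW e20).
have si (t : R) : shift y i j t i = y i + t by rewrite /shift eqxx.
have sj (t : R) : shift y i j t j = y j - t.
  by rewrite /shift eq_sym (negPf hij) eqxx.
have E1 : ~~ (frac (shift y i j e1 i) && frac (shift y i j e1 j)).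
  rewrite si sj /frac /e1 minEle; case: ifP => _.
    by rewrite subrr ltxx andbF.
  by rewrite addrC subrK ltxx andbF.
have E2 : ~~ (frac (shift y i j (- e2) i) && frac (shift y i j (- e2) j)).
  rewrite si sj opprK /frac /e2 minEle; case: ifP => _.
    by rewrite subrr ltxx.
  by rewrite [y j + _]addrC subrK ltxx !andbF.
have [ok1 _ _] := I1; have [ok2 _ _] := I2; rewrite !PE //.
case: ltP => hF; split=> //; try exact: sx; nra.
Qed.

Definition integral (y : nat -> R) : Prop :=
  forall x, (x < n)%N -> fr0 x -> y x = 0 \/ y x = 1.

(** One pass suffices: integral coordinates stay integral and every pair loses a fractional member,
    so at most one fractional coordinate survives. It would be a difference of two integers strictly
    between 0 and 1. *)
Lemma pip_result (q : nat) y : pip_inv q%:R y ->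
  [/\ pip_inv q%:R (dbl n pipstep y), F y <= F (dbl n pipstep y) &
      integral (dbl n pipstep y)].
Proof.
move=> I; rewrite /dbl foldl_pairs.
have P p : p \in [seq (i, j) | i <- iota 0 n, j <- iota 0 n] = (p.1 < n)%N && (p.2 < n)%N.
  case: p => i j; apply/allpairsP/andP => [[[a b] /= [ha hb [-> ->]]]|[hi hj]].
    by move: ha hb; rewrite !mem_iota !add0n.
  by exists (i, j); rewrite !mem_iota !add0n.
pose l := [seq (i, j) | i <- iota 0 n, j <- iota 0 n]; rewrite -/l.
have [I' HF _ HP] : let y' := foldl (fun y p => pipstep p.1 p.2 y) y l in
   [/\ pip_inv q%:R y', F y <= F y', forall x, frac (y' x) -> frac (y x) &
      forall p, p \in l -> p.1 != p.2 -> ~~ (frac (y' p.1) && frac (y' p.2))].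
  have : forall p, p \in l -> (p.1 < n)%N && (p.2 < n)%N by move=> p; rewrite P.
  elim: (l) y I => [|p l' IH] y I hp /=; first by [].
  have /andP[p1 p2] : (p.1 < n)%N && (p.2 < n)%N by apply: hp; rewrite inE eqxx.
  have hp' r : r \in l' -> (r.1 < n)%N && (r.2 < n)%N.
    by move=> hr; apply: hp; rewrite inE hr orbT.
  have [I1 H1 X1 Y1] := pip_step I p1 p2.
  have [I2 H2 X2 Y2] := IH _ I1 hp'; split=> //.
  - exact: le_trans H2.
  - by move=> x /X2 /X1.
  - move=> r; rewrite inE => /orP[/eqP->|/Y2 //] hr.
    by apply: contra (Y1 hr) => /andP[/X2 -> /X2 ->].
set z := foldl _ y l in I' HF HP *; split=> // x hx fx.
have [ok d s] := I'; have /andP[z0 z1] := d x hx fx.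
have int v : (v < n)%N -> fr0 v -> ~~ frac (z v) -> z v = 0 \/ z v = 1.
  move=> hv fv; rewrite /frac negb_and -!leNgt; have /andP[v0 v1] := d v hv fv.
  by case/orP => hh; [left|right]; apply/eqP; rewrite eq_le hh ?v0 ?v1.
apply: (int _) => //; apply/negP => hfx.
have others v : (v < n)%N -> fr0 v -> v != x -> z v = 0 \/ z v = 1.
  move=> hv fv hvx; apply: (int _) => //.
  have := HP (v, x); rewrite P hv hx => /(_ isT hvx) /=.
  by rewrite hfx andbT.
have [m em] : exists m : nat, \sum_(v <- rem x (index_iota 0 n) | fr0 v) z v = m%:R.
  have : {subset rem x (index_iota 0 n) <= [pred v | (v < n)%N && (v != x)]}.
    move=> v; rewrite mem_rem_uniq ?iota_uniq // !inE mem_index_iota.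
    by case/andP=> -> /andP[_ ->].
  elim: (rem x _) => [|v r IH] hr; first by exists 0%N; rewrite big_nil.
  have [u hu|m em] := IH; first by apply: hr; rewrite inE hu orbT.
  have /andP[hv hvx] := hr v (mem_head _ _).
  rewrite big_cons; case: ifP => fv; last by exists m.
  by case: (others v hv fv hvx) => ->; [exists m|exists m.+1];
    rewrite em ?add0r // -natr1 addrC.
have : z x = q%:R - m%:R.
  rewrite -s /total (big_rem x) ?mem_index_iota ?hx //= fx em addrK //.
move: hfx; rewrite /frac => /andP[a b] e.
have h1 : (m < q)%N by rewrite -(ltr_nat R) -subr_gt0 -e.
have h2 : (q < m.+1)%N by rewrite -(ltr_nat R) -natr1 addrC -ltrBlDr -e.
lia.
Qed.

End Runs.

(** * The ratio *)

Section Sigma.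
Variable R : realType.
Implicit Types c al r : R.

Lemma weighted_AGM (p q : R) (a b : nat) : 0 <= p -> 0 <= q ->
  p ^+ a * q ^+ b <= ((a%:R * p + b%:R * q) / (a + b)%:R) ^+ (a + b).
Proof.
move=> p0 q0; pose f (i : 'I_(a + b)) := if (i < a)%N then p else q.
have f0 i : 0 <= f i by rewrite /f; case: ifP.
have [+ _] := @leif_AGM R _ [set: 'I_(a + b)] f (fun i _ => f0 i).
rewrite cardsT card_ord.
have fl (i : 'I_a) : f (lshift b i) = p by rewrite /f /= ltn_ord.
have frr (i : 'I_b) : f (rshift a i) = q by rewrite /f /= ltnNge leq_addr.
rewrite (eq_bigl xpredT) => [|i]; last by rewrite inE.
rewrite [X in (X / _)](eq_bigl xpredT) => [|i]; last by rewrite inE.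
rewrite !big_split_ord /=.
under eq_bigr => i _ do rewrite fl; under [X in _ * X]eq_bigr => i _ do rewrite frr.
under [X in (X + _)]eq_bigr => i _ do rewrite fl.
under [X in (_ + X)]eq_bigr => i _ do rewrite frr.
by rewrite !prodr_const !sumr_const !card_ord !mulr_natl.
Qed.

Definition base c al (m : nat) : R := 1 - al * c - (1 - al) / m%:R.

Lemma base_gt0 c al m : c < 1 -> 0 < al -> al < 1 -> (0 < m)%N -> 0 < base c al m.
Proof.
move=> c1 a0 a1 m0; rewrite /base.
have : (1 - al) / m%:R <= 1 - al.
  by rewrite ler_pdivrMr ?ltr0n // ler_peMr ?ler1n // subr_ge0 ltW.
nra.
Qed.

(** Weighted AM-GM with the exponents m - 1 and m + 1 as weights: the weighted mean of the two outer
    bases is exactly [base c al m]. *)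
Lemma sigma_logconcave c al m : c < 1 -> 0 < al -> al < 1 -> (1 < m)%N ->
  sigma c al m.-1 * sigma c al m.+1 <= sigma c al m ^+ 2.
Proof.
move=> c1 a0 a1; case: m => [//|m] m1; rewrite /sigma -!/(base _ _ _) /=.
have p1 : 0 <= base c al m by apply/ltW/base_gt0.
have p2 : 0 <= base c al m.+2 by apply/ltW/base_gt0.
have h := weighted_AGM m m.+2 p1 p2; apply: le_trans h _; rewrite -exprM.
have -> : (m.+1 * 2 = m + m.+2)%N by lia.
rewrite le_eqVlt; apply/orP; left; apply/eqP; congr (_ ^+ _).
rewrite /base natrD -[m.+2%:R]natr1 -[m.+1%:R]natr1.
have h0 : 0 < m%:R :> R by rewrite ltr0n; lia.
by field; rewrite !gt_eqF //; lra.
Qed.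

(** Ratios of consecutive terms of a positive log-concave sequence decrease; the ratio at s is 1, so
    the sequence peaks at s and s + 1. *)
Lemma sigma_le c al s m : c < 1 -> 0 < al -> al < 1 -> (0 < s)%N -> (0 < m)%N ->
  sigma c al s = sigma c al s.+1 -> sigma c al m <= sigma c al s.
Proof.
move=> c1 a0 a1 s0 m0 e.
have pos q : (0 < q)%N -> 0 < sigma c al q by move=> hq; rewrite exprn_gt0 // base_gt0.
have up q : sigma c al (s + q).+1 <= sigma c al (s + q).
  elim: q => [|q IH]; first by rewrite addn0 -e.
  have p1 : 0 < sigma c al (s + q).+1 by apply: pos.
  have hq : (1 < (s + q).+1)%N by lia.
  have := sigma_logconcave c1 a0 a1 hq; rewrite /=.
  by rewrite addnS expr2 => h; rewrite -(ler_pM2l p1);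
    apply: le_trans h; rewrite ler_wpM2r // ltW // pos.
have dn q : (q < s)%N -> sigma c al (s - q) <= sigma c al (s - q).+1.
  elim: q => [|q IH] hq; first by rewrite subn0 e.
  have {}IH := IH (ltnW hq).
  have p1 : 0 < sigma c al (s - q) by apply: pos; lia.
  have hq' : (1 < s - q)%N by lia.
  have := sigma_logconcave c1 a0 a1 hq'.
  have -> : (s - q).-1 = (s - q.+1)%N by lia.
  have -> : (s - q.+1).+1 = (s - q)%N by lia.
  rewrite expr2 => h; rewrite -(ler_pM2r p1); apply: le_trans h; rewrite ler_wpM2l // ltW // pos; lia.
have [h|h] := leqP s m.
  rewrite -(subnKC h); elim: (m - s)%N => [|q IH]; first by rewrite addn0.
  by rewrite addnS; apply: le_trans IH.
have -> : m = (s - (s - m))%N by lia.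
have : (s - m < s)%N by lia.
elim: (s - m)%N => [|q IH] hq; first by rewrite subn0.
apply: le_trans (IH (ltnW hq)); apply: le_trans (dn _ hq) _.
by have -> : (s - q.+1).+1 = (s - q)%N by lia.
Qed.

(* For c = 1/s a crossing point with the same value exists too, so both cases
   of [is_rho] are handled alike. *)
Lemma sigma_alpha_exists s : (1 < s)%N -> let c := 1 / s%:R : R in
  exists al, [/\ 0 < al, al < 1, sigma c al s = sigma c al s.+1 &
    sigma c al s = (1 - c) ^+ s].
Proof.
move=> s1 c; have s0 : 0 < s%:R :> R by rewrite ltr0n; lia.
have sp : 0 < s.+1%:R :> R by rewrite ltr0n.
set x := 1 - c; set y := 1 - 1 / s.+1%:R : R.
have x0 : 0 < x by rewrite /x /c subr_gt0 ltr_pdivrMr // mul1r ltr1n.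
have y0 : 0 < y by rewrite /y subr_gt0 ltr_pdivrMr // mul1r ltr1n; lia.
(* For c = 1/s the value [sigma c al s] is x^s for every al, so the task is to make
   [sigma c al s.+1] equal to x^s; p is the difference, negative at 0 and positive at 1. *)
pose p : {poly R} := (x ^+ s)%:P - (y%:P - (c - 1 / s.+1%:R) *: 'X) ^+ s.+1.
have pE a : p.[a] = x ^+ s - (y - (c - 1 / s.+1%:R) * a) ^+ s.+1.
  by rewrite /p !hornerE.
(* The sequence (1 - 1/s)^s is strictly increasing: after division by x^(s-1) the tangent at x
   leaves a surplus of 1 / (s (s+1)^2). *)
have lt1 : x ^+ s < y ^+ s.+1.
  have T := expr_tangent s (ltW y0) (ltW x0).
  apply: lt_le_trans (_ : y * (x ^+ s + s%:R * x ^+ s.-1 * (y - x)) <= _); last first.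
    by rewrite exprS ler_wpM2l // ltW.
  have -> : x ^+ s = x * x ^+ s.-1 by rewrite -exprS prednK //; lia.
  have xs : 0 < x ^+ s.-1 by rewrite exprn_gt0.
  have -> : y * (x * x ^+ s.-1 + s%:R * x ^+ s.-1 * (y - x)) =
     (y * (x + s%:R * (y - x))) * x ^+ s.-1 by ring.
  rewrite ltr_pM2r // /y /x /c -subr_gt0 -[s.+1%:R]natr1.
  have s2 : s%:R + 1 != 0 :> R by rewrite natr1 gt_eqF.
  have -> : (1 - 1 / (s%:R + 1)) *
    (1 - 1 / s%:R + s%:R * (1 - 1 / (s%:R + 1) - (1 - 1 / s%:R))) -
     (1 - 1 / s%:R) = 1 / (s%:R * (s%:R + 1) ^+ 2) :> R.
    by field; rewrite s2 gt_eqF.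
  by rewrite divr_gt0 // mulr_gt0 // exprn_gt0 // natr1.
have lt2 : x ^+ s.+1 < x ^+ s.
  by rewrite exprS gtr_pMl ?exprn_gt0 // /x /c gtrBl divr_gt0.
have e1 : y - (c - 1 / s.+1%:R) * 1 = x by rewrite /y /x; ring.
have [||al /andP[a0 a1] rt] := @poly_ivt R p 0 1; first exact: ler01.
  by rewrite !pE e1 mulr0 subr0 subr_le0 subr_ge0 !ltW.
have {rt} ea : x ^+ s = (y - (c - 1 / s.+1%:R) * al) ^+ s.+1.
  by apply/eqP; rewrite -subr_eq0 -pE.
have sE : sigma c al s = x ^+ s.
  by rewrite /sigma; congr (_ ^+ _); rewrite /x /c; ring.
exists al; split=> //.
- rewrite lt_neqAle a0 andbT; apply/eqP => e; move: ea; rewrite -e mulr0 subr0 => ea.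
  by rewrite ea ltxx in lt1.
- rewrite lt_neqAle a1 andbT; apply/eqP => e; move: ea; rewrite e e1 => ea.
  by rewrite -ea ltxx in lt2.
- rewrite sE ea /sigma; congr (_ ^+ _); rewrite /y; ring.
Qed.

(** Collects all that the algorithm needs to know about rho. The value c = 1 is set apart, since 1 -
    rho = 0 leaves no slack for an error. *)
Lemma rho_cases c r : 0 < c <= 1 -> is_rho c r ->
  (c = 1 /\ r = 1) \/
  exists s al, [/\ 1 < c * s.+1%:R, c < 1, 0 < al < 1, r < 1 &
    forall m, (0 < m)%N -> sigma c al m <= 1 - r].
Proof.
move=> /andP[c0 c1] [[s [s0 [ec er]]]|[s [s0 [h1 [h2 [al [a0 [a1 [e er]]]]]]]]].
- case: s s0 ec er => [//|[|s]] _ ec er; [left|right].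
    have ec1 : c = 1 by rewrite ec divr1.
    by split=> //; rewrite er ec1 subrr expr0n subr0.
  have [al [a0 a1 e1 e2]] := @sigma_alpha_exists s.+2 isT; rewrite -ec in e1 e2.
  have s0 : 0 < s.+2%:R :> R by rewrite ltr0n.
  have lc1 : c < 1 by rewrite ec ltr_pdivrMr // mul1r ltr1n.
  exists s.+2, al; split=> //.
  + by rewrite ec mulrAC mul1r ltr_pdivlMr // mul1r ltr_nat.
  + by rewrite a0 a1.
  + by rewrite er gtrBl exprn_gt0 // subr_gt0.
  + move=> m m0; rewrite er opprB addrC subrK -e2.
    exact: sigma_le.
- right; exists s, al.
  have s1 : 0 < s%:R :> R by rewrite ltr0n.
  have lc1 : c < 1.
    by apply: lt_le_trans h2 _; rewrite ler_pdivrMr // mul1r ler1n.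
  split=> //.
  + by rewrite mulrC -ltr_pdivrMl ?ltr0n // mulrC.
  + by rewrite a0 a1.
  + by rewrite er gtrBl exprn_gt0 // base_gt0.
  + move=> m m0; rewrite er opprB addrC subrK; exact: sigma_le.
Qed.

End Sigma.

(** * The value reached from one guess *)

Section Guess.
Variables (R : realType) (n M j0 k : nat) (E : finType) (w : E -> R).
Variables (h : E -> nat -> bool) (fr0 : pred nat).
Hypothesis w_ge0 : forall e, 0 <= w e.
Hypothesis j0_lt : (j0 < n)%N.
Hypothesis j0_fixed : ~~ fr0 j0.
Hypothesis k_gt0 : (0 < k)%N.
Variables (T N : nat) (delta thr W : R).
Hypothesis T_delta : T%:R * delta = 1.
Hypothesis delta_gt0 : 0 < delta.
Hypothesis thrE : thr = W * delta * delta.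
Hypothesis W_ge : \sum_e wj j0 w h e <= W.
Hypothesis N_gt0 : (0 < N)%N.
Hypothesis N_ge : 1 <= N%:R * delta * delta.

Notation G := (Gf (wj j0 w h) (Ae n M h fr0)).
Notation F := (Ff (wj j0 w h) (Ae n M h fr0)).
Notation orc := (orcE n w h).

Variable y : nat -> R.
Hypothesis y_init : forall i, (i < n)%N ->
  y i = if fr0 i then if ((count fr0 (iota 0 i)).+1 < k)%N then 1 else 0 else 1 + 1.

Definition output : nat -> R :=
  dbl n (pipstep orc n (2 ^ j0)%N M)
    (iter N (sweep orc n (2 ^ j0)%N M delta thr) y).

Definition out_mask : nat :=
  (2 ^ j0 + mask (fun i => ~~ (output i < 1)%R && ~~ (1 < output i)%R) n)%N.

(** The mass placed by the initial filling: k - 1 units besides [j0], or fewer if there are not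
    enough free coordinates. *)
Definition quota : nat := minn k.-1 (count fr0 (iota 0 n)).

Lemma init_inv : ls_inv n fr0 T delta quota%:R y.
Proof.
split.
- move=> i hi; rewrite /fr y_init //; case: (fr0 i); last by rewrite ltrDl ltr01.
  by case: ifP => _; rewrite ?ltxx // -leNgt ler01.
- move=> i hi fi; rewrite y_init // fi; case: ifP => _.
    by exists T; rewrite ?T_delta.
  by exists 0%N; rewrite ?mul0r.
suff H t : (t <= n)%N ->
    \sum_(0 <= x < t | fr0 x) y x = (minn k.-1 (count fr0 (iota 0 t)))%:R by exact: H.
elim: t => [|t IH] ht; first by rewrite big_geq //= minn0.
rewrite -[in iota 0 _](addn1 t) iotaD count_cat.
rewrite big_mkcond big_nat_recr //= -big_mkcond IH; last by lia.
rewrite add0n addn0 y_init //.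
case: (fr0 t) => /=; last by rewrite addr0 addn0.
by case: ifP => ht'; rewrite -?natr1 -?natrD ?addr0; [rewrite natr1|]; congr (_%:R); lia.
Qed.

(** Local search compares with [y'] in terms of G; passing from G to F at the local optimum and then
    rounding preserves the bound. *)
Lemma output_spec : [/\ pip_inv n fr0 quota%:R output, integral n fr0 output &
  forall y', dom n fr0 y' -> total n fr0 y' <= quota%:R ->
    G y' <= F output + 2%:R * delta * W * n%:R].
Proof.
have L y' := ls_result (y' := y') M w_ge0 j0_lt j0_fixed T_delta delta_gt0 thrE W_ge
  init_inv N_gt0 N_ge.
have d0 : dom n fr0 (fun=> 0 : R) by move=> x _ _; rewrite lexx ler01.
have [|[ok g s] _] := L _ d0; first by rewrite /total big1 // ler0n.
have d := grid_dom T_delta delta_gt0 g.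
have pI : pip_inv n fr0 quota%:R
  (iter N (sweep orc n (2 ^ j0)%N M delta thr) y) by split.
have [p1 p2 p3] := pip_result M w_ge0 j0_lt j0_fixed delta_gt0 W_ge pI; split=> // y' d' h'.
have [_ h1] := L _ d' h'; apply: le_trans h1 _; rewrite lerD2r.
apply: le_trans p2; apply: G_le_F d => [e|].
  exact: wj_ge0.
exact: Ae_sub.
Qed.

Lemma bit_out i : (i < n)%N ->
  bit out_mask i = (i == j0) || fr0 i && (output i == 1).
Proof.
move=> hi; have [[ok d _] _ _] := output_spec.
rewrite /out_mask -(mask1 j0_lt) maskD.
  rewrite bit_mask hi /=; case: eqP => //= _.
  have := ok i hi; rewrite /fr -!leNgt eq_le => ->.
by case: (fr0 i); rewrite ?andbT ?andbF.
move=> i' hi' /eqP-> /andP[_]; have := ok j0 j0_lt; rewrite /fr => ->.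
by rewrite (negPf j0_fixed).
Qed.

Lemma out_card : \sum_(0 <= i < n) (bit out_mask i : nat) = quota.+1.
Proof.
have [[ok d s] int _] := output_spec.
apply/eqP; rewrite -(eqr_nat R) natr_sum -natr1 -s addrC /total.
rewrite [X in _ == _ + X]big_mkcond.
have E1 : \sum_(0 <= i < n) (i == j0)%:R = 1 :> R.
  rewrite (big_rem j0) ?mem_index_iota //= eqxx big1_seq ?addr0 //.
  by move=> x /andP[_]; rewrite mem_rem_uniq ?iota_uniq // inE => /andP[/negPf->].
rewrite -[X in _ == X + _]E1 -big_split; apply/eqP; rewrite !big_nat; apply: eq_bigr => i /andP[_ hi] /=.
rewrite bit_out //; case: (eqVneq i j0) => [->|_] /=.
  by rewrite (negPf j0_fixed) addr0.
rewrite add0r; case: (boolP (fr0 i)) => //= fi.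
by case: (int i hi fi) => ->; rewrite ?eqxx // eq_sym oner_eq0.
Qed.

(** At an integral point F weighs the elements met through their first M free members; the first sum
    restores the elements of [j0], which [wj] sets to 0. Truncation can only lose coverage. *)
Lemma out_value : \sum_e w e * (h e j0)%:R + F output <= orc out_mask.
Proof.
have [[ok d s] int _] := output_spec.
rewrite /Ff /orcE -big_split; apply: ler_sum => e _ /=; rewrite /wj.
case: (boolP (h e j0)) => hj.
  rewrite mul0r addr0 ler_wpM2l // ler_nat.
  suff -> : has (fun i => bit out_mask i && h e i) (iota 0 n) by [].
  by apply/hasP; exists j0; rewrite ?mem_iota ?add0n // bit_out // eqxx hj.
rewrite mulr0 add0r ler_wpM2l //.
case: (boolP (has (fun i => bit out_mask i && h e i) (iota 0 n))) => hh.
  rewrite gerBl big_seq; apply: prodr_ge0 => x /Ae_sub /andP[hx fx].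
  by have /andP[] := d x hx fx; rewrite subr_ge0.
rewrite big_seq big1 ?subrr // => x hx.
have /andP[hxn fx] := Ae_sub hx; have hxe : h e x.
  by move/mem_take: hx; rewrite mem_filter => /andP[/andP[_ ->]].
case: (int x hxn fx) => ex; first by rewrite ex subr0.
case/hasP: hh; exists x; first by rewrite mem_iota.
by rewrite bit_out // fx ex eqxx orbT hxe.
Qed.

Variable Ob : pred nat.
Definition covP (B : pred nat) : R :=
  \sum_e w e * (has (fun i => B i && h e i) (iota 0 n))%:R.

Hypothesis Ob_j0 : Ob j0.
Hypothesis Ob_free : forall i, (i < n)%N -> Ob i -> i != j0 -> fr0 i.

(** The quota equals the number of free coordinates, so all of them must be 1 and the output
    contains the whole of [Ob]. *)
Lemma all_free_value : (forall i, (i < n)%N -> fr0 i -> Ob i) ->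
  count fr0 (iota 0 n) = k.-1 -> covP Ob <= orc out_mask.
Proof.
move=> hall hc; have [[ok d s] int _] := output_spec.
have one i : (i < n)%N -> fr0 i -> output i = 1.
  have S : \sum_(0 <= x < n | fr0 x) (1 - output x) = 0.
    rewrite sumrB -/(total n fr0 output) s /quota hc minnn -hc.
    rewrite -sum1_count natr_sum /index_iota subn0; apply/eqP; rewrite subr_eq0.
    by apply/eqP; apply: eq_bigr => x _.
  have ge x : (x < n)%N && fr0 x -> 0 <= 1 - output x.
    by move=> /andP[hx fx]; have /andP[] := d x hx fx; rewrite subr_ge0.
  move=> hi fi; move: S; rewrite (big_rem i) ?mem_index_iota //= fi => S.
  have : 0 <= \sum_(x <- rem i (index_iota 0 n) | fr0 x) (1 - output x).
    rewrite big_seq_cond; apply: sumr_ge0 => x /andP[/mem_rem + fx].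
    by rewrite mem_index_iota => /andP[_ hx]; apply: ge; rewrite hx fx.
  have := ge i; rewrite hi fi => /(_ isT); move: S; lra.
apply: ler_sum => e _; rewrite ler_wpM2l // ler_nat.
case: (boolP (has _ _)) => // /hasP[x hx /andP[ox hxe]].
suff -> : has (fun i => bit out_mask i && h e i) (iota 0 n) by [].
apply/hasP; exists x => //; move: hx; rewrite mem_iota add0n => /= hx.
rewrite bit_out // hxe andbT; case: (eqVneq x j0) => //= hne.
have fx := Ob_free hx ox hne; by rewrite fx one // eqxx.
Qed.

Variables (c al r : R).
Hypothesis c_range : 0 < c < 1.
Hypothesis al_range : 0 < al < 1.
Hypothesis sigma_r : forall m, (0 < m)%N -> sigma c al m <= 1 - r.
Hypothesis M_gt0 : (0 < M)%N.
Hypothesis M_r : (1 - al * c) ^+ M <= 1 - r.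

(* The comparison point of the analysis; it never enters the algorithm. *)
Definition mixed (x : nat) : R := al * c + (1 - al) * (Ob x)%:R.

Lemma mixed_range x : 0 <= mixed x <= 1.
Proof.
case/andP: c_range al_range => c0 c1 /andP[a0 a1]; rewrite /mixed.
by case: (Ob x); rewrite ?mulr1 ?mulr0 ?addr0; apply/andP; split; nra.
Qed.

Lemma mixed_elem e : has (fun i => Ob i && h e i) (iota 0 n) -> ~~ h e j0 ->
  mean (Ae n M h fr0) e mixed ^+ size (Ae n M h fr0 e) <= 1 - r.
Proof.
move=> /hasP[x hx /andP[ox hex]] hj.
case/andP: c_range al_range => c0 c1 /andP[a0 a1].
have dm : dom n fr0 mixed by move=> *; apply: mixed_range.
have /andP[m0 _] := mean_range (@Ae_sub n M E h fr0) e dm.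
have fx : fr0 x.
  apply: Ob_free => //; first by move: hx; rewrite mem_iota.
  by apply: contraNneq hj => <-.
set L := [seq i <- iota 0 n | fr0 i && h e i].
have xL : x \in L by rewrite mem_filter fx hex.
have le1 z : 1 - mixed z <= 1 - al * c.
  by rewrite /mixed lerD2l lerN2 lerDl mulr_ge0 ?ler0n // subr_ge0 ltW.
have [hL|hL] := leqP (size L) M.
  have eA : Ae n M h fr0 e = L by rewrite /Ae take_oversize.
  rewrite eA in m0 *; have s0 : (0 < size L)%N by case: (L) xL.
  apply: le_trans (sigma_r s0); rewrite /sigma lerXn2r ?nnegrE //.
    by apply/ltW/base_gt0.
  have sc (q : seq nat) : \sum_(z <- q) (1 - mixed z) <= (size q)%:R * (1 - al * c).
    elim: q => [|z q IH]; first by rewrite big_nil mul0r.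
    by rewrite big_cons /= -natr1 mulrDl mul1r addrC lerD.
  rewrite /mean eA ler_pdivrMr ?ltr0n // /base.
  rewrite (big_rem x xL) /=; have := sc (rem x L); rewrite size_rem // => hs.
  have e1 : (size L)%:R = (size L).-1%:R + 1 :> R by rewrite natr1 prednK.
  have s0' : (size L)%:R != 0 :> R by rewrite pnatr_eq0 -lt0n.
  have -> : (1 - al * c - (1 - al) / (size L)%:R) * (size L)%:R =
     (1 - mixed x) + (size L).-1%:R * (1 - al * c).
    by rewrite mulrBl divfK // e1 /mixed ox mulr1; ring.
  by rewrite lerD2l.
(* The truncated list may have lost the member in [Ob], so only the uniform part al c is available;
   [M_r] takes care of this case. *)
have eA : size (Ae n M h fr0 e) = M by rewrite /Ae size_take hL.
rewrite eA; apply: le_trans M_r; rewrite lerXn2r ?nnegrE //.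
  by rewrite subr_ge0; nra.
have sc (q : seq nat) : \sum_(z <- q) (1 - mixed z) <= (size q)%:R * (1 - al * c).
  elim: q => [|z q IH]; first by rewrite big_nil mul0r.
  by rewrite big_cons /= -natr1 mulrDl mul1r addrC lerD.
by rewrite /mean eA ler_pdivrMr ?ltr0n // mulrC; have := sc (Ae n M h fr0 e); rewrite eA.
Qed.

Lemma guess_value : count (fun i => fr0 i && Ob i) (iota 0 n) = k.-1 ->
  c * (count fr0 (iota 0 n))%:R <= k.-1%:R ->
  2%:R * delta * W * n%:R <= (1 - r) * \sum_e w e * (h e j0)%:R ->
  r * covP Ob <= orc out_mask.
Proof.
move=> hc hf hs; have [_ _ L] := output_spec.
case/andP: c_range al_range => c0 c1 /andP[a0 a1].
have dm : dom n fr0 mixed by move=> *; apply: mixed_range.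
have hq : quota = k.-1.
  rewrite /quota -hc; apply/minn_idPl; rewrite -!sum1_count.
  by rewrite big_mkcond [X in (_ <= X)%N]big_mkcond leq_sum // => i _; case: (fr0 i); case: (Ob i).
(* With N free coordinates the total is al c N + (1 - al)(k - 1), at most k - 1 by the density
   assumption. *)
have ht : total n fr0 mixed <= quota%:R.
  rewrite hq /total /mixed big_split /= -[X in _ + X]mulr_sumr.
  have -> : \sum_(0 <= i < n | fr0 i) (Ob i)%:R = k.-1%:R :> R.
    rewrite -hc -sum1_count natr_sum /index_iota subn0 big_mkcond [RHS]big_mkcond.
    by apply: eq_bigr => i _; case: (fr0 i); case: (Ob i).
  have -> : \sum_(0 <= i < n | fr0 i) (al * c) = al * (c * (count fr0 (iota 0 n))%:R).
    rewrite -sum1_count natr_sum /index_iota subn0 !mulr_sumr.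
    by apply: eq_bigr => i _; rewrite mulr1.
  have := ler_wpM2l (ltW a0) hf; lra.
have := L _ dm ht; have := out_value.
set fj := \sum_e _ => h1 h2.
have h3 : r * (covP Ob - fj) <= G mixed.
  rewrite /covP /fj -sumrB mulr_sumr; apply: ler_sum => e _; rewrite /wj.
  case: (boolP (h e j0)) => hj.
    have -> : has (fun i => Ob i && h e i) (iota 0 n).
      by apply/hasP; exists j0; rewrite ?mem_iota ?Ob_j0.
    by rewrite subrr mulr0 mul0r.
  rewrite mulr0 subr0.
  have dm' := mean_range (@Ae_sub n M E h fr0) e dm.
  case: (boolP (has _ _)) => ho.
    rewrite mulr1 mulrC ler_wpM2l //; have := mixed_elem ho hj; lra.
  rewrite !mulr0 mulr_ge0 // subr_ge0; case/andP: dm' => m0 m1.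
  by rewrite exprn_ile1.
(* The weight [fj] covered by [j0] is obtained in full while only r times it is owed; the difference
   pays for the error of the local search. *)
have -> : r * covP Ob = r * (covP Ob - fj) + r * fj by ring.
by move: h1 h2 h3 hs; rewrite -/fj; lra.
Qed.

End Guess.

(** * All guesses *)

Definition in_guess (g : nat -> nat) (s i : nat) : bool :=
  has (fun l => g l == i) (iota 0 s.+1).

Section MainRun.
Variables (R : realType) (n k s M K : nat) (E : finType) (w : E -> R).
Variable h : E -> nat -> bool.
Hypothesis w_ge0 : forall e, 0 <= w e.
Hypothesis n_gt0 : (0 < n)%N.
Hypothesis k_gt0 : (0 < k)%N.
Hypothesis K_gt0 : (0 < K)%N.
Hypothesis w_supp : forall e, ~~ has (h e) (iota 0 n) -> w e = 0.

Notation orc := (orcE n w h).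

Definition unit_step : R := 1 / (K%:R * n%:R * n%:R * n%:R).
Definition total_weight : R := orc (mask xpredT n).
Definition threshold : R := total_weight * unit_step * unit_step.
Definition result : nat := (den orc (mainc s M) (start R n k K)).1 14%N.

Lemma Kn3_gt0 : 0 < K%:R * n%:R * n%:R * n%:R :> R.
Proof. by rewrite !mulr_gt0 ?ltr0n. Qed.

Lemma unit_step_gt0 : 0 < unit_step.
Proof. by rewrite divr_gt0 // Kn3_gt0. Qed.

Lemma unit_stepE : (K * n * n * n)%:R * unit_step = 1.
Proof. by rewrite !natrM /unit_step mul1r mulfV // gt_eqF // Kn3_gt0. Qed.

Lemma sweeps_gt0 : (0 < sweeps n K)%N.
Proof. by rewrite /sweeps !muln_gt0 K_gt0 n_gt0. Qed.

Lemma sweeps_unit_step : 1 <= (sweeps n K)%:R * unit_step * unit_step.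
Proof.
have e := unit_stepE.
have -> : sweeps n K = (K * n * n * n * (K * n * n * n))%N by rewrite /sweeps; ring.
by rewrite natrM -mulrA mulrACA e mulr1.
Qed.

Lemma total_weightE : total_weight = \sum_e w e.
Proof.
apply: eq_bigr => e _; case: (boolP (has (h e) (iota 0 n))) => hh; last first.
  by rewrite w_supp // mul0r.
suff -> : has (fun i => bit (mask xpredT n) i && h e i) (iota 0 n) by rewrite mulr1.
case/hasP: hh => x hx hxe; apply/hasP; exists x => //.
by move: hx; rewrite mem_iota bit_mask hxe !andbT.
Qed.

Lemma wj_le_total j0 : \sum_e wj j0 w h e <= total_weight.
Proof. by rewrite total_weightE; apply: ler_sum => e _; rewrite /wj; case: ifP. Qed.

Definition guess_init (g : nat -> nat) (y : nat -> R) : Prop :=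
  forall i, (i < n)%N -> y i =
    if ~~ in_guess g s i then
      if ((count (fun i => ~~ in_guess g s i) (iota 0 i)).+1 < k)%N then 1 else 0
    else 1 + 1.

Lemma orcE_ge0 m : 0 <= orc m.
Proof. by apply: sumr_ge0 => e _; rewrite mulr_ge0 ?ler0n. Qed.

(** All guesses are run, so a bound attained by one of them holds for the result. Every guess, good
    or bad, yields a feasible mask, and the stored value never exceeds the value of the stored
    mask. *)
Lemma main_run (g : nat -> nat) (V : R) :
  (forall l, (l < s.+1)%N -> (g l < n)%N) ->
  (forall y, guess_init g y ->
     V <= orc (out_mask n M (g 0%N) w h (sweeps n K) unit_step threshold y)) ->
  (\sum_(0 <= i < n) (bit result i : nat) <= k)%N /\ V <= orc result.
Proof.
move=> gn hV.
have [e0 b0 v0] := @den_setupc R orc n k K unit_step threshold (start R n k K)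
  erefl erefl erefl erefl erefl erefl erefl.
pose J (t : st R) := [/\ env n k K unit_step threshold t,
  (\sum_(0 <= i < n) (bit (t.1 14%N) i : nat) <= k)%N & t.2 28%N <= orc (t.1 14%N)].
set s0 := den orc setupc _ in e0 b0 v0.
have J0 : J s0.
  split=> //; last by rewrite b0 v0 orcE_ge0.
  by rewrite b0 big1 // => i _; rewrite bit0.
have Jc t : J t -> t.1 0%N = n /\ t.1 2%N = 1%N by case=> [[[]]].
have JN m v t : (m < s.+1)%N -> J t -> J (setN (gR m) v t).
  move=> _ [j1 j2 j3]; split; first by apply: env_setN j1; rewrite /gR; lia.
  - by rewrite /= upd_diff // /gR; lia.
  - by rewrite /= upd_diff // /gR; lia.
have H t : J t -> (forall m, (m < s.+1)%N -> (t.1 (gR m) < n)%N) ->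
    [/\ J (den orc (innerc s M) t), t.2 28%N <= (den orc (innerc s M) t).2 28%N &
      (forall m, (m < s.+1)%N -> t.1 (gR m) = g m) ->
      V <= (den orc (innerc s M) t).2 28%N].
  move=> [j1 j2 j3] ht.
  have [y hy [i1 i2 i3]] := den_innerc orc M j1 ht.
  set X := (_ + _)%N in i2 i3.
  have XE : X = out_mask n M (t.1 (gR 0)) w h (sweeps n K) unit_step threshold y by [].
  clearbody X.
  have hj : ~~ ~~ guessed t.1 s (t.1 (gR 0)).
    by rewrite negbK; apply/hasP; exists 0%N; rewrite ?mem_iota ?eqxx.
  have cX : (\sum_(0 <= i < n) (bit X i : nat) <= k)%N.
    rewrite XE (out_card M w_ge0 (ht 0%N isT) hj k_gt0 unit_stepE unit_step_gt0 erefl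
      (wj_le_total _) sweeps_gt0 sweeps_unit_step hy).
    by rewrite /quota; lia.
  split.
  - split=> //; first by rewrite i2; case: ifP.
    by rewrite i2 i3; case: ifP.
  - by rewrite i3; case: ltP => // /ltW.
  - move=> hg; have hVX : V <= orc X.
      have -> : X = out_mask n M (g 0%N) w h (sweeps n K) unit_step threshold y.
        by rewrite XE hg.
      apply: hV => i hi; rewrite hy //.
      have gE x : guessed t.1 s x = in_guess g s x.
        by apply: eq_in_has => l; rewrite mem_iota add0n => /andP[_ hl]; rewrite hg.
      by rewrite gE (eq_count (a2 := fun i => ~~ in_guess g s i)) // => x; rewrite gE.
    by rewrite i3; case: ltP => // /(le_trans hVX).
have wI : wf (innerc s M) := wf_innerc s M.
have wg m : (m < s.+1)%N -> ~~ wrN (innerc s M) (gR m) by rewrite wrN_innerc_guess.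
have h0 m : (s.+1 <= m < s.+1)%N -> (s0.1 (gR m) < n)%N by lia.
have [J1 _ V1] := den_nestc wI wg Jc JN H gn (leqnn _) J0 h0.
have eR : result = (den orc (nestc s.+1 (innerc s M)) s0).1 14%N by [].
case: J1 => _ j2 j3; rewrite eR; split=> //; apply: le_trans j3; apply: V1 => m; lia.
Qed.

End MainRun.

(** * Coverage functions on plain indices; monotonicity and subadditivity *)

Section Cover.
Variables (R : realType) (n : nat) (E : finType) (w : E -> R) (S : 'I_n -> {set E}).
Hypothesis w_ge0 : forall e, 0 <= w e.
Implicit Types Y Z : {set 'I_n}.

Definition mem_nat Y (i : nat) : bool := [exists j : 'I_n, (j == i :> nat) && (j \in Y)].

Lemma mem_nat_ord Y (i : 'I_n) : mem_nat Y i = (i \in Y).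
Proof.
apply/existsP/idP => [[j /andP[/eqP/val_inj->]]|hi] //.
by exists i; rewrite eqxx.
Qed.

Lemma mem_nat_decode m i : (i < n)%N -> mem_nat (decode n m) i = bit m i.
Proof. by move=> hi; rewrite -[i]/(val (Ordinal hi)) mem_nat_ord inE. Qed.

(* Elements outside every set must not count towards the total weight. *)
Definition cut (e : E) : R := if has (hit S e) (iota 0 n) then w e else 0.

Lemma cut_ge0 e : 0 <= cut e.
Proof. by rewrite /cut; case: ifP. Qed.

Lemma cov_covP Y : cov S w Y = covP n cut (hit S) (mem_nat Y).
Proof.
rewrite /cov big_mkcond; apply: eq_bigr => e _.
have -> : (e \in \bigcup_(i in Y) S i) =
    has (fun i => mem_nat Y i && hit S e i) (iota 0 n).
  apply/bigcupP/hasP => [[i h1 h2]|[i]].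
    exists (i : nat); first by rewrite mem_iota add0n ltn_ord.
    by rewrite hit_ord mem_nat_ord h1 h2.
  rewrite mem_iota add0n => /= hi /andP[h1 h2]; exists (Ordinal hi).
    by rewrite -mem_nat_ord.
  by rewrite -hit_ord.
rewrite /cut; case: (boolP (has (fun i => _) _)) => hh; last by rewrite mulr0.
suff -> : has (hit S e) (iota 0 n) by rewrite mulr1.
by case/hasP: hh => i hi /andP[_ h]; apply/hasP; exists i.
Qed.

Lemma cov_decode m : cov S w (decode n m) = orcE n cut (hit S) m.
Proof.
rewrite cov_covP; apply: eq_bigr => e _; congr (_ * (_ : bool)%:R).
by apply: eq_in_has => i; rewrite mem_iota add0n => /andP[_ /mem_nat_decode->].
Qed.

Lemma cov_ge0 Y : 0 <= cov S w Y.
Proof. exact: sumr_ge0. Qed.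

Lemma cov_mono Y Z : Y \subset Z -> cov S w Y <= cov S w Z.
Proof.
move=> sYZ; rewrite /cov big_mkcond [X in _ <= X]big_mkcond; apply: ler_sum => e _.
case: ifP => [/bigcupP[i hi he]|_]; last by case: ifP.
have -> // : e \in \bigcup_(i in Z) S i.
by apply/bigcupP; exists i => //; apply: (subsetP sYZ).
Qed.

Lemma cov_le_sum Y : cov S w Y <= \sum_(i in Y) cov S w [set i].
Proof.
rewrite /cov; under [X in _ <= X]eq_bigr => i _ do rewrite big_set1 big_mkcond.
rewrite exchange_big big_mkcond; apply: ler_sum => e _ /=.
have nn i : 0 <= (if e \in S i then w e else 0) by case: ifP.
case: ifP => [/bigcupP[i hi he]|_]; last by apply: sumr_ge0.
by rewrite (bigD1 i) //= he lerDl; apply: sumr_ge0.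
Qed.

Lemma cov_set1 (j : 'I_n) :
  cov S w [set j] = \sum_e cut e * (hit S e j)%:R.
Proof.
rewrite cov_covP; apply: eq_bigr => e _; congr (_ * (_ : bool)%:R).
apply/hasP/idP => [[i]|hj].
  rewrite mem_iota add0n => /= hi; rewrite -[i]/(val (Ordinal hi)) mem_nat_ord inE.
  by move=> /andP[/eqP->].
by exists (j : nat); rewrite ?mem_iota ?add0n ?ltn_ord // mem_nat_ord set11.
Qed.

Lemma count_ord (B : pred nat) : count B (iota 0 n) = #|[set i : 'I_n | B i]|.
Proof.
have -> : iota 0 n = index_iota 0 n by rewrite /index_iota subn0.
rewrite -sum1_count big_mkord -sum1_card.
by apply: eq_bigl => i; rewrite inE.
Qed.

End Cover.

Lemma subset_of_card (T : finType) (B : {set T}) m : (m <= #|B|)%N ->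
  exists2 C : {set T}, C \subset B & #|C| = m.
Proof.
move=> hm; exists [set x in take m (enum B)].
  by apply/subsetP => x; rewrite inE => /mem_take; rewrite mem_enum.
rewrite cardsE; move/card_uniqP: (take_uniq m (enum_uniq (mem B))) => ->.
by rewrite size_takel // -cardE.
Qed.

Lemma superset_of_card (T : finType) (B : {set T}) m : (#|B| <= m <= #|T|)%N ->
  exists2 C : {set T}, B \subset C & #|C| = m.
Proof.
case/andP=> h1 h2; have [|C sC cC] := @subset_of_card _ (~: B) (m - #|B|).
  by have := cardsC B; lia.
exists (B :|: C); first exact: subsetUl.
rewrite cardsU cC; have -> : B :&: C = set0; last by rewrite cards0; lia.
by apply/setP => x; rewrite !inE; case: (boolP (x \in C)) => [/(subsetP sC)|_];
  rewrite ?inE ?andbF // => /negPf->.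
Qed.

(** Once [I] is exhausted the default of [nth] repeats [j], and marking [j] again changes nothing;
    thus a fixed number of guesses describes smaller sets as well. *)
Definition enum_guess (n : nat) (j : 'I_n) (I : {set 'I_n}) (l : nat) : nat :=
  if l is l'.+1 then nth j (enum I) l' else j.

Lemma enum_guessP n (j : 'I_n) (I : {set 'I_n}) s (i : 'I_n) : (#|I| <= s)%N ->
  in_guess (enum_guess j I) s i = (i == j) || (i \in I).
Proof.
move=> hs; apply/hasP/orP => [[[|l]]|[/eqP->|hi]] /=.
- by move=> _ /eqP/val_inj->; left.
- move=> _ /eqP/val_inj <-; have [hl|hl] := ltnP l (size (enum I)).
    by right; rewrite -mem_enum mem_nth.
  by left; rewrite nth_default.
- by exists 0%N; rewrite ?mem_iota ?eqxx.
- exists (index i (enum I)).+1; last by rewrite /= nth_index ?mem_enum.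
  by rewrite inE mem_iota add1n /= ltnS; apply: leq_trans hs; rewrite cardE index_mem mem_enum.
Qed.

(** Bernoulli's inequality for 1/x, that is, [expr_tangent] at 1. *)
Lemma expr_small (R : realType) (x eps : R) : 0 <= x < 1 -> 0 < eps ->
  exists2 M : nat, (0 < M)%N & x ^+ M <= eps.
Proof.
move=> /andP[x0 x1] e0; have [->|xn] := eqVneq x 0.
  by exists 1%N => //; rewrite expr1 ltW.
have xp : 0 < x by rewrite lt_neqAle eq_sym xn.
have d0 : 0 < x^-1 - 1 by rewrite subr_gt0 invf_gt1.
have y0 : 0 < eps * (x^-1 - 1) by rewrite mulr_gt0.
pose m := (Num.bound (eps * (x^-1 - 1))^-1).+1; exists m => //.
have hm : (eps * (x^-1 - 1))^-1 < m%:R.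
  apply: lt_trans (archi_boundP _) _; first by rewrite invr_ge0 ltW.
  by rewrite ltr_nat.
have xv : 0 <= x^-1 by rewrite invr_ge0.
have := expr_tangent m xv (ler01 : 0 <= 1 :> R); rewrite !expr1n mulr1 => hT.
have h1 : 1 <= eps * (x^-1) ^+ m.
  apply: le_trans (_ : eps * (m%:R * (x^-1 - 1)) <= _).
    by rewrite mulrCA -ler_pdivrMr // mul1r ltW.
  by rewrite ler_wpM2l ?ltW //; lra.
by move: h1; rewrite exprVn ler_pdivlMr ?exprn_gt0 // mul1r.
Qed.

(** * Choosing the guess from an optimal solution *)

Section Optimum.
Variables (R : realType) (n k s M K : nat) (E : finType) (w : E -> R).
Variable S : 'I_n -> {set E}.
Hypothesis w_ge0 : forall e, 0 <= w e.
Hypothesis n_gt0 : (0 < n)%N.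
Hypothesis k_range : (0 < k <= n)%N.
Hypothesis K_gt0 : (0 < K)%N.

Notation f := (cov S w).
Notation cw := (cut w S).
Notation orc := (orcE n cw (hit S)).
Notation out g y := (out_mask n M (g 0%N) cw (hit S) (sweeps n K) (unit_step R n K)
  (threshold n K cw (hit S)) y).

(** By monotonicity a smaller set can be padded, so a best set among those of size exactly k is
    optimal. *)
Lemma optimum_exists : exists O : {set 'I_n}, #|O| = k /\
  forall Y : {set 'I_n}, (#|Y| <= k)%N -> f Y <= f O.
Proof.
case/andP: k_range => k0 kn.
have [|Y0 _ c0] := @subset_of_card _ [set: 'I_n] k; first by rewrite cardsT card_ord.
have [O /eqP cO hO] := @arg_maxP _ _ _ Y0 (fun Y : {set 'I_n} => #|Y| == k) f
  (introT eqP c0).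
exists O; split=> // Y cY.
have [|Z sYZ cZ] := @superset_of_card _ Y k; first by rewrite cY card_ord.
by apply: le_trans (cov_mono S w_ge0 sYZ) (hO Z _); rewrite cZ.
Qed.

Variable O : {set 'I_n}.
Hypothesis card_O : #|O| = k.
Hypothesis O_opt : forall Y : {set 'I_n}, (#|Y| <= k)%N -> f Y <= f O.

(** Subadditivity twice: W is at most n times the value of some single set, which is at most f(O)
    because k >= 1, and f(O) is at most n f({j}). *)
Lemma best_member : exists2 j, j \in O &
  total_weight n cw (hit S) <= n%:R * n%:R * f [set j].
Proof.
case/andP: k_range => k0 kn.
have [j1 hj1] : exists j, j \in O by apply/set0Pn; rewrite -card_gt0 card_O.
have [j hj jmax] := @arg_maxP _ _ _ j1 (mem O) (fun i => f [set i]) hj1.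
exists j => //.
have sum_le (Y : {set 'I_n}) b : 0 <= b -> (forall i, i \in Y -> f [set i] <= b) ->
    f Y <= n%:R * b.
  move=> b0 hb; apply: le_trans (cov_le_sum S w_ge0 Y) _.
  apply: le_trans (_ : \sum_(i in Y) b <= _); first exact: ler_sum.
  rewrite sumr_const -(mulr_natl b) ler_wpM2r // ler_nat.
  by rewrite -[n in X in (_ <= X)%N]card_ord; apply: max_card.
rewrite /total_weight -cov_decode -mulrA; apply: (sum_le _ _).
  by rewrite mulr_ge0 // cov_ge0.
move=> i _; apply: le_trans (_ : f O <= _).
  by apply: O_opt; rewrite cards1.
apply: sum_le; first exact: cov_ge0.
by move=> i' hi'; apply: jmax.
Qed.

Lemma cw_supp e : ~~ has (hit S e) (iota 0 n) -> cw e = 0.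
Proof. by rewrite /cut => /negPf->. Qed.

Lemma free_count (j : 'I_n) (I : {set 'I_n}) (B : pred nat) : (#|I| <= s)%N ->
  count (fun i => ~~ in_guess (enum_guess j I) s i && B i) (iota 0 n) =
  #|[set i in ~: (j |: I) | B i]|.
Proof.
move=> hI; rewrite count_ord; apply: eq_card => i.
by rewrite !inE enum_guessP // negb_or.
Qed.

(* If at most s indices lie outside O, guessing all of them yields O itself. *)
Lemma complement_guess r : r <= 1 -> (#|~: O| <= s)%N -> exists2 g : nat -> nat,
  forall l, (l < s.+1)%N -> (g l < n)%N &
  forall y, guess_init n k s g y -> r * f O <= orc (out g y).
Proof.
move=> r1 hs; case/andP: k_range => k0 kn.
have [j hj] : exists j, j \in O by apply/set0Pn; rewrite -card_gt0 card_O.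
exists (enum_guess j (~: O)).
  by case=> [|l] _ /=; exact: ltn_ord.
move=> y hy; apply: le_trans (_ : f O <= _); first by rewrite ler_piMl // cov_ge0.
have gE := fun i : 'I_n => @enum_guessP n j (~: O) s i hs.
have jn : ~~ ~~ in_guess (enum_guess j (~: O)) s j by rewrite negbK gE eqxx.
rewrite cov_covP; apply: (all_free_value M (cut_ge0 S w_ge0) (ltn_ord j) jn k0
  (unit_stepE R n_gt0 K_gt0) (unit_step_gt0 R n_gt0 K_gt0) erefl
  (wj_le_total (cut_ge0 S w_ge0) cw_supp j) (sweeps_gt0 n_gt0 K_gt0)
  (sweeps_unit_step R n_gt0 K_gt0) hy).
- move=> i hi; rewrite -[i]/(val (Ordinal hi)) mem_nat_ord gE inE => -> hne.
  by rewrite orbF; apply: contra hne => /eqP->.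
- move=> i hi; rewrite -[i]/(val (Ordinal hi)) mem_nat_ord gE inE negb_or negbK.
  by case/andP.
- have := free_count j xpredT hs.
  rewrite (eq_count (a2 := fun i => ~~ in_guess (enum_guess j (~: O)) s i)) => [->|i];
    last by rewrite andbT.
  rewrite -card_O (cardsD1 j O) hj /=; apply: eq_card => i.
  by rewrite !inE negb_or negbK andbT.
Qed.

Lemma mixed_guess (c al r : R) : 0 < c < 1 -> 0 < al < 1 -> r < 1 ->
  k%:R = c * n%:R -> 1 < c * s.+1%:R ->
  (forall m, (0 < m)%N -> sigma c al m <= 1 - r) ->
  (0 < M)%N -> (1 - al * c) ^+ M <= 1 - r -> 2%:R <= (1 - r) * K%:R ->
  (s <= #|~: O|)%N -> exists2 g : nat -> nat,
  forall l, (l < s.+1)%N -> (g l < n)%N &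
  forall y, guess_init n k s g y -> r * f O <= orc (out g y).
Proof.
move=> c_r al_r r1 hk hcs hsig M0 hM hK hs; case/andP: k_range => k0 kn.
have [I sI cI] := subset_of_card hs.
have [j hj hW] := best_member.
have hI : (#|I| <= s)%N by rewrite cI.
have jI : j \notin I by apply/negP => /(subsetP sI); rewrite inE hj.
exists (enum_guess j I).
  by case=> [|l] _ /=; exact: ltn_ord.
move=> y hy; have gE := fun i : 'I_n => @enum_guessP n j I s i hI.
have jn : ~~ ~~ in_guess (enum_guess j I) s j by rewrite negbK gE eqxx.
rewrite cov_covP; apply: (guess_value (cut_ge0 S w_ge0) (ltn_ord j) jn k0
  (unit_stepE R n_gt0 K_gt0) (unit_step_gt0 R n_gt0 K_gt0) erefl
  (wj_le_total (cut_ge0 S w_ge0) cw_supp j) (sweeps_gt0 n_gt0 K_gt0)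
  (sweeps_unit_step R n_gt0 K_gt0) hy _ _ c_r al_r hsig M0 hM).
- by rewrite mem_nat_ord.
- move=> i hi; rewrite -[i]/(val (Ordinal hi)) mem_nat_ord gE => hO hne.
  rewrite negb_or; apply/andP; split; first by apply: contra hne => /eqP->.
  by apply/negP => /(subsetP sI); rewrite inE hO.
- rewrite free_count // -card_O (cardsD1 j O) hj /=; apply: eq_card => i.
  rewrite !inE mem_nat_ord negb_or -andbA; case: (boolP (i \in O)) => hi; last by rewrite !andbF.
  by rewrite !andbT; case: (boolP (i \in I)) => [/(subsetP sI)|]; rewrite ?inE ?hi ?andbT.
- have := free_count j xpredT hI.
  rewrite (eq_count (a2 := fun i => ~~ in_guess (enum_guess j I) s i)) => [->|i];
    last by rewrite andbT.
  have -> : [set i in ~: (j |: I) | xpredT (i : nat)] = ~: (j |: I).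
    by apply/setP => i; rewrite inE andbT.
  have := cardsC (j |: I); rewrite card_ord cardsU1 jI cI /= add1n => hc.
  have -> : #|~: (j |: I)|%:R = n%:R - s.+1%:R :> R.
    by apply/eqP; rewrite eq_sym subr_eq addrC -natrD eqr_nat hc.
  have -> : k.-1%:R = k%:R - 1 :> R by rewrite -[in RHS](prednK k0) -natr1 addrK.
  (* There are n - s - 1 free indices, and c (n - s - 1) = k - c (s + 1) < k - 1. *)
  by rewrite mulrBr -hk; lra.
(* The error 2 delta W n is at most 2 delta n^3 f({j}) = (2 / K) f({j}), hence at most (1 - r)
   f({j}) by the choice of K. *)
- rewrite -cov_set1 //; set u := unit_step R n K.
  have u0 : 0 < u by apply: unit_step_gt0.
  have uE : K%:R * (n%:R * n%:R * n%:R * u) = 1.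
    by rewrite -[RHS](unit_stepE R n_gt0 K_gt0) !natrM -/u; ring.
  set t := n%:R * n%:R * n%:R * u in uE.
  clearbody u; have u0' := ltW u0; have t0 : 0 <= t by rewrite /t !mulr_ge0 ?ler0n.
  have f0 : 0 <= f [set j] by apply: cov_ge0.
  apply: le_trans (_ : 2%:R * t * f [set j] <= _).
    have -> : 2%:R * t * f [set j] = 2%:R * u * n%:R * (n%:R * n%:R * f [set j]).
      by rewrite /t; ring.
    rewrite mulrAC; apply: ler_wpM2l hW.
    by rewrite !mulr_ge0 ?ler0n.
  rewrite ler_wpM2r //; have := ler_wpM2r t0 hK; rewrite -mulrA uE mulr1 //.
Qed.

End Optimum.

(** Machine, feasibility and search over guesses, shared by the cases c = 1 and c < 1; what is left
    to each case is a good guess for an optimum. *)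
Lemma algorithm_correct (R : realType) (c r : R) (s M K : nat) :
  0 < c <= 1 -> (0 < K)%N ->
  (forall n k (E : finType) (w : E -> R) (S : 'I_n -> {set E}) (O : {set 'I_n}),
     k%:R = c * n%:R -> (forall e, 0 <= w e) -> (0 < n)%N -> (0 < k <= n)%N ->
     #|O| = k -> (forall Y : {set 'I_n}, (#|Y| <= k)%N -> cov S w Y <= cov S w O) ->
     exists2 g : nat -> nat, forall l, (l < s.+1)%N -> (g l < n)%N &
       forall y, guess_init n k s g y -> r * cov S w O <=
         orcE n (cut w S) (hit S) (out_mask n M (g 0%N) (cut w S) (hit S)
           (sweeps n K) (unit_step R n K) (threshold n K (cut w S) (hit S)) y)) ->
  r <= 1 ->
  exists (P : seq instr) (a d : nat),
    forall (n k : nat) (E : finType) (w : E -> R) (S : 'I_n -> {set E}),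
      k%:R = c * n%:R ->
      (forall e, 0 <= w e) ->
      exists fin : config R,
        exec P (fun m => cov S w (decode n m)) (a * n ^ d + a)%N (init R n k)
          = Some fin /\
        (#|decode n (nreg fin 0)| <= k)%N /\
        (forall Y : {set 'I_n}, (#|Y| <= k)%N ->
           r * cov S w Y <= cov S w (decode n (nreg fin 0))).
Proof.
move=> /andP[c0 c1] K0 H r1.
have [a [d PH]] := program_exec R s M K.
exists (program s M K), a, d => n k E w S hk w0.
have [fin [ef nf]] := PH n k (orcE n (cut w S) (hit S)).
exists fin; split; first by rewrite -ef; apply: exec_ext => m; apply: cov_decode.
(* For n = 0 there is no index to guess, but the empty set is the only candidate. *)
have [n0|n0] := posnP n.
  have card0 (Y : {set 'I_n}) : Y = set0.
    by apply/eqP; rewrite -cards_eq0 -leqn0 -[X in (_ <= X)%N]n0 -[X in (_ <= X)%N]card_ord max_card.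
  split; first by rewrite (card0 (decode _ _)) cards0.
  move=> Y _; rewrite (card0 Y) (card0 (decode _ _)).
  by rewrite /cov big_set0 big_set0 mulr0.
have k0 : (0 < k)%N by rewrite -(ltr_nat R) hk mulr_gt0 // ltr0n.
have kn : (k <= n)%N by rewrite -(ler_nat R) hk ler_piMl // ler0n.
have kr : (0 < k <= n)%N by rewrite k0 kn.
have [O [cO hO]] := @optimum_exists R n k E w S w0 kr.
have [g gn hg] := H n k E w S O hk w0 n0 kr cO hO.
have [hc hv] := main_run (cut_ge0 S w0) n0 k0 K0 (@cw_supp _ _ _ _ _) gn hg.
rewrite -/(result n k s M K (cut w S) (hit S)) in nf.
rewrite nf; split.
  apply: leq_trans hc; rewrite /decode -sum1_card big_mkord big_mkcond leq_sum // => i _.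
  by rewrite inE /bit; case: odd.
move=> Y cY; rewrite cov_decode.
(* Only r <= 1 is known here; for negative r the bound holds because coverage is nonnegative. *)
have [hr|hr] := lerP 0 r.
  by apply: le_trans hv; rewrite ler_wpM2l // hO.
apply: le_trans (_ : 0 <= _); first by rewrite nmulr_rle0 // cov_ge0.
by apply: orcE_ge0 => e; apply: cut_ge0.
Qed.

Theorem theorem1p2 (R : realType) (c : R) :
  0 < c <= 1 ->
  forall r : R, is_rho c r ->
  exists (P : seq instr) (a d : nat),
    forall (n k : nat) (E : finType) (w : E -> R) (S : 'I_n -> {set E}),
      k%:R = c * n%:R ->
      (forall e, 0 <= w e) ->
      exists fin : config R,
        exec P (fun m => cov S w (decode n m)) (a * n ^ d + a)%N (init R n k)
          = Some fin /\
        (#|decode n (nreg fin 0)| <= k)%N /\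
        (forall Y : {set 'I_n}, (#|Y| <= k)%N ->
           r * cov S w Y <= cov S w (decode n (nreg fin 0))).
Proof.
move=> hc r hr; have [[ec er]|[s [al [hcs c1 al_r r1 hsig]]]] := rho_cases hc hr.
  (* For c = 1 the optimum is the full set, so its complement is empty and already s = 0 admits the
     complement guess. *)
  apply: (@algorithm_correct R c r 0 1 1) => //; last by rewrite er.
  move=> n k E w S O hk w0 n0 kr cO hO.
  apply: complement_guess => //; first by rewrite er.
  have ekn : k = n by apply/eqP; rewrite -(eqr_nat R) hk ec mul1r.
  by have := cardsC O; rewrite card_ord cO ekn; lia.
case/andP: (hc) => c0 _; case/andP: (al_r) => a0 a1.
have [|M M0 hM] := @expr_small R (1 - al * c) (1 - r) _ (ltac:(by rewrite subr_gt0)).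
  by apply/andP; split; nra.
have r1' : 0 < 1 - r by rewrite subr_gt0.
(* Makes 2 / K at most 1 - r, the share of f({j}) that can absorb the error. *)
pose K := (Num.bound (2%:R / (1 - r))).+1.
have hK : 2%:R <= (1 - r) * K%:R.
  rewrite mulrC -ler_pdivrMr //; apply: ltW.
  apply: lt_trans (archi_boundP _) _; first by rewrite divr_ge0 // ltW.
  by rewrite ltr_nat.
apply: (@algorithm_correct R c r s M K) => //; last exact: ltW.
move=> n k E w S O hk w0 n0 kr cO hO.
have [hs|hs] := leqP #|~: O| s.
  by apply: complement_guess => //; exact: ltW.
by apply: (@mixed_guess _ _ _ _ _ _ _ _ _ w0 n0 kr _ _ cO hO c al) => //; [rewrite c0|exact: ltnW].
Qed.
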